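(* Let $\phi$ be a Drinfeld $A[\underline{t}_s]$-module of rank $r$ over $\mathbb{T}_s$ with $\phi_\theta=\theta + A_1\tau + \dots + A_r\tau^r$ such that (i) $A_r \in \mathbb{T}_s^{\times}$, and (ii) $\Lambda_{\phi}$ is a free and finitely generated $A[\underline{t}_s]$-module. Then the following are equivalent: (a) $\Lambda_{\phi}$ is free of rank $r$ over $A[\underline{t}_s]$; (b) $\phi$ has a rigid analytic trivialization; (c) the de Rham map $\mathrm{DR}$ is an isomorphism; (d) $\phi$ is uniformizable, and $\phi[\theta]$ is free of rank $r$ over $\mathbb{F}_q[\underline{t}_s]$.
   Context: Let $\mathbb{F}_q$ be a finite field with $q$ elements, $\theta,t_1,\dots,t_s,z$ independent variables, $A=\mathbb{F}_q[\theta]$, $A[\underline{t}_s]=\mathbb{F}_q[\theta,t_1,\dots,t_s]$, $\mathbb{F}_q[\underline{t}_s]=\mathbb{F}_q[t_1,\dots,t_s]$. $\mathbb{C}_\infty$ is the completion of an algebraic closure of $\mathbb{F}_q((1/\theta))$, $|\theta|_\infty=q$. $\mathbb{T}_s$ is the Tate algebra of power series in $t_1,\dots,t_s$ over $\mathbb{C}_\infty$ whose coefficients tend to $0$, with Gauss norm $\|\cdot\|_\infty$ (sup of absolute values of coefficients). The automorphism $\tau$ raises every $\mathbb{C}_\infty$-coefficient to its $q$-th power, $f^{(n)}=\tau^n(f)$ ($n\in\mathbb{Z}$), applied entrywise to matrices and coefficientwise to power series in $z$ (fixing $z$). $\mathbb{T}_s[\tau]$, $\mathbb{T}_s[[\tau]]$: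 twisted rings with $\tau f=f^{(1)}\tau$, acting on $\mathbb{T}_s$ by $\sum a_i\tau^i(f)=\sum a_if^{(i)}$. A Drinfeld $A[\underline{t}_s]$-module of rank $r$ is an $\mathbb{F}_q[\underline{t}_s]$-algebra homomorphism $\phi:A[\underline{t}_s]\to\mathbb{T}_s[\tau]$ with $\phi_\theta=\theta+A_1\tau+\dots+A_r\tau^r$, $A_r\ne0$. Its exponential $\exp_\phi=\sum\alpha_i\tau^i$ is the unique series with $\alpha_0=1$, $\exp_\phi a=\phi_a\exp_\phi$ for all $a\in A[\underline{t}_s]$; it converges on all of $\mathbb{T}_s$, giving $\exp_\phi:\mathbb{T}_s\to\mathbb{T}_s$, and $\Lambda_\phi=\ker\exp_\phi$. $\phi$ is uniformizable if $\exp_\phi:\mathbb{T}_s\to\mathbb{T}_s$ is surjective. $\phi[\theta]=\{f\in\mathbb{T}_s:\phi_\theta(f)=0\}$. Rigid analytic trivialization: let $\mathbb{T}_s\{z/\theta\}=\{\sum_{i\ge0}a_iz^i: a_i\in\mathbb{T}_s,\ q^i\|a_i\|_\infty\to0\}$, and let $\Phi\in\mathrm{Mat}_r(\mathbb{T}_s[z])$ be the matrix whose $i$-th row, for $1\le i\le r-1$, is the $(i+1)$-st standard basis row vector, and whose last row is $\big[(z-\theta)/A_r^{(-r)},\ -A_1^{(-1)}/A_r^{(-r)},\ \dots,\ -A_{r-1}^{(-r+1)}/A_r^{(-r)}\big]$. A rigid analytic trivialization is a $\Psi\in\mathrm{GL}_r(\mathbb{T}_s\{z/\theta\})$ with $\Psi^{(-1)}=\Phi\Psi$.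 De Rham map: a biderivation is an $\mathbb{F}_q[\underline{t}_s]$-linear $\eta:A[\underline{t}_s]\to\tau\mathbb{T}_s[\tau]$ with $\eta_{ab}=a\eta_b+\eta_a\phi_b$; $\mathrm{Der}(\phi)$ is the left $\mathbb{T}_s$-module of biderivations ($(f\eta)_a=f\eta_a$), $\mathrm{Der}_{si}(\phi)$ the submodule of $\eta^{\{m\}}_a=m\phi_a-am$ with $m\in\tau\mathbb{T}_s[\tau]$, and $H^*_{\mathrm{DR}}(\phi)=\mathrm{Der}(\phi)/\mathrm{Der}_{si}(\phi)$. For $\eta$, $F_\eta$ is the unique element of $\tau\mathbb{T}_s[[\tau]]$ with $F_\eta\theta-\theta F_\eta=\eta_\theta\exp_\phi$; it converges on $\mathbb{T}_s$, and $\mathrm{DR}:H^*_{\mathrm{DR}}(\phi)\to\operatorname{Hom}_{A[\underline{t}_s]}(\Lambda_\phi,\mathbb{T}_s)$, $[\eta]\mapsto F_\eta|_{\Lambda_\phi}$, is a well-defined $\mathbb{T}_s$-linear map. *)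

(* Defs.v *)
From HB Require Import structures.
From mathcomp Require Import all_boot all_order all_algebra.
From mathcomp Require Import reals.
Set Implicit Arguments. Unset Strict Implicit. Unset Printing Implicit Defensive.
Import Order.TTheory GRing.Theory Num.Theory.
Local Open Scope ring_scope.

Section Drinfeld.

Variable F : finFieldType.
Context {C : closedFieldType} {R : realType}.
Variable iota : {rmorphism F -> C}.
Variable theta : C.
Variable abs : C -> R.

Definition q : nat := #|F|.

(* complete, algebraically closed (closedFieldType), non-archimedean,
   |theta| = q, and the algebraic closure of F_q(theta) is dense.
   Any such field is isometrically isomorphic to C_oo. *)
Definition c_cauchy (u : nat -> C) :=
  forall e : R, 0 < e -> exists N, forall n m, (N <= n)%N -> (N <= m)%N ->
    abs (u n - u m) < e.
Definition c_lim (u : nat -> C) (l : C) :=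
  forall e : R, 0 < e -> exists N, forall n, (N <= n)%N -> abs (u n - l) < e.

Definition is_Cinf : Prop :=
  [/\ (forall x, 0 <= abs x),
      (forall x, abs x = 0 <-> x = 0),
      (forall x y, abs (x * y) = abs x * abs y),
      (forall x y, abs (x + y) <= Num.max (abs x) (abs y))
    & abs theta = q%:R] /\
  (forall u, c_cauchy u -> exists l, c_lim u l) /\
      (forall x (e : R), 0 < e -> exists y n (c : 'I_n.+1 -> {poly F}),
         [/\ (exists i, c i != 0),
             \sum_(i < n.+1) (map_poly iota (c i)).[theta] * y ^+ i = 0
           & abs (x - y) < e]).

Lemma frob_surj (x : C) : exists y : C, y ^+ q == x.
Proof.
have q_gt0 : (0 < q)%N by rewrite /q; apply/card_gt0P; exists 0.
have [y Hy] := @solve_monicpoly C q (fun i => if i == 0%N then x else 0) q_gt0.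
exists y; apply/eqP; rewrite Hy (bigD1 (Ordinal q_gt0)) //= expr0 mulr1 big1 ?addr0 //.
by move=> i /negbTE; rewrite -val_eqE /= => ->; rewrite mul0r.
Qed.

Definition frob_inv (x : C) : C := xchoose (frob_surj x).

Definition frobz (n : int) (x : C) : C :=
  match n with
  | Posz k => iter k (fun y => y ^+ q) x
  | Negz k => iter k.+1 frob_inv x
  end.

Variable s : nat.
Definition mon := {ffun 'I_s -> nat}.
Definition mdeg (m : mon) : nat := (\sum_i m i)%N.
Definition mon0 : mon := [ffun => 0%N].
Definition tser := mon -> C.                   (* formal power series in t_1..t_s *)

Definition tate (f : tser) : Prop :=
  forall e : R, 0 < e -> exists N, forall m, (N <= mdeg m)%N -> abs (f m) < e.

Definition tzero : tser := fun _ => 0.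
Definition tconst (c : C) : tser := fun m => if m == mon0 then c else 0.
Definition tone : tser := tconst 1.
Definition tadd (f g : tser) : tser := fun m => f m + g m.
Definition tsub (f g : tser) : tser := fun m => f m - g m.
Definition tmul (f g : tser) : tser := fun m =>
  \sum_(a : {ffun 'I_s -> 'I_(mdeg m).+1} | [forall i, (a i <= m i)%N])
     f [ffun i => nat_of_ord (a i)] * g [ffun i => (m i - a i)%N].
Definition tsum n (u : 'I_n -> tser) : tser := fun m => \sum_(i < n) u i m.
Definition twist (n : int) (f : tser) : tser := fun m => frobz n (f m).
Definition tconv (u : nat -> tser) (g : tser) : Prop :=
  forall e : R, 0 < e -> exists N, forall n, (N <= n)%N ->
    forall m, abs (u n m - g m) < e.

Definition inA (c : C) := exists p : {poly F}, c = (map_poly iota p).[theta].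
Definition inAt (f : tser) : Prop :=
  (forall m, inA (f m)) /\ exists N, forall m, (N <= mdeg m)%N -> f m = 0.
Definition inFt (f : tser) : Prop :=
  (forall m, exists c : F, f m = iota c) /\
  exists N, forall m, (N <= mdeg m)%N -> f m = 0.

(* M (a predicate on T_s, a P-submodule) is free of rank n over the ring P *)
Definition free_rank (P M : tser -> Prop) (n : nat) : Prop :=
  exists b : 'I_n -> tser,
  [/\ forall i, M (b i),
      forall x, M x -> exists c : 'I_n -> tser,
        (forall i, P (c i)) /\ x = tsum (fun i => tmul (c i) (b i))
    & forall c : 'I_n -> tser, (forall i, P (c i)) ->
        tsum (fun i => tmul (c i) (b i)) = tzero -> forall i, c i = tzero].

Variable r : nat.
Variable A : nat -> tser.

Definition phi_theta (f : tser) : tser :=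
  tadd (tmul (tconst theta) f)
       (fun m => \sum_(1 <= i < r.+1) tmul (A i) (twist (Posz i) f) m).

(* coefficients alpha_n of exp_phi : alpha_0 = 1 and exp_phi theta = phi_theta exp_phi,
   i.e. alpha_n (theta^(q^n) - theta) = sum_{j=1}^{min(n,r)} A_j alpha_{n-j}^(j) *)
Fixpoint expl (n : nat) : seq tser :=
  if n is n'.+1 then
    let l := expl n' in
    rcons l (fun m => (\sum_(1 <= j < (minn n r).+1)
               tmul (A j) (twist (Posz j) (nth tzero l (n - j))) m)
              / (frobz (Posz n) theta - theta))
  else [:: tone].
Definition alpha (n : nat) : tser := nth tzero (expl n) n.

Definition expR (f g : tser) : Prop :=
  tconv (fun N m => \sum_(i < N) tmul (alpha i) (twist (Posz i) f) m) g.

Definition Lambda (f : tser) : Prop := tate f /\ expR f tzero.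
Definition uniformizable : Prop :=
  forall g, tate g -> exists f, tate f /\ expR f g.
Definition phi_torsion (f : tser) : Prop := tate f /\ phi_theta f = tzero.

(* ---------- twisted series (elements of T_s[[tau]]) ---------- *)
Definition tw := nat -> tser.
Definition tw_mul (u v : tw) : tw := fun n m =>
  \sum_(k < n.+1) tmul (u k) (twist (Posz k) (v (n - k)%N)) m.
Definition phiw : tw := fun n =>
  if n == 0%N then tconst theta else if (n <= r)%N then A n else tzero.
Definition thetaw : tw := fun n => if n == 0%N then tconst theta else tzero.
Definition taupoly (u : tw) : Prop :=
  [/\ u 0%N = tzero, forall n, tate (u n)
    & exists N, forall n, (N <= n)%N -> u n = tzero].

(* A biderivation eta is determined by eta_theta in tau T_s[tau], and every such
   element arises; eta is inner (in Der_si) iff eta_theta = m phi_theta - theta m. *)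
Definition in_Dersi (eta : tw) : Prop :=
  exists mm, taupoly mm /\ forall n, eta n = tsub (tw_mul mm phiw n) (tw_mul thetaw mm n).

(* F_eta in tau T_s[[tau]] with F_eta theta - theta F_eta = eta_theta exp_phi *)
Definition Fco (eta : tw) : tw := fun n =>
  if n == 0%N then tzero
  else fun m => tw_mul eta alpha n m / (frobz (Posz n) theta - theta).
Definition Fev (eta : tw) (f g : tser) : Prop :=
  tconv (fun N m => \sum_(i < N) tmul (Fco eta i) (twist (Posz i) f) m) g.

Definition AHom (h : tser -> tser) : Prop :=
  (forall l, Lambda l -> tate (h l)) /\
  forall a b l l', inAt a -> inAt b -> Lambda l -> Lambda l' ->
    h (tadd (tmul a l) (tmul b l')) = tadd (tmul a (h l)) (tmul b (h l')).

Definition DR_iso : Prop :=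
  (forall e1 e2, taupoly e1 -> taupoly e2 ->
     (forall l, Lambda l -> exists g, Fev e1 l g /\ Fev e2 l g) ->
     in_Dersi (fun n => tsub (e1 n) (e2 n))) /\
  (forall h, AHom h -> exists eta, taupoly eta /\ forall l, Lambda l -> Fev eta l (h l)).

Definition zser := nat -> tser.  (* sum_i a_i z^i *)
Definition zTate (a : zser) : Prop :=
  (forall n, tate (a n)) /\
  forall e : R, 0 < e -> exists N, forall n, (N <= n)%N ->
    forall m, (q%:R) ^+ n * abs (a n m) < e.
Definition zmul (a b : zser) : zser := fun n m =>
  \sum_(k < n.+1) tmul (a k) (b (n - k)%N) m.
Definition zconst (f : tser) : zser := fun n => if n == 0%N then f else tzero.
Definition mxz := 'I_r -> 'I_r -> zser.
Definition mxmul (P Q : mxz) : mxz := fun i j n m =>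
  \sum_(l < r) zmul (P i l) (Q l j) n m.
Definition mxone : mxz := fun i j => zconst (if i == j then tone else tzero).

(* Phi, with B = A_r^{-1} *)
Definition Phi (B : tser) : mxz := fun i j =>
  if (i < r.-1)%N then zconst (if nat_of_ord j == i.+1 then tone else tzero)
  else if nat_of_ord j == 0%N then
    (fun n => if n == 0%N then tmul (tconst (- theta)) (twist (- Posz r) B)
              else if n == 1%N then twist (- Posz r) B else tzero)
  else zconst (tmul (tsub tzero (twist (- Posz j) (A j))) (twist (- Posz r) B)).

Definition has_RAT (B : tser) : Prop :=
  exists Psi Psi' : mxz,
  [/\ forall i j, zTate (Psi i j) /\ zTate (Psi' i j),
      mxmul Psi Psi' = mxone, mxmul Psi' Psi = mxone
    & (fun i j n => twist (-1) (Psi i j n)) = mxmul (Phi B) Psi].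

End Drinfeld.

(* Main.v *)
(** Let S be the ring of power series in z over T_s whose coefficients tend
    to 0, tau acting on coefficients, and let P = phi_theta - z act on S.
    The map l |-> f_l = sum_n exp_phi(l / theta^(n+1)) z^n identifies
    Lambda_phi with ker P, with theta corresponding to z.  A closed Frobenius-stable
    C_oo-subspace is topologically spanned by its F_q-valued vectors; hence S-linear
    relations among elements of ker P descend to S^tau = F_q[t, z], and
    a basis f_1, ..., f_r of ker P has a Moore determinant that is a unit of S.
    A triangular matrix turns this Moore matrix into the inverse of a rigid
    analytic trivialization, the recursions for the coefficients giving
    the convergence at |z| <= q; conversely the last column of Psi^-1 recovers
    the f_i.  At z = theta, tau^k f_l becomes the value at l of the F_eta with
    eta_theta = tau^k, so modulo inner biderivations DR is given by an invertible
    r x r matrix.  Variation of constants solves P x = g, since tau - 1 is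
    surjective on S, and yields uniformizability; exp_phi(l_i / theta) is then
    a basis of the theta-torsion.  The implications back to (a) compare ranks. *)
Require Import Defs.
From HB Require Import structures.
From mathcomp Require Import all_boot all_order all_algebra finfield.
From mathcomp Require Import boolp reals.
From mathcomp Require Import lra zify ring.
Set Implicit Arguments. Unset Strict Implicit. Unset Printing Implicit Defensive.
Import Order.TTheory GRing.Theory Num.Theory.
Local Open Scope ring_scope.

(** * Formal power series *)

(** Two facts replace them: the Gauss norm on S is multiplicative, so divisibility by a given
    element is a closed condition, and a closed Frobenius-stable submodule is controlled by its
    tau-fixed vectors. The Moore determinant then has to be tested only against fixed divisors c. If
    c divides a fixed combination of the f_i, the quotient is again killed by P, hence comes from
    the lattice, and freeness of the lattice makes the coefficients divisible by c.

    For a nonzero period l the series f_l has a pole at z = theta. It lives at radius 1 but not at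
    radius q, which is why the linear algebra takes place in S and why only the twists tau^k f_l
    with k >= 1 enter the trivialization and the quasi-periods.

    Scalars in A[t] are exchanged for tau-fixed scalars in F_q[t, z] by evaluation at z = theta,
    which is injective there because theta is transcendental over F_q. *)

Section Monomials.
Variable s : nat.
Implicit Types m a b c : mon s.

Definition mle a m := [forall i, (a i <= m i)%N].
Definition madd a b : mon s := [ffun i => (a i + b i)%N].
Definition msub m a : mon s := [ffun i => (m i - a i)%N].
(** The index type of the sum in [tmul] varies with m. A duplicate-free list of monomials can be
    reindexed by permutation across different m. *)
Definition mbelow m : seq (mon s) :=
  [seq [ffun i => nat_of_ord (a i)] | a : {ffun 'I_s -> 'I_(mdeg m).+1} <- enum {ffun 'I_s -> 'I_(mdeg m).+1} &
     [forall i, (a i <= m i)%N]].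

Lemma mleP a m : reflect (forall i, (a i <= m i)%N) (mle a m).
Proof. exact: forallP. Qed.

Lemma leq_mdeg m i : (m i <= mdeg m)%N.
Proof. by rewrite /mdeg (bigD1 i) //= leq_addr. Qed.

Lemma mbelow_uniq m : uniq (mbelow m).
Proof.
rewrite map_inj_in_uniq; first exact/filter_uniq/enum_uniq.
move=> a b _ _ /ffunP eab.
by apply/ffunP => i; apply: val_inj; have := eab i; rewrite !ffunE.
Qed.

Lemma mem_mbelow m a : (a \in mbelow m) = mle a m.
Proof.
apply/mapP/mleP => [[b] | am].
  by rewrite mem_filter => /andP[/forallP bm _] -> i; rewrite ffunE.
have lt i : (a i < (mdeg m).+1)%N by rewrite ltnS (leq_trans (am i)) ?leq_mdeg.
exists [ffun i => Ordinal (lt i)].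
  rewrite mem_filter mem_enum andbT; apply/forallP => i.
  by rewrite ffunE /=.
by apply/ffunP => i; rewrite !ffunE.
Qed.

Lemma msubK m a : mle a m -> msub m (msub m a) = a.
Proof. by move/mleP=> am; apply/ffunP=> i; rewrite !ffunE subKn. Qed.

Lemma mle_sub m a : mle (msub m a) m.
Proof. by apply/mleP=> i; rewrite ffunE leq_subr. Qed.

Lemma maddK a b : msub (madd a b) a = b.
Proof. by apply/ffunP=> i; rewrite !ffunE addKn. Qed.

Lemma mle_addr a b : mle a (madd a b).
Proof. by apply/mleP=> i; rewrite ffunE leq_addr. Qed.

Lemma maddBn m a : mle a m -> madd a (msub m a) = m.
Proof. by move/mleP=> am; apply/ffunP=> i; rewrite !ffunE subnKC. Qed.

Lemma mdeg_add a b : mdeg (madd a b) = (mdeg a + mdeg b)%N.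
Proof. by rewrite /mdeg -big_split /=; apply: eq_bigr => i _; rewrite ffunE. Qed.

Lemma mdeg_sub m a : mle a m -> (mdeg a + mdeg (msub m a))%N = mdeg m.
Proof. by move=> am; rewrite -mdeg_add maddBn. Qed.

Lemma mdeg0 : mdeg (mon0 s) = 0%N.
Proof. by rewrite /mdeg big1 // => i _; rewrite ffunE. Qed.

Lemma mle0 m : mle (mon0 s) m.
Proof. by apply/mleP=> i; rewrite ffunE. Qed.

Lemma msub0 m : msub m (mon0 s) = m.
Proof. by apply/ffunP=> i; rewrite !ffunE subn0. Qed.

End Monomials.

Section TateRing.
Variables (C : closedFieldType) (s : nat).
Local Notation ts := (@tser C s).
Implicit Types f g h : ts.

Lemma tmulE f g (m : mon s) : tmul f g m = \sum_(a <- mbelow m) f a * g (msub m a).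
Proof.
rewrite /mbelow big_map big_filter /= /tmul big_enum_cond /=.
apply: eq_bigr => a _; congr (_ * g _).
by apply/ffunP => i; rewrite !ffunE.
Qed.

Lemma tmulC : commutative (@tmul C s).
Proof.
move=> f g; apply: funext => m; rewrite !tmulE.
have pm : perm_eq (mbelow m) [seq msub m a | a <- mbelow m].
  apply: uniq_perm; rewrite ?mbelow_uniq //.
    rewrite map_inj_in_uniq ?mbelow_uniq // => a b; rewrite !mem_mbelow => am bm e.
    by rewrite -(msubK am) e msubK.
  move=> a; rewrite mem_mbelow; apply/idP/mapP => [am | [b _ ->]]; last exact: mle_sub.
  by exists (msub m a); rewrite ?mem_mbelow ?mle_sub ?msubK.
rewrite (perm_big _ pm) big_map; apply: eq_big_seq => a; rewrite mem_mbelow => am.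
by rewrite msubK // mulrC.
Qed.

Lemma mbelow_sub (m b : mon s) : mle b m ->
  perm_eq [seq a <- mbelow m | mle b a] [seq madd b c | c <- mbelow (msub m b)].
Proof.
move=> bm; apply: uniq_perm; rewrite ?filter_uniq ?mbelow_uniq //.
  by rewrite map_inj_in_uniq ?mbelow_uniq // => a c _ _ e; rewrite -(maddK b a) e maddK.
move=> a; rewrite mem_filter mem_mbelow; apply/andP/mapP => [[ba am] | [c]].
  exists (msub a b); last by rewrite maddBn.
  rewrite mem_mbelow; apply/mleP=> i; rewrite !ffunE leq_sub2r //; exact: (mleP _ _ am).
rewrite mem_mbelow => /mleP cm ->; split; first exact: mle_addr.
apply/mleP=> i; have := cm i; rewrite !ffunE => ?.
by rewrite -(subnKC (mleP _ _ bm i)) leq_add2l.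
Qed.

Lemma tmulA : associative (@tmul C s).
Proof.
move=> f g h; apply: funext => m; rewrite !tmulE.
transitivity (\sum_(b <- mbelow m) \sum_(c <- mbelow (msub m b))
                f b * g c * h (msub m (madd b c))).
  apply: eq_bigr => b _; rewrite tmulE mulr_sumr; apply: eq_bigr => c _.
  by rewrite mulrA; congr (_ * h _); apply/ffunP=> i; rewrite !ffunE subnDA.
transitivity (\sum_(a <- mbelow m) \sum_(b <- mbelow m | mle b a)
                f b * g (msub a b) * h (msub m a)).
  rewrite [RHS](exchange_big_dep predT) //=; apply: eq_big_seq => b; rewrite mem_mbelow => bm.
  rewrite -[RHS]big_filter (perm_big _ (mbelow_sub bm)) [RHS]big_map.
  by apply: eq_bigr => c _; rewrite maddK.
apply: eq_big_seq => a; rewrite mem_mbelow => am; rewrite tmulE mulr_suml.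
rewrite -[LHS]big_filter; apply: perm_big; apply: uniq_perm; rewrite ?filter_uniq ?mbelow_uniq //.
move=> b; rewrite mem_filter !mem_mbelow; apply/andP/idP => [[]// | ba]; split=> //.
by apply/mleP=> i; apply: leq_trans (mleP _ _ ba i) (mleP _ _ am i).
Qed.

Lemma tconst_mulE (c : C) f : tmul (tconst c) f = fun m => c * f m.
Proof.
apply: funext => m; rewrite tmulE (bigD1_seq (mon0 s)) ?mem_mbelow ?mle0 ?mbelow_uniq //=.
rewrite /tconst eqxx msub0 big1 ?addr0 // => a /negbTE ->; exact: mul0r.
Qed.

Lemma tmul1 : left_id (@tone C s) (@tmul C s).
Proof. by move=> f; rewrite tconst_mulE; apply: funext => m; rewrite mul1r. Qed.

Lemma tmulDl : left_distributive (@tmul C s) (@tadd C s).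
Proof.
move=> f g h; apply: funext => m; rewrite /tadd !tmulE -big_split /=.
by apply: eq_bigr => a _; rewrite mulrDl.
Qed.

Definition topp f : ts := fun m => - f m.

Lemma taddA : associative (@tadd C s).
Proof. by move=> f g h; apply: funext => m; rewrite /tadd addrA. Qed.
Lemma taddC : commutative (@tadd C s).
Proof. by move=> f g; apply: funext => m; rewrite /tadd addrC. Qed.
Lemma tadd0 : left_id (@tzero C s) (@tadd C s).
Proof. by move=> f; apply: funext => m; rewrite /tadd add0r. Qed.
Lemma taddN : left_inverse (@tzero C s) topp (@tadd C s).
Proof. by move=> f; apply: funext => m; rewrite /tadd addNr. Qed.

HB.instance Definition _ := gen_eqMixin ts.
HB.instance Definition _ := gen_choiceMixin ts.
HB.instance Definition _ := GRing.isZmodule.Build ts taddA taddC tadd0 taddN.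

Lemma tone_neq0 : @tone C s != 0 :> ts.
Proof.
apply/eqP => /(congr1 (fun f : ts => f (mon0 s))) /eqP.
by rewrite /tone /tconst eqxx oner_eq0.
Qed.

HB.instance Definition _ :=
  GRing.Zmodule_isComNzRing.Build ts tmulA tmulC tmul1 tmulDl tone_neq0.

Lemma tmul_mulE f g : tmul f g = f * g. Proof. by []. Qed.
Lemma tcoefD f g m : (f + g) m = f m + g m. Proof. by []. Qed.
Lemma tcoefN f m : (- f) m = - f m. Proof. by []. Qed.
Lemma tcoefB f g m : (f - g) m = f m - g m. Proof. by []. Qed.
Lemma tcoef0 m : (0 : ts) m = 0. Proof. by []. Qed.
Lemma tcoef_sum I (r : seq I) (P : pred I) (u : I -> ts) m :
  (\sum_(i <- r | P i) u i) m = \sum_(i <- r | P i) u i m.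
Proof. by elim/big_rec2: _ => //= i x y _ <-. Qed.
Lemma tsumE n (u : 'I_n -> ts) : tsum u = \sum_i u i.
Proof. by apply: funext => m; rewrite tcoef_sum. Qed.
Lemma tsubE f g : tsub f g = f - g. Proof. by []. Qed.
Lemma tcoef_constM c f m : ((tconst c : ts) * f) m = c * f m.
Proof. by rewrite -tmul_mulE tconst_mulE. Qed.
Lemma tconstM c d : (tconst (c * d) : ts) = (tconst c : ts) * tconst d.
Proof.
apply: funext => m; rewrite tcoef_constM /tconst.
by case: eqP; rewrite ?mulr0.
Qed.
Lemma tconstD c d : (tconst (c + d) : ts) = (tconst c : ts) + tconst d.
Proof. by apply: funext => m; rewrite tcoefD /tconst; case: eqP; rewrite ?addr0. Qed.
Lemma tconst0 : (tconst 0 : ts) = 0.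
Proof. by apply: funext => m; rewrite /tconst; case: eqP. Qed.
Lemma tconst1 : (tconst 1 : ts) = 1. Proof. by []. Qed.

End TateRing.

(** * Power series in z over series in t *)

Section ZRing.
Variables (C : closedFieldType) (s : nat).
Local Notation ts := (@tser C s).
Local Notation zs := (@zser C s).
Implicit Types a b c : zs.

Definition zadd a b : zs := fun n => (a n : ts) + b n.
Definition zopp a : zs := fun n => - (a n : ts).
Definition zzero : zs := fun _ => 0.
Definition zone : zs := zconst (@tone C s).

(** A coefficient of a product involves finitely many terms, so associativity and commutativity are
    inherited from [{poly ts}]. *)
Definition ztrunc N a : {poly ts} := \poly_(i < N) (a i : ts).

Lemma zmulE a b n : zmul a b n = \sum_(k < n.+1) (a k : ts) * b (n - k)%N.
Proof. by apply: funext => m; rewrite tcoef_sum. Qed.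

Lemma zmul_trunc N a b n : (n < N)%N -> zmul a b n = (ztrunc N a * ztrunc N b)`_n.
Proof.
move=> nN; rewrite zmulE coefM; apply: eq_bigr => k _.
rewrite !coef_poly (leq_ltn_trans _ nN) ?leq_ord //.
by rewrite (leq_ltn_trans (leq_subr _ _) nN).
Qed.

Lemma ztrunc_zmul N a b k : (k < N)%N -> (ztrunc N (zmul a b))`_k = (ztrunc N a * ztrunc N b)`_k.
Proof. by move=> kN; rewrite coef_poly kN (zmul_trunc _ _ kN). Qed.

Lemma zmulA : associative (@zmul C s).
Proof.
move=> a b c; apply: funext => n; rewrite !(@zmul_trunc n.+1) //.
transitivity (ztrunc n.+1 a * (ztrunc n.+1 b * ztrunc n.+1 c))`_n.
  rewrite !coefM; apply: eq_bigr => k _; rewrite ztrunc_zmul // ltnS leq_subr //.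
rewrite mulrA !coefM; apply: eq_bigr => k _.
by rewrite ztrunc_zmul.
Qed.

Lemma zmulC : commutative (@zmul C s).
Proof. by move=> a b; apply: funext => n; rewrite !(@zmul_trunc n.+1) // mulrC. Qed.

Lemma zmul_const (f : ts) a n : zmul (zconst f) a n = f * (a n : ts).
Proof.
rewrite zmulE big_ord_recl /= subn0 big1 ?addr0 // => i _; rewrite /zconst /=.
exact: mul0r.
Qed.

Lemma zmul1 : left_id zone (@zmul C s).
Proof. by move=> a; apply: funext => n; rewrite zmul_const mul1r. Qed.

Lemma zmulDl : left_distributive (@zmul C s) zadd.
Proof.
move=> a b c; apply: funext => n; rewrite /zadd !zmulE -big_split /=.
by apply: eq_bigr => k _; rewrite mulrDl.
Qed.

Lemma zaddA : associative zadd.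
Proof. by move=> a b c; apply: funext => n; rewrite /zadd addrA. Qed.
Lemma zaddC : commutative zadd.
Proof. by move=> a b; apply: funext => n; rewrite /zadd addrC. Qed.
Lemma zadd0 : left_id zzero zadd.
Proof. by move=> a; apply: funext => n; rewrite /zadd add0r. Qed.
Lemma zaddN : left_inverse zzero zopp zadd.
Proof. by move=> a; apply: funext => n; rewrite /zadd addNr. Qed.

HB.instance Definition _ := gen_eqMixin zs.
HB.instance Definition _ := gen_choiceMixin zs.
HB.instance Definition _ := GRing.isZmodule.Build zs zaddA zaddC zadd0 zaddN.

Lemma zone_neq0 : zone != 0 :> zs.
Proof.
apply/eqP => /(congr1 (fun a : zs => (a 0%N : ts))) /eqP.
by rewrite /zone /zconst /= (negbTE (tone_neq0 C s)).
Qed.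

HB.instance Definition _ :=
  GRing.Zmodule_isComNzRing.Build zs zmulA zmulC zmul1 zmulDl zone_neq0.

Lemma zcoefM a b n : ((a * b : zs) n : ts) = \sum_(k < n.+1) (a k : ts) * b (n - k)%N.
Proof. exact: zmulE. Qed.
Lemma zcoefD a b n : (a + b : zs) n = (a n : ts) + b n. Proof. by []. Qed.
Lemma zcoefN a n : (- a : zs) n = - (a n : ts). Proof. by []. Qed.
Lemma zcoefB a b n : (a - b : zs) n = (a n : ts) - b n. Proof. by []. Qed.
Lemma zcoef_sum I (r : seq I) (P : pred I) (u : I -> zs) n :
  ((\sum_(i <- r | P i) u i) n : ts) = \sum_(i <- r | P i) (u i n : ts).
Proof. by elim/big_rec2: _ => //= i x y _ <-. Qed.
Lemma zcoef_constM (f : ts) a n : ((zconst f * a : zs) n : ts) = f * (a n : ts).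
Proof. exact: zmul_const. Qed.

Lemma zmul_mulE2 a b n m : (a * b : zs) n m =
  \sum_(k < n.+1) \sum_(c <- mbelow m) a k c * b (n - k)%N (msub m c).
Proof. by rewrite zcoefM tcoef_sum; apply: eq_bigr => k _; rewrite -tmulE. Qed.

End ZRing.

(** * Valuation and Frobenius *)

(** A single bundled parameter, on which the morphism structures of the twists can depend. *)
Record cinf := Cinf {
  cF : finFieldType; cC : closedFieldType; cR : realType;
  cio : {rmorphism cF -> cC}; cth : cC; cab : cC -> cR;
  cinfP : is_Cinf cio cth cab }.

Section Valuation.
Variable K : cinf.
Local Notation F := (cF K).
Local Notation C := (cC K).
Local Notation R := (cR K).
Local Notation io := (@cio K).
Local Notation th := (@cth K).
Local Notation ab := (@cab K).
Local Notation q := (Defs.q (cF K)).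
Implicit Types x y : C.

Lemma ab_ge0 x : 0 <= ab x.
Proof. by case: (cinfP K) => -[]. Qed.

Lemma ab_eq0 x : (ab x == 0) = (x == 0).
Proof. by apply/eqP/eqP; case: (cinfP K) => -[_ H _ _ _] _ /H. Qed.

Lemma ab0 : ab 0 = 0. Proof. by apply/eqP; rewrite ab_eq0. Qed.

Lemma abM x y : ab (x * y) = ab x * ab y.
Proof. by case: (cinfP K) => -[]. Qed.

Lemma abD x y : ab (x + y) <= Num.max (ab x) (ab y).
Proof. by case: (cinfP K) => -[]. Qed.

Lemma ab_th : ab th = q%:R.
Proof. by case: (cinfP K) => -[]. Qed.

Lemma ab_complete (u : nat -> C) : c_cauchy ab u -> exists l, c_lim ab u l.
Proof. by case: (cinfP K) => _ [H _] /H. Qed.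

Lemma ab1 : ab 1 = 1.
Proof.
have: ab 1 * ab 1 = ab 1 by rewrite -abM mulr1.
have: ab 1 != 0 by rewrite ab_eq0 oner_eq0.
by move=> n0 /(congr1 (fun z => z / ab 1)); rewrite mulfK // divff.
Qed.

Lemma abX x n : ab (x ^+ n) = ab x ^+ n.
Proof. by elim: n => [|n IH]; rewrite ?expr0 ?ab1 // !exprS abM IH. Qed.

Lemma abN x : ab (- x) = ab x.
Proof.
have h : ab (-1) = 1.
  apply/eqP; rewrite -(@eqrXn2 _ 2) ?ab_ge0 //; first by rewrite -abX sqrrN expr1n ab1 expr1n.
by rewrite -mulN1r abM h mul1r.
Qed.

Lemma abV x : ab x^-1 = (ab x)^-1.
Proof.
have [->|x0] := eqVneq x 0; first by rewrite invr0 ab0 invr0.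
have a0 : ab x != 0 by rewrite ab_eq0.
by apply: (mulfI a0); rewrite -abM !divff // ab1.
Qed.

Lemma abD_le x y rho : ab x <= rho -> ab y <= rho -> ab (x + y) <= rho.
Proof. by move=> xr yr; apply: le_trans (abD _ _) _; rewrite ge_max xr yr. Qed.
Lemma abD_lt x y rho : ab x < rho -> ab y < rho -> ab (x + y) < rho.
Proof. by move=> xr yr; apply: le_lt_trans (abD _ _) _; rewrite gt_max xr yr. Qed.
Lemma abB_lt x y rho : ab x < rho -> ab y < rho -> ab (x - y) < rho.
Proof. by move=> xr yr; apply: abD_lt => //; rewrite abN. Qed.
Lemma ab_sum_le I (r : seq I) (P : pred I) (u : I -> C) rho : 0 <= rho ->
  (forall i, P i -> ab (u i) <= rho) -> ab (\sum_(i <- r | P i) u i) <= rho.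
Proof.
by move=> r0 H; elim/big_ind: _ => // [|x y]; [rewrite ab0 | exact: abD_le].
Qed.
Lemma ab_sum_lt I (r : seq I) (P : pred I) (u : I -> C) rho : 0 < rho ->
  (forall i, P i -> ab (u i) < rho) -> ab (\sum_(i <- r | P i) u i) < rho.
Proof.
by move=> r0 H; elim/big_ind: _ => // [|x y]; [rewrite ab0 | exact: abD_lt].
Qed.
Lemma ab_sum_lt_seq (I : eqType) (r : seq I) (u : I -> C) rho : 0 < rho ->
  (forall i, i \in r -> ab (u i) < rho) -> ab (\sum_(i <- r) u i) < rho.
Proof. by move=> r0 H; rewrite big_seq; apply: ab_sum_lt. Qed.

Lemma abD_dom x y : ab y < ab x -> ab (x + y) = ab x.
Proof.
move=> yx; apply/le_anti/andP; split; first by rewrite abD_le // ltW.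
rewrite leNgt; apply/negP => h.
by have := abB_lt h yx; rewrite addrK ltxx.
Qed.

Lemma q_gt1 : (1 < q)%N.
Proof. by rewrite /Defs.q (cardD1 0) (cardD1 1) !inE oner_eq0. Qed.
Lemma q_gt0 : (0 < q)%N. Proof. exact: ltnW q_gt1. Qed.
Lemma qn_gt0 n : (0 < q ^ n)%N. Proof. by rewrite expn_gt0 q_gt0. Qed.
Lemma qR_gt1 : 1 < (q%:R : R). Proof. by rewrite ltr1n q_gt1. Qed.
Lemma qR_gt0 : 0 < (q%:R : R). Proof. by rewrite ltr0n q_gt0. Qed.
Lemma qR_ge2 : 2 <= (q%:R : R). Proof. by rewrite (ler_nat _ 2) q_gt1. Qed.

Lemma ab_io (a : F) : a != 0 -> ab (io a) = 1.
Proof.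
move=> a0; apply/eqP; rewrite -(@eqrXn2 _ q.-1) ?ab_ge0 ?ler01 //; last first.
  by rewrite -ltnS prednK ?q_gt1 ?q_gt0.
rewrite -abX -rmorphXn expr1n /=.
have := expf_card a; rewrite -/(Defs.q F) -{1}(prednK q_gt0) exprS => e.
have -> : a ^+ q.-1 = 1 by apply: (mulfI a0); rewrite e mulr1.
by rewrite rmorph1 ab1.
Qed.

Lemma ab_io_le1 (a : F) : ab (io a) <= 1.
Proof. by have [->|/ab_io->//] := eqVneq a 0; rewrite rmorph0 ab0 ler01. Qed.

Lemma frobD x y : (x + y) ^+ q = x ^+ q + y ^+ q.
Proof.
have [p p_pr pp] := finPcharP F.
have pC : p \in [pchar C] by rewrite (fmorph_pchar io).
apply: exprDn_pchar; rewrite /Defs.q (card_pprimeChar pp).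
apply/pnatP => [|l lp]; first by rewrite expn_gt0 prime_gt0.
by rewrite Euclid_dvdX // dvdn_prime2 // => /andP[/eqP -> _].
Qed.

Lemma frob0 : (0 : C) ^+ q = 0.
Proof. by rewrite expr0n; case: q q_gt0. Qed.

Lemma frobN x : (- x) ^+ q = - x ^+ q.
Proof. by apply/eqP; rewrite -addr_eq0 -frobD addNr frob0. Qed.

Lemma frobB x y : (x - y) ^+ q = x ^+ q - y ^+ q.
Proof. by rewrite frobD frobN. Qed.

Lemma frob_io a : (io a) ^+ q = io a.
Proof. by rewrite -rmorphXn /= expf_card. Qed.

Lemma frob_sub_prod x : x ^+ q - x = \prod_(a : F) (x - io a).
Proof.
have /(congr1 (fun p => (map_poly io p).[x])) := finField_genPoly F.
rewrite rmorphB /= map_polyXn map_polyX !hornerE => ->.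
rewrite rmorph_prod /= horner_prod; apply: eq_bigr => a _.
by rewrite rmorphB /= map_polyX map_polyC /= !hornerE.
Qed.

Lemma frob_fixed x : x ^+ q = x -> exists a, x = io a.
Proof.
move=> /eqP; rewrite -subr_eq0 frob_sub_prod => /prodf_eq0[a _ /eqP xa].
by exists a; apply/eqP; rewrite -subr_eq0 xa.
Qed.

Lemma frob_inj x y : x ^+ q = y ^+ q -> x = y.
Proof.
move=> /eqP; rewrite -subr_eq0 -frobB expf_eq0 => /andP[_].
by rewrite subr_eq0 => /eqP.
Qed.

Lemma frob_invK x : (frob_inv F x) ^+ q = x.
Proof. apply/eqP; exact: (xchooseP (frob_surj F x)). Qed.

(** The roots form a coset of F_q, and x is the product of the y - a over a in F_q. If [ab x < 1],
    some factor is small; replacing y by it, y^q is dominated by y, so |y| = |x|. This size control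
    is what keeps coefficientwise solutions null. *)
Lemma artin_schreier x : exists y, y ^+ q - y = x /\ (ab x < 1 -> ab y <= ab x).
Proof.
have [y yx] : exists y, y ^+ q - y = x.
  have [y Hy] := @solve_monicpoly C q
    (fun i => if i == 0%N then x else (i == 1%N)%:R) q_gt0.
  exists y; rewrite Hy.
  case E: q q_gt1 => [|[|n]] // _; rewrite !big_ord_recl /= big1 ?addr0.
    by rewrite expr0 mulr1 expr1 mul1r addrK.
  by move=> i _; rewrite mul0r.
have [x1|] := boolP (ab x < 1); last by exists y.
have /existsP[a ya] : [exists a : F, ab (y - io a) < 1].
  apply: contraTT x1; rewrite negb_exists -leNgt => /forallP H.
  rewrite -yx frob_sub_prod; elim/big_rec: _ => [|a z _ z1]; first by rewrite ab1.
  by rewrite abM; apply: mulr_ege1 => //; rewrite leNgt.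
have e : (y - io a) ^+ q - (y - io a) = x.
  by rewrite frobB frob_io opprB addrA subrK.
exists (y - io a); split=> // _; move: (y - io a) ya e => z ya e.
have [->|z0] := eqVneq z 0; first by rewrite ab0 ab_ge0.
rewrite -e -[z ^+ q - z]opprB abN abD_dom // abN abX -[X in _ < X]mul1r.
rewrite -(prednK q_gt0) exprSr ltr_pM2r; last by rewrite lt0r ab_ge0 ab_eq0 z0.
by rewrite exprn_ilt1 ?ab_ge0 // -lt0n -ltnS prednK ?q_gt1 ?q_gt0.
Qed.

Lemma frobz_nat n x : frobz F (Posz n) x = x ^+ (q ^ n).
Proof. by elim: n => [|n /= ->]; rewrite ?expr1 // -exprM expnSr. Qed.

Lemma frobzS (n : int) x : frobz F (n + 1) x = (frobz F n x) ^+ q.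
Proof.
case: n => n; first by rewrite -PoszD addn1.
case: n => [|n]; first by rewrite /= frob_invK.
have -> : Negz n.+1 + 1 = Negz n by rewrite !NegzE -[n.+2]addn1 PoszD opprD subrK.
by rewrite /= frob_invK.
Qed.

Lemma frobzB1 (n : int) x : frobz F (n - 1) x = frob_inv F (frobz F n x).
Proof. by apply: frob_inj; rewrite -frobzS subrK frob_invK. Qed.

Lemma frobz_comp (m n : int) x : frobz F m (frobz F n x) = frobz F (m + n) x.
Proof.
elim/int_rec: m => [|m IH|m IH]; first by rewrite add0r.
  by rewrite -addn1 PoszD frobzS IH -frobzS addrAC.
by rewrite -addn1 PoszD opprD frobzB1 IH -frobzB1 addrAC.
Qed.

Lemma frobz_add (n : int) x y : frobz F n (x + y) = frobz F n x + frobz F n y.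
Proof.
elim/int_rec: n => [//|m IH|m IH].
  by rewrite -addn1 PoszD !frobzS IH frobD.
apply: frob_inj; rewrite frobD -!frobzS -addn1 PoszD opprD subrK; exact: IH.
Qed.

Lemma frobz_mul (n : int) x y : frobz F n (x * y) = frobz F n x * frobz F n y.
Proof.
elim/int_rec: n => [//|m IH|m IH].
  by rewrite -addn1 PoszD !frobzS IH exprMn.
apply: frob_inj; rewrite exprMn -!frobzS -addn1 PoszD opprD subrK; exact: IH.
Qed.

Lemma frobz_io (n : int) a : frobz F n (io a) = io a.
Proof.
elim/int_rec: n => [//|m IH|m IH].
  by rewrite -addn1 PoszD !frobzS IH frob_io.
apply: frob_inj; rewrite frob_io -!frobzS -addn1 PoszD opprD subrK; exact: IH.
Qed.

Lemma frobz_zero (n : int) : frobz F n (0 : C) = 0.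
Proof. by rewrite -(rmorph0 io) frobz_io. Qed.
Lemma frobz_one (n : int) : frobz F n (1 : C) = 1.
Proof. by rewrite -(rmorph1 io) frobz_io. Qed.
Lemma frobz_opp (n : int) x : frobz F n (- x) = - frobz F n x.
Proof. by apply/eqP; rewrite -addr_eq0 -frobz_add addNr frobz_zero. Qed.
Lemma frobz_sum (n : int) I (r : seq I) (P : pred I) (u : I -> C) :
  frobz F n (\sum_(i <- r | P i) u i) = \sum_(i <- r | P i) frobz F n (u i).
Proof. exact: (big_morph _ (frobz_add n) (frobz_zero n)). Qed.

Lemma ab_frobz n x : ab (frobz F (Posz n) x) = ab x ^+ (q ^ n).
Proof. by rewrite frobz_nat abX. Qed.

Lemma ab_frobzN (n : nat) x : ab (frobz F (- (n : int)) x) ^+ (q ^ n) = ab x.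
Proof. by rewrite -ab_frobz frobz_comp subrr. Qed.

Lemma ab_thetaB n : (0 < n)%N -> ab (frobz F (Posz n) th - th) = q%:R ^+ (q ^ n).
Proof.
move=> n0; rewrite abD_dom ab_frobz ab_th // abN ab_th -[X in X < _]expr1.
by rewrite ltr_eXn2l ?qR_gt1 // -{1}(expn0 q) ltn_exp2l ?q_gt1.
Qed.

Lemma thetaB_neq0 n : (0 < n)%N -> frobz F (Posz n) th - th != 0.
Proof. by move=> n0; rewrite -ab_eq0 ab_thetaB // expf_neq0 // gt_eqF ?qR_gt0. Qed.

(** Nonzero coefficients have absolute value 1 and |theta| = q > 1, so the leading term strictly
    dominates. *)
Lemma theta_transcendental (p : {poly F}) : (map_poly io p).[th] = 0 -> p = 0.
Proof.
move=> p0; apply/eqP/negPn/negP => pn0.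
have sz : (0 < size p)%N by rewrite size_poly_gt0.
move: p0; rewrite (@horner_coef_wide _ (size p)) ?size_map_poly //.
rewrite -(prednK sz) big_ord_recr /= => /eqP; rewrite addr_eq0 => /eqP.
move/(congr1 ab); rewrite abN coef_map abM ab_io ?lead_coef_eq0 // mul1r abX ab_th => e.
set d := (size p).-1 in e *.
case: d e => [|d].
  by rewrite big_ord0 ab0 expr0 => /eqP; rewrite eq_sym oner_eq0.
move=> e; have : ab (\sum_(i < d.+1) (map_poly io p)`_i * th ^+ i) <= q%:R ^+ d.
  apply: ab_sum_le => [|i _]; first by rewrite exprn_ge0 // ler0n.
  rewrite coef_map abM abX ab_th -[leRHS]mul1r ler_pM ?ab_ge0 ?exprn_ge0 ?ler0n ?ab_io_le1 //.
  by rewrite ler_eXn2l ?qR_gt1 // -ltnS.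
by rewrite e leNgt ltr_eXn2l ?qR_gt1 // ltnSn.
Qed.

Variable s : nat.
Local Notation ts := (@tser C s).
Implicit Types f g : ts.

Lemma twist_zmod (n : int) : zmod_morphism (@twist F C s n).
Proof. by move=> f g; apply: funext => m; rewrite /twist frobz_add frobz_opp. Qed.
Lemma twist_monoid (n : int) : monoid_morphism (@twist F C s n).
Proof.
split=> [|f g]; apply: funext => m; rewrite /twist.
  rewrite -tconst1 /tconst; case: eqP => _; [exact: frobz_one | exact: frobz_zero].
rewrite -!tmul_mulE !tmulE frobz_sum; apply: eq_bigr => a _; exact: frobz_mul.
Qed.
HB.instance Definition _ n := GRing.isZmodMorphism.Build ts ts (@twist F C s n) (twist_zmod n).
HB.instance Definition _ n := GRing.isMonoidMorphism.Build ts ts (@twist F C s n) (twist_monoid n).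

Lemma twist_comp (m n : int) f : twist F m (twist F n f) = twist F (m + n) f.
Proof. by apply: funext => a; rewrite /twist frobz_comp. Qed.
Lemma twist_const (n : int) c : twist F n (tconst c : ts) = tconst (frobz F n c).
Proof. by apply: funext => m; rewrite /twist /tconst; case: eqP; rewrite ?frobz_zero. Qed.

End Valuation.

Lemma seq_argmax (T : eqType) d (L : orderType d) (f : T -> L) (l : seq T) x :
  x \in l -> exists2 y, y \in l & forall z, z \in l -> (f z <= f y)%O.
Proof.
elim: l x => // a l IH x _; case: l IH => [|b l] IH.
  by exists a; rewrite ?mem_head // => z; rewrite inE => /eqP ->.
have [y yl ym] := IH b (mem_head _ _).
have [ay|ya] := leP (f a) (f y).
  exists y; first by rewrite inE yl orbT.
  by move=> z; rewrite inE => /orP[/eqP -> //|/ym].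
exists a; first exact: mem_head.
move=> z; rewrite inE => /orP[/eqP -> //|/ym h]; exact: le_trans h (ltW ya).
Qed.

(** * Uniform convergence and null families *)

Section Uniform.
Variable K : cinf.
Local Notation C := (cC K).
Local Notation R := (cR K).
Local Notation ab := (@cab K).

Section Functions.
Variable I : Type.
Implicit Types (x y g : I -> C) (u v : nat -> I -> C) (e rho : R).

(** The index set is left arbitrary: monomials in t, pairs of exponents in z and t, and coordinates
    of vectors of series are all instances. *)
Definition bnd x rho := forall i, ab (x i) <= rho.
Definition uconv u g := forall e, 0 < e -> exists N, forall n, (N <= n)%N ->
  forall i, ab (u n i - g i) < e.
Definition tends0 u := forall e, 0 < e -> exists N, forall n, (N <= n)%N ->
  forall i, ab (u n i) < e.
Definition usums u g := uconv (fun N i => \sum_(k < N) u k i) g.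

Lemma abBC (a b : C) : ab (a - b) = ab (b - a).
Proof. by rewrite -abN opprB. Qed.

Lemma ab_tri (a b c : C) e : ab (a - b) < e -> ab (b - c) < e -> ab (a - c) < e.
Proof. by move=> h1 h2; have := abD_lt h1 h2; rewrite addrA subrK. Qed.

Lemma ab_close x y (i : I) e : ab (x i - y i) < e -> ab (x i) < e -> ab (y i) < e.
Proof. by move=> h1 h2; have := abB_lt h2 h1; rewrite opprB addrC subrK. Qed.

Lemma eq_uconv u v g : (forall n i, u n i = v n i) -> uconv u g -> uconv v g.
Proof. by move=> uv ug e /ug[N H]; exists N => n /H h i; rewrite -uv. Qed.

Lemma uconv_unique u g g' : uconv u g -> uconv u g' -> g = g'.
Proof.
move=> ug ug'; apply: funext => i; apply/eqP; rewrite -subr_eq0 -ab_eq0.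
apply/negPn/negP => h; have e0 : 0 < ab (g i - g' i) by rewrite lt0r h ab_ge0.
have [N HN] := ug _ e0; have [M HM] := ug' _ e0.
have := HN _ (leq_maxl N M) i; rewrite abBC => h1.
by have := ab_tri h1 (HM _ (leq_maxr N M) i); rewrite ltxx.
Qed.

Lemma uconv_ex u :
  (forall e, 0 < e -> exists N, forall n p, (N <= n)%N -> (N <= p)%N ->
     forall i, ab (u n i - u p i) < e) -> exists g, uconv u g.
Proof.
move=> H; have Hi i : exists l, c_lim ab (fun n => u n i) l.
  by apply: ab_complete => e /H[N HN]; exists N => n p Nn Np; apply: HN.
have [g Hg] := choice Hi; exists g => e e0.
have [N HN] := H _ e0; exists N => n Nn i.
have [M HM] := Hg i _ e0; by apply: ab_tri (HM _ (leq_maxr N M)); apply: HN (leq_maxl N M) _.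
Qed.

Lemma uconvD u v g h : uconv u g -> uconv v h ->
  uconv (fun n i => u n i + v n i) (fun i => g i + h i).
Proof.
move=> ug vh e e0; have [N HN] := ug _ e0; have [M HM] := vh _ e0.
exists (maxn N M) => n; rewrite geq_max => /andP[Nn Mn] i.
by rewrite opprD addrACA abD_lt ?HN ?HM.
Qed.

Lemma uconv_cst g : uconv (fun _ => g) g.
Proof. by move=> e e0; exists 0%N => n _ i; rewrite subrr ab0. Qed.

Lemma uconvN u g : uconv u g -> uconv (fun n i => - u n i) (fun i => - g i).
Proof.
move=> ug e /ug[N HN]; exists N => n Nn i.
by rewrite opprK addrC abBC HN.
Qed.

Lemma uconv_shift u g p : uconv u g -> uconv (fun n => u (n + p)%N) g.
Proof.
move=> ug e /ug[N HN]; exists N => n Nn; apply: HN.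
by rewrite (leq_trans Nn) ?leq_addr.
Qed.

Lemma uconv_bnd u g rho : uconv u g -> (forall n, bnd (u n) rho) -> bnd g rho.
Proof.
move=> ug ur i; rewrite leNgt; apply/negP => h.
have e0 : 0 < ab (g i) by rewrite (le_lt_trans _ h) // (le_trans _ (ur 0%N i)) // ab_ge0.
have [N /(_ N (leqnn N) i) HN] := ug _ e0.
have := abB_lt (le_lt_trans (ur N i) h) HN.
by rewrite opprB addrC subrK ltxx.
Qed.

Lemma tends0_partial u e : tends0 u -> 0 < e -> exists N, forall n p, (N <= n)%N ->
  (N <= p)%N -> forall i, ab (\sum_(k < n) u k i - \sum_(k < p) u k i) < e.
Proof.
move=> u0 e0; have [N HN] := u0 _ e0; exists N.
have main n p : (N <= n)%N -> (n <= p)%N -> forall i,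
    ab (\sum_(k < n) u k i - \sum_(k < p) u k i) < e.
  move=> Nn np i; rewrite -abN opprB -!(big_mkord xpredT (fun k => u k i)).
  rewrite (big_cat_nat (n := n)) //= addrAC subrr add0r.
  by apply: ab_sum_lt_seq => // k; rewrite mem_index_iota => /andP[nk _]; rewrite HN // (leq_trans Nn).
move=> n p Nn Np i; have [np|/ltnW pn] := leqP n p; first exact: main.
by rewrite -abN opprB; apply: main.
Qed.

Lemma usums_ex u : tends0 u -> exists g, usums u g.
Proof. by move=> u0; apply: uconv_ex => e e0; apply: tends0_partial. Qed.

Lemma usumsD u v g h : usums u g -> usums v h ->
  usums (fun n i => u n i + v n i) (fun i => g i + h i).
Proof.
move=> ug vh; apply: eq_uconv (uconvD ug vh) => n i.
by rewrite big_split.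
Qed.

Lemma usumsN u g : usums u g -> usums (fun n i => - u n i) (fun i => - g i).
Proof. by move=> ug; apply: eq_uconv (uconvN ug) => n i; rewrite sumrN. Qed.

Lemma usums_shift u g : usums u g <-> usums (fun n => u n.+1) (fun i => g i - u 0%N i).
Proof.
split=> H e /H[N HN].
  exists N => n Nn i; have := HN n.+1 (leqW Nn) i.
  by rewrite big_ord_recl /= opprB addrA [X in _ -> ab (X - _) < _]addrC; apply.
exists N.+1 => -[//|n] Nn i; have := HN n Nn i.
by rewrite big_ord_recl /= opprB addrA [X in ab (X - _) < _ -> _]addrC; apply.
Qed.

Lemma usums_bnd u g rho : 0 <= rho -> usums u g -> (forall n, bnd (u n) rho) -> bnd g rho.
Proof. by move=> r0 ug ur; apply: uconv_bnd ug _ => n i; apply: ab_sum_le => // k _; apply: ur. Qed.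

Lemma usums_finite u N : (forall n, (N <= n)%N -> forall i, u n i = 0) ->
  usums u (fun i => \sum_(k < N) u k i).
Proof.
move=> H e e0; exists N => n Nn i; rewrite -!(big_mkord xpredT (fun k => u k i)).
rewrite (big_cat_nat (n := N)) //= [X in ab (_ + X - _)]big_nat_cond [X in ab (_ + X - _)]big1 ?addr0 ?subrr ?ab0 //.
by move=> k /andP[/andP[Nk _] _]; apply: H.
Qed.

Lemma usums_unique u g g' : usums u g -> usums u g' -> g = g'.
Proof. exact: uconv_unique. Qed.

Lemma eq_usums u v g : (forall n i, u n i = v n i) -> usums u g -> usums v g.
Proof. by move=> uv; apply: eq_uconv => n i; apply: eq_bigr => k _; rewrite uv. Qed.

End Functions.

Section Null.
Variable I : eqType.
Implicit Types (x y g : I -> C) (u v : nat -> I -> C) (e rho : R).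

(** Decay off finite sets refers to no degree, so one notion covers series in t, series in t and z,
    and vectors of them. It also makes the largest absolute value attained. *)
Definition fnull x := forall e, 0 < e -> exists l : seq I, forall i, i \notin l -> ab (x i) < e.

Lemma fnull_max x i1 : fnull x -> x i1 != 0 ->
  exists i0, ab (x i0) != 0 /\ forall i, ab (x i) <= ab (x i0).
Proof.
move=> nx x1; have e0 : 0 < ab (x i1) by rewrite lt0r ab_ge0 ab_eq0 x1.
have [l Hl] := nx _ e0.
have il : i1 \in l by apply/negPn/negP => /Hl; rewrite ltxx.
have [i0 i0l Hi] := seq_argmax (fun i => ab (x i)) il.
exists i0; split; first by rewrite gt_eqF // (lt_le_trans e0) // Hi.
move=> i; have [/Hi//|/Hl h] := boolP (i \in l).
exact: le_trans (ltW h) (Hi _ il).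
Qed.

Lemma fnullD x y : fnull x -> fnull y -> fnull (fun i => x i + y i).
Proof.
move=> nx ny e e0; have [l Hl] := nx _ e0; have [l' Hl'] := ny _ e0.
exists (l ++ l') => i; rewrite mem_cat negb_or => /andP[/Hl a /Hl' b].
exact: abD_lt.
Qed.

Lemma uconv_fnull u g : uconv u g -> (forall n, fnull (u n)) -> fnull g.
Proof.
move=> ug nu e e0; have [N /(_ N (leqnn N)) HN] := ug _ e0; have [l Hl] := nu N _ e0.
by exists l => i /Hl; apply: ab_close (HN i).
Qed.

End Null.

End Uniform.

(** The parallelogram law in nat: one of the two truncated differences is zero, the other is |x -
    x'|. *)
Lemma square_swap (x y x' y' : nat) : (x' + y' = x + y ->
  (x' + y) ^ 2 + (x + y') ^ 2 = (x + y) ^ 2 + (x + y) ^ 2 + 2 * ((x - x') ^ 2 + (x' - x) ^ 2))%N.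
Proof.
move=> e; case: (leqP x x') => [|/ltnW] /subnKC h.
  set d := (x' - x)%N in h *; have -> : (x - x' = 0)%N by lia.
  have ey : (y = y' + d)%N by lia.
  by rewrite -h ey; ring.
set d := (x - x')%N in h *; have -> : (x' - x = 0)%N by lia.
have ey : (y' = y + d)%N by lia.
by rewrite -h ey; ring.
Qed.

Lemma square_sub_eq0 (a b : nat) : ((a - b) ^ 2 + (b - a) ^ 2 = 0)%N -> b = a.
Proof. by move/eqP; rewrite addn_eq0 !expn_eq0 !andbT => /andP[]; lia. Qed.

(** * Series with coefficients tending to zero *)

Section NullSeries.
Variables (K : cinf) (s : nat).
Local Notation F := (cF K).
Local Notation C := (cC K).
Local Notation R := (cR K).
Local Notation ab := (@cab K).
Local Notation q := (Defs.q (cF K)).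
Local Notation ts := (@tser (cC K) s).
Local Notation zs := (@zser (cC K) s).
Implicit Types (f g : ts) (a b : zs) (e rho : R) (m : mon s).

Definition mons N : seq (mon s) :=
  [seq [ffun i => nat_of_ord (a i)] | a : {ffun 'I_s -> 'I_N} <- enum {ffun 'I_s -> 'I_N}].

Lemma mem_mons N m : (mdeg m < N)%N -> m \in mons N.
Proof.
move=> mN; have lt i : (m i < N)%N by rewrite (leq_ltn_trans (leq_mdeg m i)).
apply/mapP; exists [ffun i => Ordinal (lt i)]; first by rewrite mem_enum.
by apply/ffunP => i; rewrite !ffunE.
Qed.

Definition znull a := forall e, 0 < e -> exists N, forall n m, (N <= n + mdeg m)%N -> ab (a n m) < e.
Definition zflat a : nat * mon s -> C := fun p => a p.1 p.2.
Definition zbnd a rho := forall n, bnd (a n) rho.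

Lemma tate_fnull f : tate ab f <-> fnull f.
Proof.
split=> H e /H[].
  move=> N HN; exists (mons N) => m /negP h; apply: HN; rewrite leqNgt.
  by apply/negP => /mem_mons.
move=> l Hl; exists (\sum_(m <- l) (mdeg m).+1)%N => m; rewrite leqNgt => /negP h.
by apply: Hl; apply/negP => ml; apply: h; rewrite (big_rem _ ml) /= leq_addr.
Qed.

Lemma znull_fnull a : znull a <-> fnull (zflat a).
Proof.
split=> H e /H[].
  move=> N HN; exists [seq (n, m) | n <- iota 0 N, m <- mons N] => -[n m] /negP h.
  apply: HN; rewrite leqNgt; apply/negP => nm; apply: h.
  apply/allpairsP; exists (n, m); split=> //=.
    by rewrite mem_iota add0n (leq_ltn_trans _ nm) ?leq_addr.
  by rewrite mem_mons // (leq_ltn_trans _ nm) ?leq_addl.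
move=> l Hl; exists (\sum_(p <- l) (p.1 + mdeg p.2).+1)%N => n m; rewrite leqNgt => /negP h.
by apply: (Hl (n, m)); apply/negP => ml; apply: h; rewrite (big_rem _ ml) /= leq_addr.
Qed.

Lemma znull_tate a n : znull a -> tate ab (a n).
Proof.
by move=> na e /na[N HN]; exists N => m h; apply: HN; rewrite (leq_trans h) ?leq_addl.
Qed.

Lemma znullP a : znull a <-> (forall n, tate ab (a n)) /\
  (forall e, 0 < e -> exists N, forall n, (N <= n)%N -> forall m, ab (a n m) < e).
Proof.
split=> [na|[ta ua] e e0].
  split=> [n|e /na[N HN]]; first exact: znull_tate.
  by exists N => n h m; apply: HN; rewrite (leq_trans h) ?leq_addr.
have [N HN] := ua _ e0.
have [M HM] := choice (fun n => ta n e e0).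
exists (N + \sum_(k < N) M k)%N => n m h.
have [/HN//|nN] := leqP N n; apply: HM.
rewrite -(leq_add2l n) (leq_trans _ h) // leq_add ?(ltnW nN) //.
by rewrite (bigD1 (Ordinal nN)) //= leq_addr.
Qed.

Lemma ab_bnd0 f rho m : bnd f rho -> 0 <= rho.
Proof. by move=> /(_ m); apply: le_trans; apply: ab_ge0. Qed.

Lemma bndM f g rho sg : bnd f rho -> bnd g sg -> bnd (f * g) (rho * sg).
Proof.
move=> fr gs m; have r0 := ab_bnd0 (mon0 s) fr; have s0 := ab_bnd0 (mon0 s) gs.
rewrite -tmul_mulE tmulE; apply: ab_sum_le => [|c _]; first exact: mulr_ge0.
by rewrite abM ler_pM ?ab_ge0.
Qed.

Lemma bnd_sum I (r : seq I) (P : pred I) (u : I -> ts) rho : 0 <= rho ->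
  (forall i, P i -> bnd (u i) rho) -> bnd (\sum_(i <- r | P i) u i) rho.
Proof. by move=> r0 H m; rewrite tcoef_sum; apply: ab_sum_le => // i /H. Qed.

Lemma bndD f g rho : bnd f rho -> bnd g rho -> bnd (f + g) rho.
Proof. by move=> fr gr m; rewrite tcoefD abD_le. Qed.

Lemma bndN f rho : bnd f rho -> bnd (- f) rho.
Proof. by move=> fr m; rewrite tcoefN abN. Qed.

Lemma bnd_le f rho sg : rho <= sg -> bnd f rho -> bnd f sg.
Proof. by move=> rs fr m; apply: le_trans (fr m) rs. Qed.

Lemma bnd0 rho : 0 <= rho -> bnd (0 : ts) rho.
Proof. by move=> r0 m; rewrite tcoef0 ab0. Qed.

Lemma bnd_const c : bnd (tconst c : ts) (ab c).
Proof. by move=> m; rewrite /tconst; case: eqP; rewrite ?ab0 ?ab_ge0. Qed.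

Lemma bnd_twist n f rho : bnd f rho -> bnd (twist F (Posz n) f) (rho ^+ (q ^ n)).
Proof. by move=> fr m; rewrite /twist ab_frobz lerXn2r ?nnegrE ?ab_ge0 ?(ab_bnd0 m fr). Qed.

Lemma zbndM a b rho sg : zbnd a rho -> zbnd b sg -> zbnd (a * b) (rho * sg).
Proof.
move=> ar bs n; rewrite zcoefM; apply: bnd_sum => [|k _]; last exact: bndM.
by rewrite mulr_ge0 ?(ab_bnd0 (mon0 s) (ar n)) ?(ab_bnd0 (mon0 s) (bs n)).
Qed.

Lemma fnull_bnd (I : eqType) (x : I -> C) : fnull x -> exists2 rho, 1 <= rho & bnd x rho.
Proof.
move=> nx; have [x0|/existsNP[i1 /eqP x1]] := pselect (forall i, x i = 0).
  by exists 1 => // i; rewrite x0 ab0 ler01.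
have [i0 [_ Hi]] := fnull_max nx x1.
by exists (Num.max 1 (ab (x i0))) => [|i]; rewrite le_max ?lexx ?Hi ?orbT.
Qed.

Lemma tate_bnd f : tate ab f -> exists2 rho, 1 <= rho & bnd f rho.
Proof. by move/tate_fnull/fnull_bnd. Qed.

Lemma znull_zbnd a : znull a -> exists2 rho, 1 <= rho & zbnd a rho.
Proof.
by move/znull_fnull/fnull_bnd => [rho r1 H]; exists rho => // n m; apply: (H (n, m)).
Qed.

Lemma znullD a b : znull a -> znull b -> znull (a + b).
Proof. by rewrite !znull_fnull; apply: fnullD. Qed.
Lemma znullN a : znull a -> znull (- a).
Proof. by move=> na e /na[N HN]; exists N => n m h; rewrite zcoefN tcoefN abN HN. Qed.

Lemma znullM a b : znull a -> znull b -> znull (a * b).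
Proof.
move=> na nb e e0; have [ra ra1 Ha] := znull_zbnd na; have [rb rb1 Hb] := znull_zbnd nb.
have ra0 : 0 < ra := lt_le_trans ltr01 ra1; have rb0 : 0 < rb := lt_le_trans ltr01 rb1.
have [N HN] := na _ (divr_gt0 e0 rb0); have [M HM] := nb _ (divr_gt0 e0 ra0).
exists (N + M)%N => n m h; rewrite zmul_mulE2.
apply: ab_sum_lt => // k _; apply: ab_sum_lt_seq => // c; rewrite mem_mbelow => cm.
rewrite abM; have [Nk|kN] := leqP N (k + mdeg c).
  apply: le_lt_trans (_ : _ <= ab (a k c) * rb) _; first by rewrite ler_wpM2l ?ab_ge0 ?Hb.
  by rewrite -ltr_pdivlMr ?HN.
apply: le_lt_trans (_ : _ <= ra * ab (b (n - k)%N (msub m c))) _.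
  by rewrite ler_wpM2r ?ab_ge0 ?Ha.
rewrite mulrC -ltr_pdivlMr ?HM //.
have e2 : (k + mdeg c + (n - k + mdeg (msub m c)) = n + mdeg m)%N.
  by rewrite addnACA mdeg_sub // subnKC // -ltnS.
by rewrite -(leq_add2l (k + mdeg c)) e2 (leq_trans _ h) // leq_add2r ltnW.
Qed.

Lemma znull_const f : znull (zconst f) <-> tate ab f.
Proof.
split=> [/(@znull_tate _ 0%N)//|tf]; apply/znullP; split=> [[|n]//|e e0] /=.
  by move=> e e0; exists 0%N => m _; rewrite ab0.
by exists 1%N => -[//|n] _ m; rewrite /zconst /= ab0.
Qed.

Lemma tate_const c : tate ab (tconst c : ts).
Proof.
move=> e e0; exists 1%N => m; rewrite /tconst; case: eqP => [->|_ _]; last by rewrite ab0.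
by rewrite mdeg0.
Qed.

Definition tateb : {pred ts} := fun f => `[< tate ab f >].
Definition znullb : {pred zs} := fun a => `[< znull a >].

Lemma zconstB f g : (zconst (f - g) : zs) = zconst f - zconst g.
Proof. by apply: funext => -[|n]; rewrite zcoefB /zconst //= subr0. Qed.
Lemma zconstM f g : (zconst (f * g) : zs) = zconst f * zconst g.
Proof. by apply: funext => -[|n]; rewrite zcoef_constM /zconst //= mulr0. Qed.

Lemma znull_subring : subring_closed znullb.
Proof.
split=> [|a b|a b]; rewrite ?inE.
- by apply/asboolP; rewrite -[1]/(zconst (@tone C s)) znull_const; apply: tate_const.
- by move=> /asboolP na /asboolP nb; apply/asboolP/znullD => //; apply: znullN.
by move=> /asboolP na /asboolP nb; apply/asboolP/znullM.
Qed.

HB.instance Definition _ := GRing.isSubringClosed.Build zs znullb znull_subring.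

(** Gauss's lemma without a residue field. Among the finitely many pairs of coefficients of maximal
    absolute value, one pair is alone with its sum of exponents, so the coefficient of the product
    at that sum has a single dominant term. *)
Lemma gauss_product a b n1 m1 n2 m2 : znull a -> znull b ->
  ab (a n1 m1) != 0 -> (forall n m, ab (a n m) <= ab (a n1 m1)) ->
  ab (b n2 m2) != 0 -> (forall n m, ab (b n m) <= ab (b n2 m2)) ->
  exists n m, ab ((a * b : zs) n m) = ab (a n1 m1) * ab (b n2 m2).
Proof.
set ra := ab (a n1 m1); set rb := ab (b n2 m2) => na nb ra0 Ha rb0 Hb.
have {}ra0 : 0 < ra by rewrite lt0r ra0 ab_ge0.
have {}rb0 : 0 < rb by rewrite lt0r rb0 ab_ge0.
have Da : exists2 l : seq (nat * mon s), (n1, m1) \in l &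
    forall p, (p \in l) = (ab (a p.1 p.2) == ra).
  have [l Hl] := (znull_fnull a).1 na _ ra0.
  exists [seq p <- l | ab (a p.1 p.2) == ra] => [|p].
    by rewrite mem_filter eqxx; apply/negPn/negP => /Hl; rewrite ltxx.
  rewrite mem_filter; case: eqP => //= e; apply/negPn/negP => /Hl.
  by rewrite /zflat e ltxx.
have Db : exists2 l : seq (nat * mon s), (n2, m2) \in l &
    forall p, (p \in l) = (ab (b p.1 p.2) == rb).
  have [l Hl] := (znull_fnull b).1 nb _ rb0.
  exists [seq p <- l | ab (b p.1 p.2) == rb] => [|p].
    by rewrite mem_filter eqxx; apply/negPn/negP => /Hl; rewrite ltxx.
  rewrite mem_filter; case: eqP => //= e; apply/negPn/negP => /Hl.
  by rewrite /zflat e ltxx.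
have [la la1 Hla] := Da; have [lb lb1 Hlb] := Db.
(* Strict convexity of the sum of squares: a pair maximizing it is the only pair with its sum. *)
pose Q (p p' : nat * mon s) := ((p.1 + p'.1) ^ 2 + \sum_i (p.2 i + p'.2 i) ^ 2)%N.
have /(seq_argmax (fun pp => Q pp.1 pp.2)) : ((n1, m1), (n2, m2)) \in [seq (x, y) | x <- la, y <- lb].
  by apply/allpairsP; exists ((n1, m1), (n2, m2)).
move=> [_ /allpairsP[[[k1 c1] [k2 c2]] /= [h1 h2 ->]] Hmax].
have uniq_sum k1' c1' k2' c2' : (k1', c1') \in la -> (k2', c2') \in lb ->
    (k1' + k2' = k1 + k2)%N -> madd c1' c2' = madd c1 c2 -> k1' = k1 /\ c1' = c1.
  move=> h1' h2' ek ec.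
  have eci i : (c1' i + c2' i = c1 i + c2 i)%N.
    by move/ffunP: ec => /(_ i); rewrite !ffunE.
  have := Hmax ((k1, c1), (k2', c2')); have := Hmax ((k1', c1'), (k2, c2)).
  move=> /(_ (allpairs_f _ h1' h2)) M1 /(_ (allpairs_f _ h1 h2')) M2.
  move: M1 M2; rewrite /Q /= !leEnat => M1 M2.
  have eS : (\sum_i (c1' i + c2 i) ^ 2 + \sum_i (c1 i + c2' i) ^ 2 =
      \sum_i (c1 i + c2 i) ^ 2 + \sum_i (c1 i + c2 i) ^ 2 +
      2 * \sum_i ((c1 i - c1' i) ^ 2 + (c1' i - c1 i) ^ 2))%N.
    by rewrite big_distrr -!big_split /=; apply: eq_bigr => i _; apply: square_swap.
  have eK := square_swap ek.
  have : (((k1 - k1') ^ 2 + (k1' - k1) ^ 2) + \sum_i ((c1 i - c1' i) ^ 2 + (c1' i - c1 i) ^ 2) = 0)%N.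
    have key (a1 a2 x y b1 b2 d t : nat) : (a1 + b1 <= x + y -> a2 + b2 <= x + y ->
        b1 + b2 = y + y + 2 * t -> a1 + a2 = x + x + 2 * d -> d + t = 0)%N by lia.
    exact: key M1 M2 eS eK.
  move=> /eqP; rewrite addn_eq0 sum_nat_eq0 => /andP[/eqP z1 /forallP z2].
  split; first exact: square_sub_eq0.
  by apply/ffunP => i; apply: square_sub_eq0; apply/eqP/z2.
have v1 : ab (a k1 c1) = ra by apply/eqP; rewrite -(Hla (k1, c1)).
have v2 : ab (b k2 c2) = rb by apply/eqP; rewrite -(Hlb (k2, c2)).
exists (k1 + k2)%N, (madd c1 c2); rewrite zmul_mulE2.
have k1lt : (k1 < (k1 + k2).+1)%N by rewrite ltnS leq_addr.
rewrite (bigD1 (Ordinal k1lt)) //= (bigD1_seq c1) ?mem_mbelow ?mle_addr ?mbelow_uniq //=.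
rewrite addKn maddK -addrA abD_dom abM v1 v2 //.
have small k c : (k <= k1 + k2)%N -> mle c (madd c1 c2) -> (k, c) != (k1, c1) ->
    ab (a k c * b (k1 + k2 - k)%N (msub (madd c1 c2) c)) < ra * rb.
  move=> kk cc ne; rewrite abM lt_neqAle ler_pM ?ab_ge0 ?Ha ?Hb // andbT.
  apply/eqP => e.
  have ea : ab (a k c) = ra.
    apply/le_anti; rewrite Ha /= -(ler_pM2r rb0) -e ler_wpM2l ?ab_ge0 ?Hb //.
  have eb : ab (b (k1 + k2 - k)%N (msub (madd c1 c2) c)) = rb.
    by apply: (mulfI (lt0r_neq0 ra0)); rewrite -e ea.
  have := @uniq_sum k c (k1 + k2 - k)%N (msub (madd c1 c2) c).
  rewrite Hla Hlb ea eb !eqxx subnKC // maddBn // => /(_ isT isT erefl erefl) [ek ec].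
  by rewrite ek ec eqxx in ne.
have rr0 : 0 < ra * rb by rewrite mulr_gt0.
apply: abD_lt.
  rewrite -big_filter; apply: ab_sum_lt_seq => // c; rewrite mem_filter mem_mbelow => /andP[cn cm].
  have := @small k1 c (leq_addr _ _) cm; rewrite addKn; apply.
  by apply: contraNneq cn => -[->].
apply: ab_sum_lt => // k kn.
apply: ab_sum_lt_seq => // c; rewrite mem_mbelow => cm.
apply: small => //; first by rewrite -ltnS.
by apply: contraNneq kn => -[ek _]; apply/eqP/val_inj.
Qed.

Lemma znull_max a : znull a -> a != 0 ->
  exists n0 m0, ab (a n0 m0) != 0 /\ forall n m, ab (a n m) <= ab (a n0 m0).
Proof.
move=> na a0; have [[n1 m1] x1] : exists p : nat * mon s, zflat a p != 0.
  apply: contrapT => /forallNP h; move/eqP: a0; apply; apply: funext => n.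
  by apply: funext => m; apply/eqP/negPn/negP/(h (n, m)).
have [[n0 m0] [h1 h2]] := fnull_max ((znull_fnull a).1 na) x1.
by exists n0, m0; split=> // n m; apply: (h2 (n, m)).
Qed.

Lemma zmul_lower a : znull a -> a != 0 -> exists2 kappa : R, 0 < kappa &
  forall b rho, znull b -> zbnd (a * b) rho -> zbnd b (rho / kappa).
Proof.
move=> na a0; have [n1 [m1 [h1 H1]]] := znull_max na a0.
have k0 : 0 < ab (a n1 m1) by rewrite lt0r h1 ab_ge0.
exists (ab (a n1 m1)) => // b rho nb H n m.
have r0 := ab_bnd0 (mon0 s) (H 0%N).
have [->|b0] := eqVneq b 0; first by rewrite ab0 divr_ge0 // ltW.
have [n2 [m2 [h2 H2]]] := znull_max nb b0.
have [n' [m' e]] := gauss_product na nb h1 H1 h2 H2.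
apply: le_trans (H2 n m) _; rewrite ler_pdivlMr // mulrC -e; exact: H.
Qed.

Lemma zmul_eq0 a b : znull a -> znull b -> a * b = 0 -> a = 0 \/ b = 0.
Proof.
move=> na nb e; have [->|a0] := eqVneq a 0; [by left | right].
have [->//|b0] := eqVneq b 0; exfalso.
have [n1 [m1 [h1 H1]]] := znull_max na a0; have [n2 [m2 [h2 H2]]] := znull_max nb b0.
have [n [m]] := gauss_product na nb h1 H1 h2 H2.
by rewrite e ab0 => /esym/eqP; rewrite mulf_eq0 (negbTE h1) (negbTE h2).
Qed.

End NullSeries.

(** * Frobenius descent *)

Section Descent.
Variables (K : cinf) (I : eqType).
Local Notation C := (cC K).
Local Notation R := (cR K).
Local Notation io := (@cio K).
Local Notation ab := (@cab K).
Local Notation q := (Defs.q (cF K)).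
Implicit Types (x y v : I -> C).

Lemma bernoulli_pow (x : R) n : 0 <= x -> 1 + x *+ n <= (1 + x) ^+ n.
Proof.
move=> x0; elim: n => [|n IH]; first by rewrite expr0 mulr0n addr0.
rewrite exprS; apply: le_trans (_ : _ <= (1 + x) * (1 + x *+ n)) _.
  have : 0 <= x * (x *+ n) by rewrite mulr_ge0 ?mulrn_wge0.
  by rewrite mulrS; set t := x *+ n => ?; lra.
by rewrite ler_pM2l // ltr_pwDl.
Qed.

Lemma pow_lt_small (rho e : R) : 0 <= rho -> rho < 1 -> 0 < e ->
  exists N, forall n, (N <= n)%N -> rho ^+ n < e.
Proof.
move=> r0 r1 e0; have [->|rn0] := eqVneq rho 0.
  by exists 1%N => -[//|n] _; rewrite expr0n.
have rp : 0 < rho by rewrite lt0r rn0.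
have h0 : 0 < rho^-1 - 1 by rewrite subr_gt0 invf_gt1.
set h := rho^-1 - 1 in h0; have [N HN] : exists N, e^-1 < h *+ N.
  exists (Num.bound (e^-1 / h)); rewrite -mulr_natr mulrC -ltr_pdivrMr //.
  by apply: archi_boundP; rewrite divr_ge0 ?invr_ge0 // ltW.
exists N => n Nn; rewrite -[ltLHS]invrK -[ltRHS]invrK ltf_pV2 ?posrE ?invr_gt0 ?exprn_gt0 //.
rewrite -exprVn; have -> : rho^-1 = 1 + h by rewrite addrC subrK.
apply: lt_le_trans (bernoulli_pow n (ltW h0)); apply: lt_le_trans HN _.
by rewrite ler_wpDl ?ler01 // ler_wpMn2l ?ltW.
Qed.

Lemma powq_lt_small (rho e : R) : 0 <= rho -> rho < 1 -> 0 < e ->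
  exists N, forall n, (N <= n)%N -> rho ^+ (q ^ n) < e.
Proof.
move=> r0 r1 /(pow_lt_small r0 r1)[N HN]; exists N => n Nn; apply: HN.
by apply: leq_trans Nn (ltnW (ltn_expl _ (q_gt1 K))).
Qed.

Variables Rp Lp : (I -> C) -> Prop.
Hypothesis Rnull : forall x, Rp x -> fnull x.
Hypothesis RD : forall x y, Rp x -> Rp y -> Rp (fun i => x i + y i).
Hypothesis RZ : forall c x, Rp x -> Rp (fun i => c * x i).
Hypothesis Rfrob : forall x, Rp x -> Rp (fun i => x i ^+ q).
Hypothesis Rlim : forall u x, (forall n, Rp (u n)) -> uconv u x -> Rp x.

(** Scale x so that its entry at i0 is 1 and let z = x^q - x, which vanishes at i0. If z has norm 1,
    it attains it at fewer indices than x and induction applies. Otherwise the sum of the z^(q^n)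
    converges and telescopes: x^(q^n) tends to a Frobenius-fixed vector close to x. *)
Lemma fixed_vector_norm1 n x (l : seq I) : (size l <= n)%N -> Rp x ->
  (forall i, ab (x i) <= 1) -> (exists i0, ab (x i0) = 1) ->
  (forall i, ab (x i) = 1 -> i \in l) ->
  exists v i0, [/\ Rp v, forall i, exists a, v i = io a, v i0 != 0 &
    forall i, v i != 0 -> ab (x i) = 1].
Proof.
elim: n x l => [|n IH] x l.
  by rewrite leqn0 size_eq0 => /eqP -> _ _ [i h] /(_ i h).
move=> sl Rx x1 [i0 xi0] xl.
have xi0n : x i0 != 0 by rewrite -ab_eq0 xi0 oner_eq0.
pose x' i := (x i0)^-1 * x i.
have Rx' : Rp x' := RZ _ Rx.
have ax' i : ab (x' i) = ab (x i) by rewrite abM abV xi0 invr1 mul1r.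
pose z i := x' i ^+ q + (-1) * x' i.
have Rz : Rp z by apply: RD; [exact: Rfrob | exact: RZ].
have z_le1 i : ab (z i) <= 1.
  rewrite abD_le ?mulN1r ?abN ?ax' ?x1 // abX ax'.
  by rewrite exprn_ile1 ?ab_ge0.
have z_eq1 i : ab (z i) = 1 -> ab (x i) = 1.
  move=> zi; apply/eqP; rewrite eq_le x1 /= leNgt; apply/negP => xi.
  have : ab (z i) < 1.
    rewrite abD_lt ?mulN1r ?abN ?ax' // abX ax'.
    by rewrite exprn_ilt1 ?ab_ge0 // -lt0n q_gt0.
  by rewrite zi ltxx.
have zi0 : z i0 = 0 by rewrite /z /x' mulVf // expr1n mulr1 subrr.
have [[i1 zi1]|/forallNP zlt] := pselect (exists i, ab (z i) = 1).
  have [|i zi|v [j [Rv vF vj vz]]] := @IH z (filter (predC1 i0) l) _ Rz z_le1 (ex_intro _ i1 zi1).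
  - rewrite -ltnS (leq_trans _ sl) // -(count_predC (pred1 i0) l) size_filter.
    by rewrite -addn1 addnC leq_add2r -has_count has_pred1 xl.
  - rewrite mem_filter xl ?z_eq1 // andbT /=; apply/eqP => e.
    by move: zi; rewrite e zi0 ab0 => /esym/eqP; rewrite oner_eq0.
  by exists v, j; split=> // i /vz/z_eq1.
(* A null family attains its largest absolute value, so being below 1 at each index yields a uniform
   bound below 1. *)
have [rho [r0 r1 zr]] : exists rho, [/\ 0 <= rho, rho < 1 & forall i, ab (z i) <= rho].
  have [z0|/existsNP[i1 /eqP zi1]] := pselect (forall i, z i = 0).
    by exists 0; split=> // i; rewrite z0 ab0.
  have [i2 [_ H2]] := fnull_max (Rnull Rz) zi1.
  exists (ab (z i2)); split=> //; first exact: ab_ge0.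
  by rewrite lt_neqAle z_le1 andbT; apply/eqP/zlt.
have [w Hw] : exists w, usums (fun n i => z i ^+ (q ^ n)) w.
  apply: usums_ex => e e0; have [N HN] := powq_lt_small r0 r1 e0.
  exists N => k Nk i; apply: le_lt_trans (HN k Nk).
  by rewrite abX lerXn2r ?nnegrE ?ab_ge0.
have psum k i : \sum_(j < k) z i ^+ (q ^ j) = x' i ^+ (q ^ k) - x' i.
  elim: k => [|k IHk]; first by rewrite big_ord0 expn0 expr1 subrr.
  rewrite big_ord_recr /= IHk /z; move: (x' i) => t.
  by rewrite mulN1r -!frobz_nat frobz_add frobz_opp !frobz_nat -exprM -expnS addrC addrA subrK.
pose v i := w i + x' i.
have uv : uconv (fun k i => x' i ^+ (q ^ k)) v.
  apply: eq_uconv (uconvD Hw (uconv_cst x')) => k i /=.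
  by rewrite psum subrK.
have Rv : Rp v.
  apply: Rlim uv; elim=> [|k IHk]; first by rewrite (_ : (fun i => _) = x') //; apply: funext.
  by move: (Rfrob IHk); congr Rp; apply: funext => i; rewrite -exprM -expnSr.
have vfix i : v i ^+ q = v i.
  suff : (fun i => v i ^+ q) = v by move/(congr1 (fun f => f i)).
  apply: uconv_unique (uconv_shift 1 uv) => e e0.
  have m0 : 0 < Num.min e 1 by rewrite lt_min e0 ltr01.
  have [N HN] := uv _ m0; exists N => k Nk j.
  have := HN k Nk j; rewrite lt_min => /andP[h1 h2].
  rewrite addn1 expnSr exprM -frobB abX; apply: le_lt_trans h1.
  by rewrite -[leRHS]expr1 ler_wiXn2l ?ab_ge0 ?q_gt0 // ltW.
have w1 i : ab (w i) < 1.
  apply: le_lt_trans r1; apply: (usums_bnd r0 Hw) => k j.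
  rewrite abX; apply: le_trans (zr j); rewrite -[leRHS]expr1.
  by rewrite ler_wiXn2l ?ab_ge0 ?qn_gt0 // z_le1.
exists v, i0; split=> // [i||i vi].
- exact: frob_fixed.
- rewrite -ab_eq0 /v addrC abD_dom ax' xi0 ?oner_eq0 //.
(* A nonzero entry of v lies in F_q, hence has absolute value 1, and it differs from the entry of x'
   by less than 1. *)
apply/eqP; rewrite -ax' eq_le ax' x1 /= -ax' leNgt; apply/negP => xi.
have [a va] := frob_fixed (vfix i).
have a0 : a != 0 by apply: contraNneq vi => a0; rewrite va a0 rmorph0.
by have := abD_lt (w1 i) xi; rewrite -/(v i) va ab_io // ltxx.
Qed.

Lemma fixed_vector x i1 : Rp x -> x i1 != 0 ->
  exists v i0, [/\ Rp v, forall i, exists a, v i = io a, v i0 != 0 &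
    forall i, v i != 0 -> forall j, ab (x j) <= ab (x i)].
Proof.
move=> Rx xi1; have [i0 [xi0 xmax]] := fnull_max (Rnull Rx) xi1.
have p0 : 0 < ab (x i0) by rewrite lt0r xi0 ab_ge0.
pose y i := (x i0)^-1 * x i.
have ay i : ab (y i) = ab (x i) / ab (x i0) by rewrite abM abV mulrC.
have Ry : Rp y := RZ _ Rx.
have [l Hl] := Rnull Ry ltr01.
have [||i yi|v [j [Rv vF vj vy]]] := @fixed_vector_norm1 (size l) y l (leqnn _) Ry.
- by move=> i; rewrite ay ler_pdivrMr // mul1r.
- by exists i0; rewrite ay divff.
- by apply/negPn/negP => /Hl; rewrite yi ltxx.
exists v, j; split=> // i /vy; rewrite ay => /(congr1 (fun t => t * ab (x i0))).
by rewrite divfK // mul1r => -> k.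
Qed.

Hypothesis L0 : Lp (fun=> 0).
Hypothesis LD : forall x y, Lp x -> Lp y -> Lp (fun i => x i + y i).
Hypothesis LZ : forall c x, Lp x -> Lp (fun i => c * x i).
Hypothesis Llim : forall u x, (forall n, Lp (u n)) -> uconv u x -> Lp x.
Hypothesis LF : forall v, Rp v -> (forall i, exists a, v i = io a) -> Lp v.

Lemma descent_approx n e x (l : seq I) : 0 < e -> (size l <= n)%N -> Rp x ->
  (forall i, i \notin l -> ab (x i) < e) ->
  exists2 y, Lp y & forall i, ab (x i - y i) < e.
Proof.
move=> e0; elim: n x l => [|n IH] x l sl Rx Hl.
  exists (fun=> 0) => // i; rewrite subr0 Hl //.
  by move: sl; rewrite leqn0 size_eq0 => /eqP ->.
have [sm|/existsNP[i1 /negP]] := pselect (forall i, ab (x i) < e).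
  by exists (fun=> 0) => // i; rewrite subr0.
rewrite -leNgt => xi1; have x1 : x i1 != 0 by rewrite -ab_eq0 gt_eqF // (lt_le_trans e0).
have [v [i0 [Rv vF vi0 vmax]]] := fixed_vector Rx x1.
pose c := x i0 / v i0; pose x' i := x i + (- c) * v i.
have Rx' : Rp x' by apply: RD => //; apply: RZ.
(* v is supported where |x| is maximal, hence inside l, so the subtraction leaves the entries
   outside l untouched. *)
have vl i : v i != 0 -> i \in l.
  move=> /vmax/(_ i1) h; apply/negPn/negP => /Hl.
  by rewrite ltNge (le_trans xi1 h).
have [|i|y Ly Hy] := IH x' (filter (predC1 i0) l) _ Rx'.
- rewrite -ltnS (leq_trans _ sl) // -(count_predC (pred1 i0) l) size_filter.
  by rewrite -addn1 addnC leq_add2r -has_count has_pred1 vl.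
- rewrite mem_filter negb_and negbK /= => /orP[/eqP ->|il].
    by rewrite /x' mulNr divfK // subrr ab0.
  have [vi|/vl] := eqVneq (v i) 0; last by rewrite (negbTE il).
  by rewrite /x' vi mulr0 addr0 Hl.
exists (fun i => y i + c * v i); first by apply: LD => //; apply: LZ; apply: LF.
by move=> i; have := Hy i; rewrite /x' mulNr -addrA -opprD [c * _ + _]addrC.
Qed.

(* A closed Frobenius-stable C-subspace is the closure of the span of its F_q-valued vectors. *)
Lemma descent x : Rp x -> Lp x.
Proof.
move=> Rx; have H n : exists y, Lp y /\ forall i, ab (x i - y i) < n.+1%:R^-1.
  have e0 : 0 < n.+1%:R^-1 :> R by rewrite invr_gt0 ltr0n.
  have [l Hl] := Rnull Rx e0.
  by have [y] := descent_approx e0 (leqnn _) Rx Hl; exists y.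
have [u Hu] := choice H; apply: (Llim (u := u)) => [n|e e0]; first by have [] := Hu n.
exists (Num.bound e^-1) => n Nn i; rewrite abBC; apply: lt_trans (proj2 (Hu n) i) _.
rewrite -[ltRHS]invrK ltf_pV2 ?posrE ?invr_gt0 ?ltr0n //.
apply: lt_le_trans (archi_boundP _) _; first by rewrite invr_ge0 ltW.
by rewrite ler_nat leqW.
Qed.

End Descent.

(* The Tate algebra in t_1, ..., t_s and z over C_oo. *)
Record nser (K : cinf) (s : nat) := NSer { nval : @zser (cC K) s; _ : nval \in @znullb K s }.
Arguments nval {K s} _ : simpl never.

(** * The integral domain S and its twists *)

Section NullSeriesRing.
Variables (K : cinf) (s : nat).
Local Notation F := (cF K).
Local Notation C := (cC K).
Local Notation R := (cR K).
Local Notation ab := (@cab K).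
Local Notation q := (Defs.q (cF K)).
Local Notation ts := (@tser (cC K) s).
Local Notation zs := (@zser (cC K) s).
Local Notation S := (nser K s).

HB.instance Definition _ := [isSub of S for @nval K s].
HB.instance Definition _ := [Choice of S by <:].
HB.instance Definition _ := [SubChoice_isSubComNzRing of S by <:].

Lemma nvalP (a : S) : znull (nval a).
Proof. exact/asboolP/(valP a). Qed.

Lemma nval_inj : injective (@nval K s). Proof. exact: val_inj. Qed.

Definition toS (a : zs) : S := insubd (0 : S) a.

Lemma toSK a : znull a -> nval (toS a) = a.
Proof. by move=> na; apply: insubdK; apply/asboolP. Qed.

Lemma nvalD (a b : S) : nval (a + b) = nval a + nval b. Proof. exact: (rmorphD (\val : S -> zs)). Qed.
Lemma nvalN (a : S) : nval (- a) = - nval a. Proof. exact: (rmorphN (\val : S -> zs)). Qed.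
Lemma nvalB (a b : S) : nval (a - b) = nval a - nval b. Proof. exact: (rmorphB (\val : S -> zs)). Qed.
Lemma nvalM (a b : S) : nval (a * b) = nval a * nval b. Proof. exact: (rmorphM (\val : S -> zs)). Qed.
Lemma nval0 : nval (0 : S) = 0. Proof. exact: (rmorph0 (\val : S -> zs)). Qed.
Lemma nval1 : nval (1 : S) = 1. Proof. exact: (rmorph1 (\val : S -> zs)). Qed.
Lemma nval_sum I (r : seq I) (P : pred I) (u : I -> S) :
  nval (\sum_(i <- r | P i) u i) = \sum_(i <- r | P i) nval (u i).
Proof. exact: (rmorph_sum (\val : S -> zs)). Qed.

Definition nunit : {pred S} := fun a => `[< exists b, b * a = 1 >].
Definition ninv (a : S) : S :=
  if pselect (exists b, b * a = 1) is left h then sval (cid h) else a.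

Lemma nmulV : {in nunit, left_inverse 1 ninv *%R}.
Proof.
by move=> a /asboolP h; rewrite /ninv; case: pselect => // h'; case: (cid h').
Qed.
Lemma nunitP (a b : S) : b * a = 1 -> nunit a.
Proof. by move=> h; apply/asboolP; exists b. Qed.
Lemma ninv_out : {in [predC nunit], ninv =1 id}.
Proof. by move=> a /asboolPn h; rewrite /ninv; case: pselect. Qed.

HB.instance Definition _ := GRing.ComNzRing_hasMulInverse.Build S nmulV nunitP ninv_out.

Lemma nser_integral : GRing.integral_domain_axiom S.
Proof.
move=> a b /(congr1 (@nval K s)); rewrite nvalM nval0.
case/(zmul_eq0 (nvalP a) (nvalP b)) => h; apply/orP; [left | right];
  by apply/eqP/nval_inj; rewrite h nval0.
Qed.

HB.instance Definition _ := GRing.ComUnitRing_isIntegral.Build S nser_integral.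

Lemma unitS (a b : S) : a * b = 1 -> a \is a GRing.unit.
Proof. by rewrite mulrC => h; apply/unitrP; exists b; rewrite h mulrC. Qed.

Definition ztwist (n : int) (a : zs) : zs := fun k => twist F n (a k).

Lemma ztwist_null n a : znull a -> znull (ztwist n a).
Proof.
case: n => n na e e0.
  have m0 : 0 < Num.min e 1 by rewrite lt_min e0 ltr01.
  have [N HN] := na _ m0; exists N => k m /HN; rewrite lt_min => /andP[h1 h2].
  rewrite /ztwist /twist ab_frobz; apply: le_lt_trans h1; rewrite -[leRHS]expr1.
  by rewrite ler_wiXn2l ?ab_ge0 ?qn_gt0 // ltW.
have [N HN] := na _ (exprn_gt0 (q ^ n.+1) e0); exists N => k m /HN.
rewrite /ztwist /twist NegzE -(ab_frobzN n.+1 (a k m)).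
by rewrite ltr_pXn2r ?nnegrE ?ab_ge0 ?qn_gt0 // ltW.
Qed.

Lemma ztwist_zmod n : zmod_morphism (ztwist n).
Proof. by move=> a b; apply: funext => k; rewrite /ztwist !zcoefB rmorphB. Qed.
Lemma ztwist_monoid n : monoid_morphism (ztwist n).
Proof.
split=> [|a b]; apply: funext => k; rewrite /ztwist.
  by case: k => [|k]; [exact: (rmorph1 (@twist F C s n)) | exact: (rmorph0 (@twist F C s n))].
by rewrite !zcoefM rmorph_sum; apply: eq_bigr => i _; rewrite rmorphM.
Qed.
HB.instance Definition _ n := GRing.isZmodMorphism.Build zs zs (ztwist n) (ztwist_zmod n).
HB.instance Definition _ n := GRing.isMonoidMorphism.Build zs zs (ztwist n) (ztwist_monoid n).

Lemma ztwist_comp m n a : ztwist m (ztwist n a) = ztwist (m + n) a.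
Proof. by apply: funext => k; rewrite /ztwist twist_comp. Qed.
Lemma ztwist0 a : ztwist 0 a = a. Proof. by []. Qed.
Lemma ztwist_const n f : ztwist n (zconst f) = zconst (twist F n f).
Proof. by apply: funext => -[|k] //; rewrite /ztwist /zconst /=; apply: rmorph0. Qed.

Definition stwist (n : int) (a : S) : S := toS (ztwist n (nval a)).
Lemma nval_twist n a : nval (stwist n a) = ztwist n (nval a).
Proof. by rewrite toSK //; apply/ztwist_null/nvalP. Qed.
Lemma stwist_zmod n : zmod_morphism (stwist n).
Proof. by move=> a b; apply: nval_inj; rewrite !(nvalB, nval_twist) rmorphB. Qed.
Lemma stwist_monoid n : monoid_morphism (stwist n).
Proof.
split=> [|a b]; apply: nval_inj; rewrite !(nvalM, nval_twist, nval1) ?rmorph1 //.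
by rewrite rmorphM.
Qed.
HB.instance Definition _ n := GRing.isZmodMorphism.Build S S (stwist n) (stwist_zmod n).
HB.instance Definition _ n := GRing.isMonoidMorphism.Build S S (stwist n) (stwist_monoid n).

Lemma stwist_comp m n a : stwist m (stwist n a) = stwist (m + n) a.
Proof. by apply: nval_inj; rewrite !nval_twist ztwist_comp. Qed.
Lemma stwist0 a : stwist 0 a = a.
Proof. by apply: nval_inj; rewrite nval_twist ztwist0. Qed.

Definition scst (f : ts) : S := toS (zconst f).
Lemma nval_cst f : tate ab f -> nval (scst f) = zconst f.
Proof. by move=> tf; rewrite toSK // znull_const. Qed.

Definition sconv (u : nat -> S) (g : S) := forall e : R, 0 < e -> exists N,
  forall n, (N <= n)%N -> forall k m, ab (nval (u n) k m - nval g k m) < e.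

Lemma sconvP u g : sconv u g <-> uconv (fun n => zflat (nval (u n))) (zflat (nval g)).
Proof.
split=> H e /H[N HN]; exists N => n Nn; first by move=> -[k m]; apply: HN.
by move=> k m; apply: (HN n Nn (k, m)).
Qed.

Lemma sconv_unique u g g' : sconv u g -> sconv u g' -> g = g'.
Proof.
move=> /sconvP h /sconvP h'; apply: nval_inj; apply: funext => k; apply: funext => m.
by have /(congr1 (fun x => x (k, m))) := uconv_unique h h'.
Qed.

Lemma sconv_ex u :
  (forall e : R, 0 < e -> exists N, forall n p, (N <= n)%N -> (N <= p)%N ->
     zbnd (nval (u n - u p)) e) -> exists g, sconv u g.
Proof.
move=> H.
have [e e0|g Hg] := @uconv_ex K _ (fun n => zflat (nval (u n))).
  have e2 : 0 < e / 2 by rewrite divr_gt0.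
  have [N HN] := H _ e2; exists N => n p Nn Np [k m] /=.
  have := HN n p Nn Np k m; rewrite nvalB zcoefB tcoefB => h.
  by apply: le_lt_trans h _; rewrite ltr_pdivrMr // ltr_pMr // ltr1n.
have ng : znull (fun k m => g (k, m) : C).
  apply/znull_fnull; apply: (@uconv_fnull K _ (fun n => zflat (nval (u n)))).
    by move: Hg; congr uconv; apply: funext => -[].
  by move=> n; apply/znull_fnull/nvalP.
exists (toS (fun k m => g (k, m))); apply/sconvP; rewrite toSK //.
by move: Hg; congr uconv; apply: funext => -[].
Qed.

Lemma sconvD u v g h : sconv u g -> sconv v h -> sconv (fun n => u n + v n) (g + h).
Proof.
move=> ug vh e e0; have [N HN] := ug _ e0; have [M HM] := vh _ e0.
exists (maxn N M) => n; rewrite geq_max => /andP[Nn Mn] k m.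
by rewrite !nvalD !zcoefD !tcoefD opprD addrACA abD_lt ?HN ?HM.
Qed.

Lemma sconv_cst g : sconv (fun=> g) g.
Proof. by move=> e e0; exists 0%N => n _ k m; rewrite subrr ab0. Qed.

Lemma sconvZ a u g : sconv u g -> sconv (fun n => a * u n) (a * g).
Proof.
move=> ug e e0; have [rho r1 Ha] := znull_zbnd (nvalP a).
have r0 : 0 < rho := lt_le_trans ltr01 r1.
have e1 : 0 < e / rho / 2 by rewrite !divr_gt0.
have [N HN] := ug _ e1; exists N => n Nn k m.
have -> : nval (a * u n) k m - nval (a * g) k m = nval (a * (u n - g)) k m.
  by rewrite mulrBr nvalB zcoefB tcoefB.
have hb : zbnd (nval (u n - g)) (e / rho / 2).
  by move=> k' m'; rewrite nvalB zcoefB tcoefB ltW // HN.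
have := zbndM Ha hb k m; rewrite -nvalM => h; apply: le_lt_trans h _.
have -> : rho * (e / rho / 2) = e / 2 by field; rewrite gt_eqF.
by rewrite ltr_pdivrMr // ltr_pMr // ltr1n.
Qed.

Lemma sconv_sum I (r : seq I) (u : I -> nat -> S) (g : I -> S) :
  (forall i, sconv (u i) (g i)) -> sconv (fun n => \sum_(i <- r) u i n) (\sum_(i <- r) g i).
Proof.
move=> H; elim: r => [|i r IH].
  by rewrite big_nil; under eq_fun do rewrite big_nil; apply: sconv_cst.
by rewrite big_cons; under eq_fun do rewrite big_cons; apply: sconvD.
Qed.

(* Divisibility by a fixed element is a closed condition because the Gauss norm is multiplicative. *)
Lemma sconv_dvd c (u y : nat -> S) x : sconv u x -> (forall n, u n = c * y n) ->
  exists z, x = c * z.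
Proof.
move=> ux uy; have [c0|cn0] := eqVneq c 0.
  exists 0; apply: sconv_unique ux _; rewrite c0 mul0r.
  by move=> e e0; exists 0%N => n _ k m; rewrite uy c0 mul0r subrr ab0.
have nc0 : nval c != 0 by apply: contraNneq cn0 => h; apply/eqP/nval_inj; rewrite h nval0.
have [kap k0 Hk] := zmul_lower (nvalP c) nc0.
have [|z Hz] := @sconv_ex y; last first.
  exists z; apply: sconv_unique ux _.
  by have := sconvZ c Hz; under eq_fun do rewrite -uy.
move=> e e0; have [N HN] := ux _ (mulr_gt0 e0 k0); exists N => n p Nn Np.
have -> : e = e * kap / kap by rewrite mulfK // gt_eqF.
apply: Hk; first exact: nvalP.
move=> k m; rewrite -nvalM mulrBr -!uy nvalB zcoefB tcoefB ltW //.
by apply: ab_tri (HN _ Nn k m) _; rewrite abBC HN.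
Qed.

End NullSeriesRing.

(** * An invertibility criterion by Frobenius descent *)

Section Moore.
Variables (K : cinf) (s : nat).
Local Notation C := (cC K).
Local Notation ab := (@cab K).
Local Notation q := (Defs.q (cF K)).
Local Notation S := (nser K s).
Local Notation tau := (@stwist K s 1).

Definition sconst (c : C) : S := scst (tconst c).

Lemma nval_sconstM c (a : S) k m : nval (sconst c * a) k m = c * nval a k m.
Proof. by rewrite nvalM nval_cst ?zcoef_constM ?tcoef_constM //; apply: tate_const. Qed.

Lemma nval_tau (a : S) k m : nval (tau a) k m = nval a k m ^+ q.
Proof. by rewrite nval_twist. Qed.

(** The congruence v M = 0 modulo c. It is the left kernel of M for c = 0 and divisibility of v by c
    for M = 1, so that one descent statement relates all these closed submodules. *)
Definition divides_mx n k (c : S) (M : 'M[S]_(n, k)) (v : 'rV[S]_n) :=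
  exists y : 'rV[S]_k, v *m M = c *: y.

Definition flat n (v : 'rV[S]_n) : 'I_n * (nat * mon s) -> C :=
  fun p => nval (v ord0 p.1) p.2.1 p.2.2.

Lemma flat_inj n : injective (@flat n).
Proof.
move=> v w e; apply/rowP => i; apply: nval_inj; apply: funext => k; apply: funext => m.
exact: (congr1 (fun x => x (i, (k, m))) e).
Qed.

Lemma flat_null n (v : 'rV[S]_n) : fnull (flat v).
Proof.
move=> e e0; have H i : exists l : seq (nat * mon s), forall p, p \notin l -> ab (zflat (nval (v ord0 i)) p) < e.
  by apply: (znull_fnull _).1 e0; apply: nvalP.
have [l Hl] := choice H.
exists [seq (i, p) | i <- enum 'I_n, p <- l i] => -[i p] h; apply: (Hl i).
apply: contra h => pl; apply/allpairsPdep; exists i, p; split=> //; exact: mem_enum.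
Qed.

Lemma flat_limit n (u : nat -> 'rV[S]_n) x : uconv (fun j => flat (u j)) x ->
  exists2 g, x = flat g & forall i, sconv (fun j => u j ord0 i) (g ord0 i).
Proof.
move=> ux; have H i : exists g, sconv (fun j => u j ord0 i) g /\
    forall k m, nval g k m = x (i, (k, m)).
  have [e e0|g Hg] := @sconv_ex K s (fun j => u j ord0 i).
    have [N HN] := ux _ e0; exists N => j p Nj Np k m.
    rewrite nvalB zcoefB tcoefB ltW //; apply: ab_tri (HN j Nj (i, (k, m))) _.
    by rewrite abBC; apply: (HN p Np (i, (k, m))).
  exists g; split=> // k m.
  have ui : uconv (fun j => zflat (nval (u j ord0 i))) (fun p => x (i, p)).
    by move=> e /ux[N HN]; exists N => j Nj p; apply: HN Nj (i, p).
  by rewrite -[LHS]/(zflat (nval g) (k, m)) (uconv_unique ((sconvP _ _).1 Hg) ui).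
have [g Hg] := choice H; exists (\row_i g i).
  by apply: funext => -[i [k m]]; rewrite /flat mxE (proj2 (Hg i)).
by move=> i; rewrite mxE; case: (Hg i).
Qed.

Lemma divides_mx_limit n k c (M : 'M[S]_(n, k)) (u : nat -> 'rV[S]_n) (g : 'rV[S]_n) :
  (forall j, divides_mx c M (u j)) ->
  (forall i, sconv (fun j => u j ord0 i) (g ord0 i)) -> divides_mx c M g.
Proof.
move=> /choice[y Hy] Hg.
have H l : exists z, (g *m M) ord0 l = c * z.
  apply: (@sconv_dvd K s c (fun j => (u j *m M) ord0 l) (fun j => y j ord0 l)).
    rewrite mxE; under eq_fun do rewrite mxE.
    by apply: sconv_sum => i; rewrite mulrC; under eq_fun do rewrite mulrC; apply: sconvZ.
  by move=> j; rewrite Hy mxE.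
have [z Hz] := choice H; exists (\row_l z l).
by apply/rowP => l; rewrite Hz !mxE.
Qed.

(** All coefficients of a row vector over S form one null family, indexed by coordinate and
    exponents, so Frobenius descent applies: an inclusion of such submodules need only be tested on
    tau-fixed vectors. *)
Lemma divides_mx_descent n k1 k2 c1 c2 (M1 : 'M[S]_(n, k1)) (M2 : 'M[S]_(n, k2)) :
  (forall v, divides_mx c1 M1 v -> divides_mx c1 M1 (map_mx tau v)) ->
  (forall v, divides_mx c1 M1 v -> map_mx tau v = v -> divides_mx c2 M2 v) ->
  forall v, divides_mx c1 M1 v -> divides_mx c2 M2 v.
Proof.
pose P k c (M : 'M[S]_(n, k)) x := exists2 v, divides_mx c M v & x = flat v.
have PD k c (M : 'M[S]_(n, k)) x y : P _ c M x -> P _ c M y -> P _ c M (fun i => x i + y i).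
  move=> [v [z vz] ->] [w [t wt] ->]; exists (v + w).
    by exists (z + t); rewrite mulmxDl vz wt scalerDr.
  by apply: funext => p; rewrite /flat mxE nvalD.
have PZ k c (M : 'M[S]_(n, k)) a x : P _ c M x -> P _ c M (fun i => a * x i).
  move=> [v [z vz] ->]; exists (sconst a *: v).
    by exists (sconst a *: z); rewrite -scalemxAl vz !scalerA mulrC.
  by apply: funext => p; rewrite /flat mxE nval_sconstM.
have Plim k c (M : 'M[S]_(n, k)) u x : (forall j, P _ c M (u j)) -> uconv u x -> P _ c M x.
  move=> H ux; have {}H j : exists v, divides_mx c M v /\ u j = flat v.
    by have [v] := H j; exists v.
  have [v Hv] := choice H.
  have [|g -> Hg] := @flat_limit n v x.
    by move: ux; congr uconv; apply: funext => j; case: (Hv j).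
  by exists g => //; apply: divides_mx_limit Hg => j; case: (Hv j).
move=> stab fixed v v1; have Pv : P _ c1 M1 (flat v) by exists v.
suff [w w2 /flat_inj ->] : P _ c2 M2 (flat v) by [].
move: Pv; apply: (@descent K _ (P _ c1 M1) (P _ c2 M2)).
- by move=> x [w _ ->]; apply: flat_null.
- exact: PD.
- exact: PZ.
- move=> x [w /stab h ->]; exists (map_mx tau w) => //.
  by apply: funext => p; rewrite /flat mxE nval_tau.
- exact: Plim.
- exists 0; first by exists 0; rewrite mul0mx scaler0.
  by apply: funext => p; rewrite /flat mxE nval0.
- exact: PD.
- exact: PZ.
- exact: Plim.
move=> x [w w1 ->] xF; exists w => //; apply: fixed => //.
apply/rowP => i; rewrite mxE; apply: nval_inj; apply: funext => k; apply: funext => m.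
by rewrite nval_tau; have [a] := xF (i, (k, m)); rewrite /flat /= => ->; apply: frob_io.
Qed.

(** By descent the saturation hypothesis extends from fixed v to all v; c = 0 gives a nonzero
    determinant. A nonzero fixed multiple c of det M then yields N, a multiple of the adjugate, with
    N M = c. Its rows are divisible by c, and the quotient inverts M. *)
Lemma moore_unit r (M Th Th' : 'M[S]_r) :
  map_mx tau M = M *m Th -> M = map_mx tau M *m Th' ->
  (forall c v, tau c = c -> map_mx tau v = v -> divides_mx c M v -> exists w, v = c *: w) ->
  M \in unitmx.
Proof.
move=> tM Mt sat.
have stab c v : tau c = c -> divides_mx c M v -> divides_mx c M (map_mx tau v).
  move=> tc [y vy]; exists (map_mx tau y *m Th').
  by rewrite [M in LHS]Mt mulmxA -map_mxM vy map_mxZ /= tc scalemxAl.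
have sat' c v : tau c = c -> divides_mx c M v -> divides_mx c 1%:M v.
  move=> tc; apply: divides_mx_descent => {}v; first exact: stab.
  by move=> vc vt; have [w ->] := sat c v tc vt vc; exists w; rewrite mulmx1.
have det0 : \det M != 0.
  apply/negP => /det0P[v v0 vM].
  have [||w] := @sat' 0 v; first by rewrite rmorph0.
    by exists 0; rewrite vM scale0r.
  by rewrite mulmx1 scale0r => e; rewrite e eqxx in v0.
have [c [tc c0 [g cg]]] : exists c, [/\ tau c = c, c != 0 & exists g, c = \det M * g].
  apply: contrapT => H.
  (* The ideal of det M is stable since tau(det M) = det M det Th. If zero were its only fixed
     element, descent would place it inside the zero ideal. *)
  have : divides_mx 0 (1%:M : 'M_1) (const_mx (\det M)).
    apply: (@divides_mx_descent 1 1 1 (\det M) 0 1%:M 1%:M) => [v [y]|v [y]|].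
    - rewrite mulmx1 => ->; exists (\det Th *: map_mx tau y).
      by rewrite mulmx1 map_mxZ -det_map_mx tM det_mulmx scalerA.
    - rewrite mulmx1 => vy tv; exists 0; rewrite mulmx1 scale0r.
      apply/rowP => i; rewrite (ord1 i) mxE; apply: contrapT => /eqP v0; apply: H.
      exists (v ord0 ord0); split=> //; first by rewrite -{2}tv mxE.
      by exists (y ord0 ord0); rewrite vy mxE.
    by exists (const_mx 1); apply/rowP => i; rewrite mulmx1 !mxE mulr1.
  move=> [y]; rewrite mulmx1 scale0r => /rowP/(_ ord0); rewrite !mxE => e.
  by rewrite e eqxx in det0.
pose N := g *: \adj M.
have NM : N *m M = c%:M by rewrite -scalemxAl mul_adj_mx scale_scalar_mx mulrC cg.
have rowN i : exists w : 'rV_r, row i N = c *: w.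
  have [|w] := @sat' c (row i N) tc; last by rewrite mulmx1; exists w.
  by exists (delta_mx 0 i); rewrite -row_mul NM rowE mul_mx_scalar.
have [w Hw] := choice rowN.
have cc : c *: ((\matrix_i w i) *m M) = c *: 1%:M.
  rewrite scale_scalar_mx mulr1 -NM scalemxAl; congr (_ *m _).
  by apply/row_matrixP => i; rewrite Hw linearZ /= rowK.
have [_ h] : (M *m (\matrix_i w i) = 1%:M) * ((\matrix_i w i) *m M = 1%:M).
  have h : (\matrix_i w i) *m M = 1%:M.
    apply/matrixP => i j; apply: (mulfI c0).
    by have /matrixP/(_ i j) := cc; rewrite [LHS]mxE [RHS]mxE.
  by split=> //; apply: mulmx1C.
by case: (mulmx1_unit h).
Qed.

End Moore.

(** * The exponential *)

Section TwistedSeries.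
Variables (K : cinf) (s : nat).
Local Notation F := (cF K).
Local Notation C := (cC K).
Local Notation R := (cR K).
Local Notation ab := (@cab K).
Local Notation q := (Defs.q (cF K)).
Local Notation ts := (@tser (cC K) s).
Local Notation tate := (@Defs.tate C R ab s).
Local Notation tw n := (@twist F C s (Posz n)).
Implicit Types (f g : ts) (u v c : nat -> ts) (e rho : R).

Lemma tate_subring : subring_closed (@tateb K s).
Proof.
have h f : f \in @tateb K s <-> zconst f \in @znullb K s.
  by split=> /asboolP h; apply/asboolP; apply/znull_const.
split=> [|f g|f g]; rewrite ?h.
- by rewrite -[zconst 1]/(1 : @zser C s) rpred1.
- by rewrite zconstB; apply: rpredB.
by rewrite zconstM; apply: rpredM.
Qed.
HB.instance Definition _ := GRing.isSubringClosed.Build ts (@tateb K s) tate_subring.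

Lemma tateP f : reflect (tate f) (f \in @tateb K s).
Proof. exact: asboolP. Qed.

Lemma tateD f g : tate f -> tate g -> tate (f + g).
Proof. by move=> /tateP h /tateP h'; apply/tateP/rpredD. Qed.
Lemma tateB f g : tate f -> tate g -> tate (f - g).
Proof. by move=> /tateP h /tateP h'; apply/tateP/rpredB. Qed.
Lemma tateN f : tate f -> tate (- f).
Proof. by move=> /tateP h; apply/tateP; rewrite rpredN. Qed.
Lemma tateM f g : tate f -> tate g -> tate (f * g).
Proof. by move=> /tateP h /tateP h'; apply/tateP/rpredM. Qed.
Lemma tate0 : tate (0 : ts). Proof. exact/tateP/rpred0. Qed.
Lemma tate1 : tate (1 : ts). Proof. exact/tateP/rpred1. Qed.
Lemma tate_sum I (r : seq I) (P : pred I) (w : I -> ts) :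
  (forall i, P i -> tate (w i)) -> tate (\sum_(i <- r | P i) w i).
Proof. by move=> H; apply/tateP/rpred_sum => i /H/tateP. Qed.
Lemma tate_twist n f : tate f -> tate (twist F n f).
Proof. by rewrite -!znull_const -ztwist_const; apply: ztwist_null. Qed.

Lemma bndB f g rho : bnd f rho -> bnd g rho -> bnd (f - g) rho.
Proof. by move=> fr gr; apply: bndD => //; apply: bndN. Qed.

Lemma psumE u n : (fun i => \sum_(k < n) u k i) = \sum_(k < n) u k :> ts.
Proof. by apply: funext => i; rewrite tcoef_sum. Qed.

Lemma usums_tate u g : usums u g -> (forall n, tate (u n)) -> tate g.
Proof.
move=> ug ut; apply/tate_fnull; apply: uconv_fnull ug _ => n.
by rewrite psumE; apply/tate_fnull/tate_sum.
Qed.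

Lemma tate_max f : tate f -> f != 0 -> exists m0, ab (f m0) != 0 /\ bnd f (ab (f m0)).
Proof.
move=> /tate_fnull tf f0; have [m1 fm1] : exists m1, f m1 != 0.
  apply: contrapT => /forallNP h; move/eqP: f0; apply; apply: funext => m.
  by apply/eqP/negPn/negP/(h m).
by have [m0 [h1 h2]] := fnull_max tf fm1; exists m0.
Qed.

Section Maps.
Variable L : ts -> ts.
Hypothesis LD : forall f g, tate f -> tate g -> L (f + g) = L f + L g.
Hypothesis Lcont : forall e, 0 < e -> exists2 d, 0 < d & forall f, tate f -> bnd f d -> bnd (L f) e.

Lemma additive0 : L 0 = 0.
Proof. by have /eqP := LD tate0 tate0; rewrite addr0 -subr_eq subrr => /eqP. Qed.

Lemma additiveB f g : tate f -> tate g -> L (f - g) = L f - L g.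
Proof.
by move=> tf tg; apply/eqP; rewrite eq_sym subr_eq -LD ?subrK //; apply: tateB.
Qed.

Lemma additive_sum I (r : seq I) (P : pred I) (w : I -> ts) : (forall i, P i -> tate (w i)) ->
  L (\sum_(i <- r | P i) w i) = \sum_(i <- r | P i) L (w i).
Proof.
move=> H; suff [] : L (\sum_(i <- r | P i) w i) = \sum_(i <- r | P i) L (w i) /\
  tate (\sum_(i <- r | P i) w i) by [].
elim/big_rec2: _ => [|i x y Pi [IH ty]]; first by split; [exact: additive0 | exact: tate0].
by split; [rewrite LD ?IH //; apply: H | apply: tateD => //; apply: H].
Qed.

Lemma usums_map u g : (forall n, tate (u n)) -> usums u g -> usums (fun n => L (u n)) (L g).
Proof.
move=> ut ug e e0; have tg := usums_tate ug ut.
have e2 : 0 < e / 2 by rewrite divr_gt0.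
have [d d0 Ld] := Lcont e2; have [N HN] := ug _ d0; exists N => n Nn i.
have tp : tate (\sum_(k < n) u k) by apply: tate_sum.
have b : bnd (\sum_(k < n) u k - g) d.
  by move=> m; rewrite tcoefB tcoef_sum ltW // HN.
have := Ld _ (tateB tp tg) b i; rewrite additiveB // additive_sum // tcoefB tcoef_sum.
by move=> h; apply: le_lt_trans h _; rewrite ltr_pdivrMr // ltr_pMr // ltr1n.
Qed.
End Maps.

Lemma usums_mulr (a : ts) u g : tate a -> (forall n, tate (u n)) -> usums u g ->
  usums (fun n => a * u n) (a * g).
Proof.
move=> ta; apply: (@usums_map (fun f => a * f)) => [f h _ _|e e0]; first exact: mulrDr.
have [rho r1 ar] := tate_bnd ta; have r0 := lt_le_trans ltr01 r1.
exists (e / rho); first by rewrite divr_gt0.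
by move=> f _ fe; have := bndM ar fe; rewrite mulrCA divff ?mulr1 // gt_eqF.
Qed.

Lemma usums_twist n u g : (forall k, tate (u k)) -> usums u g ->
  usums (fun k => tw n (u k)) (tw n g).
Proof.
apply: (@usums_map (twist F (Posz n))) => [f h _ _|e e0]; first exact: rmorphD.
exists (Num.min e 1); first by rewrite lt_min e0 ltr01.
move=> f _ /(@bnd_twist _ _ n); apply: bnd_le.
have m0 : 0 <= Num.min e 1 by rewrite le_min ltW //= ler01.
apply: le_trans (_ : _ <= Num.min e 1) _; last by rewrite ge_min lexx.
by rewrite -[leRHS]expr1 ler_wiXn2l ?qn_gt0 // ge_min lexx orbT.
Qed.

Lemma usums_delay k u (g : ts) : usums u g ->
  usums (fun n => if (k <= n)%N then u (n - k)%N else 0) g.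
Proof.
elim: k u g => [|k IH] u g ug; first by apply: eq_usums ug => n i; rewrite subn0.
apply/usums_shift => /=.
have -> : (fun i => g i - (0 : ts) i) = g by apply: funext => i; rewrite subr0.
exact: (IH _ _ ug).
Qed.

Lemma usums_sum (I : Type) (r : seq I) (w : I -> nat -> ts) (g : I -> ts) :
  (forall i, usums (w i) (g i)) -> usums (fun n => \sum_(i <- r) w i n) (\sum_(i <- r) g i).
Proof.
move=> H; elim: r => [|i r IH].
  rewrite big_nil; under eq_fun do rewrite big_nil.
  by move=> e e0; exists 0%N => n _ m; rewrite big1 ?subrr ?ab0.
rewrite big_cons; under eq_fun do rewrite big_cons; exact: (usumsD (H i) IH).
Qed.

(** Since tau^n raises the Gauss norm to the power q^n, this is an infinite radius of
    convergence. *)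
Definition entire c := (forall n, tate (c n)) /\
  forall e, 0 < e -> exists N, forall n, (N <= n)%N -> bnd (c n) (e ^+ (q ^ n)).

(* Junk value 0 when the series diverges; likewise for [zev] below. *)
Definition tev c f : ts :=
  if pselect (exists g : ts, usums (fun n => c n * tw n f) g) is left h then sval (cid h) else 0.

Lemma tev_eq c f g : usums (fun n => c n * tw n f) g -> tev c f = g.
Proof.
move=> h; rewrite /tev; case: pselect => [h'|[]]; last by exists g.
by case: (cid h') => g' /= hg'; apply: usums_unique hg' h.
Qed.

Lemma entire_term_tate c n f : entire c -> tate f -> tate (c n * tw n f).
Proof. by move=> [tc _] tf; apply: tateM => //; apply: tate_twist. Qed.

Lemma tevP c f : entire c -> tate f -> usums (fun n => c n * tw n f) (tev c f).
Proof.
move=> [tc ec] tf; suff [g hg] : exists g : ts, usums (fun n => c n * tw n f) g.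
  by rewrite (tev_eq hg).
apply: usums_ex => e e0; have [rho r1 fr] := tate_bnd tf; have r0 := lt_le_trans ltr01 r1.
have e1 : 0 < rho^-1 / 2 by rewrite divr_gt0 // invr_gt0.
have [N HN] := ec _ e1.
have h2 : 2^-1 < 1 :> R by rewrite invf_lt1 ?ltr1n.
have h1 : 0 <= 2^-1 :> R by rewrite invr_ge0 ler0n.
have [M HM] := @powq_lt_small K 2^-1 e h1 h2 e0.
exists (maxn N M) => n; rewrite geq_max => /andP[Nn Mn] m.
have := bndM (HN n Nn) (@bnd_twist _ _ n _ _ fr) m; rewrite -exprMn.
have -> : rho^-1 / 2 * rho = 2^-1 by field; rewrite gt_eqF.
by move=> h; apply: le_lt_trans h (HM n Mn).
Qed.

Lemma tev_tate c f : entire c -> tate f -> tate (tev c f).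
Proof. by move=> ec tf; apply: usums_tate (tevP ec tf) _ => n; apply: entire_term_tate. Qed.

Lemma tevD c f g : entire c -> tate f -> tate g -> tev c (f + g) = tev c f + tev c g.
Proof.
move=> ec tf tg; apply: tev_eq; apply: eq_usums (usumsD (tevP ec tf) (tevP ec tg)) => n i.
by rewrite rmorphD mulrDr.
Qed.

Lemma tevZ c a f : entire c -> tate f -> tate a -> (forall n, tw n a = a) ->
  tev c (a * f) = a * tev c f.
Proof.
move=> ec tf ta fa; apply: tev_eq; apply: eq_usums (usums_mulr ta _ (tevP ec tf)) => n.
  by move=> i; rewrite rmorphM /= fa mulrCA.
exact: entire_term_tate.
Qed.

End TwistedSeries.

(** * The coefficients of exp and its behaviour near zero *)

Section Exponential.
Variables (K : cinf) (s r : nat).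
Local Notation F := (cF K).
Local Notation C := (cC K).
Local Notation R := (cR K).
Local Notation th := (@cth K).
Local Notation ab := (@cab K).
Local Notation q := (Defs.q (cF K)).
Local Notation ts := (@tser (cC K) s).
Local Notation tate := (@Defs.tate C R ab s).
Local Notation tw n := (@twist F C s (Posz n)).
Variable A : nat -> ts.
Hypothesis tateA : forall i, (1 <= i <= r)%N -> tate (A i).
Local Notation al := (@alpha F C th s r A).
Local Notation thc := (tconst th : ts).
Implicit Types (f g : ts) (u v c b : nat -> ts) (e rho : R).

Definition thetaD n : C := frobz F (Posz n) th - th.

Lemma size_expl n : size (@expl F C th s r A n) = n.+1.
Proof. by elim: n => //= n IH; rewrite size_rcons IH. Qed.

Lemma nth_expl n k : (k <= n)%N -> nth (@tzero C s) (@expl F C th s r A n) k = al k.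
Proof.
elim: n k => [|n IH] k; first by rewrite leqn0 => /eqP ->.
rewrite leq_eqVlt => /orP[/eqP -> //|]; rewrite ltnS => kn.
by rewrite /= nth_rcons size_expl ltnS kn IH.
Qed.

Lemma alpha0 : al 0%N = 1. Proof. by []. Qed.

(** The constant term theta of phi_theta is left out: in the recursion it sits on the other side,
    inside theta^(q^n) - theta. *)
Definition phib : nat -> ts := fun k => if (0 < k <= r)%N then A k else 0.

Lemma alphaE n : tconst (thetaD n) * al n = \sum_(k < n.+1) phib k * tw k (al (n - k)%N).
Proof.
case: n => [|n].
  by rewrite big_ord_recl big_ord0 /phib /= mul0r addr0 /thetaD /= subrr tconst0 mul0r.
apply: funext => m; rewrite tcoef_constM.
have -> : al n.+1 m = (\sum_(1 <= j < (minn n.+1 r).+1)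
    tmul (A j) (tw j (nth (@tzero C s) (@expl F C th s r A n) (n.+1 - j))) m) / thetaD n.+1.
  by rewrite {1}/alpha /= nth_rcons size_expl ltnn eqxx.
rewrite [LHS]mulrC divfK ?thetaB_neq0 // tcoef_sum.
rewrite -(big_mkord xpredT (fun i => (phib i * tw i (al (n.+1 - i)%N)) m)).
rewrite [RHS]big_ltn // {1}/phib /= mul0r tcoef0 add0r.
rewrite [RHS](big_cat_nat (n := (minn n.+1 r).+1)) ?ltnS ?geq_minl //=.
rewrite [X in _ = _ + X]big_nat_cond [X in _ = _ + X]big1 ?addr0; last first.
  move=> i /andP[/andP[]]; rewrite gtn_min => h1 h2 _.
  have e : (0 < i <= r)%N = false by apply/negbTE; move: h1 h2; lia.
  by rewrite /phib e mul0r.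
apply: eq_big_nat => i /andP[i0]; rewrite ltnS leq_min => /andP[i1 i2].
by rewrite /phib i0 i2 /= nth_expl //; lia.
Qed.

Lemma tate_phib k : tate (phib k).
Proof. by rewrite /phib; case: ifP => [/tateA//|_]; apply: tate0. Qed.

Lemma thetaD_inv n (f g : ts) : (0 < n)%N -> tconst (thetaD n) * f = g -> f = tconst (thetaD n)^-1 * g.
Proof.
move=> n0 <-; rewrite mulrA -tconstM mulVf ?thetaB_neq0 //.
by rewrite [tconst 1]/(1 : ts) mul1r.
Qed.

Lemma thetaD_bnd n (f g : ts) X : (0 < n)%N -> tconst (thetaD n) * f = g -> bnd g X ->
  bnd f (X / q%:R ^+ (q ^ n)).
Proof.
move=> n0 e gX; rewrite (thetaD_inv n0 e) => m.
by rewrite tcoef_constM abM abV ab_thetaB // mulrC ler_wpM2r // invr_ge0 exprn_ge0 ?ler0n.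
Qed.

Lemma alpha_tate n : tate (al n).
Proof.
elim/ltn_ind: n => -[_|n IH]; first exact: tate1.
rewrite (thetaD_inv (ltn0Sn n) (alphaE n.+1)).
apply: tateM; first exact: tate_const.
apply: tate_sum => -[[|k] /= kn] _; first by rewrite /phib /= mul0r; apply: tate0.
by apply: tateM; [exact: tate_phib | apply/tate_twist/IH; rewrite subSS ltnS leq_subr].
Qed.

Lemma coef_bound : exists2 k0 : R, 1 <= k0 & forall k, bnd (phib k) k0.
Proof.
have /choice[k Hk] k : exists rho : R, 1 <= rho /\ bnd (phib k) rho.
  by have [rho] := tate_bnd (tate_phib k); exists rho.
exists (1 + \sum_(i < r.+1) k i).
  by rewrite lerDl sumr_ge0 // => i _; rewrite (le_trans ler01) ?(proj1 (Hk i)).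
move=> i; have [ir|ri] := ltnP i r.+1; last first.
  rewrite /phib [(i <= r)%N]leqNgt ri /= andbF; apply: bnd0.
  by rewrite addr_ge0 ?ler01 ?sumr_ge0 // => j _; rewrite (le_trans ler01) ?(proj1 (Hk j)).
apply: bnd_le (proj2 (Hk i)); rewrite (bigD1 (Ordinal ir)) //= addrCA lerDl.
by rewrite addr_ge0 ?ler01 ?sumr_ge0 // => j _; rewrite (le_trans ler01) ?(proj1 (Hk j)).
Qed.

(** The bound on the coefficients of phi_theta also fixes the scale 1 / cbound below which exp is a
    small perturbation of the identity. *)
Definition cbound : R := s2val (cid2 coef_bound).
Lemma cbound_ge1 : 1 <= cbound. Proof. exact: (s2valP (cid2 coef_bound)). Qed.
Lemma cbound_gt0 : 0 < cbound. Proof. exact: lt_le_trans ltr01 cbound_ge1. Qed.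
Lemma phib_bnd k : bnd (phib k) cbound. Proof. exact: (s2valP' (cid2 coef_bound)). Qed.

Lemma alpha_bnd_step n X : (0 < n)%N -> 0 <= X ->
  (forall k, (0 < k <= n)%N -> (k <= r)%N -> exists2 Y, bnd (al (n - k)%N) Y & cbound * Y ^+ (q ^ k) <= X) ->
  bnd (al n) (X / q%:R ^+ (q ^ n)).
Proof.
move=> n0 X0 H; apply: (thetaD_bnd n0 (alphaE n)); apply: bnd_sum => // -[k kn] _ /=.
have [h|h] := boolP ((0 < k) && (k <= r))%N; last first.
  by rewrite /phib (negbTE h) mul0r; apply: bnd0.
have [||Y Yk YX] := H k; first by move: h kn; lia.
  by case/andP: h.
apply: bnd_le YX _; apply: bndM; [exact: phib_bnd | exact: bnd_twist].
Qed.

(** With the exponent q^n - 1 in place of q^n the induction closes: 1 + (q^(n-k) - 1) q^k <= q^n - 1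
    for k >= 1, so the extra factor cbound is absorbed. *)
Lemma alpha_bnd n : bnd (al n) (cbound ^+ (q ^ n).-1).
Proof.
have c0 := cbound_gt0; have c1 := cbound_ge1.
elim/ltn_ind: n => -[_|n IH]; first by rewrite expn0 expr0 alpha0 -ab1; apply: bnd_const.
apply: bnd_le (_ : cbound ^+ (q ^ n.+1).-1 / q%:R ^+ (q ^ n.+1) <= _) _.
  rewrite ler_pdivrMr ?exprn_gt0 ?qR_gt0 // ler_peMr ?exprn_ge0 ?(ltW c0) //.
  by rewrite exprn_ege1 // ltW // qR_gt1.
apply: alpha_bnd_step => //; first by rewrite exprn_ge0 // ltW.
move=> k /andP[k0 kn] _; exists (cbound ^+ (q ^ (n.+1 - k)).-1).
  by apply: IH; move: k0; lia.
rewrite -exprM -exprS ler_weXn2l //.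
have e : (q ^ n.+1 = q ^ (n.+1 - k) * q ^ k)%N by rewrite -expnD subnK.
have h1 : (1 < q ^ k)%N by rewrite -(expn0 q) ltn_exp2l ?q_gt1.
have h2 := qn_gt0 K (n.+1 - k); rewrite e; nia.
Qed.

(** Bernoulli's inequality. The base 4/3 is chosen because 4/3 <= (2/3) q for every q >= 2. *)
Lemma pow_absorb (X : R) : exists N, forall n, (N <= n)%N -> X <= (4 / 3) ^+ (q ^ n).
Proof.
have [N HN] : exists N, X <= 3^-1 *+ N.
  exists (Num.bound (`|X| * 3)); rewrite -[leRHS]mulr_natl -ler_pdivrMr ?invr_gt0 ?ltr0n // invrK.
  by apply: le_trans (ltW (archi_boundP _)); rewrite ?mulr_ge0 // ler_wpM2r // ler_norm.
exists N => n Nn; apply: le_trans HN _.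
have -> : 4 / 3 = 1 + 3^-1 :> R by field.
have i3 : 0 <= 3^-1 :> R by rewrite invr_ge0.
apply: le_trans (bernoulli_pow (q ^ n) i3); apply: ler_wpDl => //.
rewrite ler_wpMn2l //; apply: leq_trans Nn _; exact: ltnW (ltn_expl n (q_gt1 K)).
Qed.

(** The recursion divides by theta^(q^n) - theta, of absolute value q^(q^n), so a bound Y^(q^n)
    becomes cbound (Y/q)^(q^n), and the constant is absorbed by (4/3)^(q^n). Iteration drives the
    base to 0, which makes exp entire. *)
Lemma alpha_bnd_improve Y N : 0 <= Y -> (forall n, (N <= n)%N -> bnd (al n) (Y ^+ (q ^ n))) ->
  exists M, forall n, (M <= n)%N -> bnd (al n) ((2 / 3 * Y) ^+ (q ^ n)).
Proof.
move=> Y0 H; have [N' HN'] := pow_absorb cbound.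
exists (N + r + N').+1 => n nn; have n0 : (0 < n)%N by move: nn; lia.
have c0 := cbound_gt0.
apply: bnd_le (_ : cbound * Y ^+ (q ^ n) / q%:R ^+ (q ^ n) <= _) _; last first.
  apply: alpha_bnd_step => // [|k /andP[k0 kn] kr]; first by rewrite mulr_ge0 ?exprn_ge0 // ltW.
  exists (Y ^+ (q ^ (n - k))); first by apply: H; move: nn kr; lia.
  by rewrite -exprM -expnD subnK.
rewrite ler_pdivrMr ?exprn_gt0 ?qR_gt0 // -exprMn.
apply: le_trans (_ : _ <= (4 / 3) ^+ (q ^ n) * Y ^+ (q ^ n)) _.
  by rewrite ler_wpM2r ?exprn_ge0 // HN' //; move: nn; lia.
rewrite -exprMn lerXn2r ?nnegrE ?mulr_ge0 ?divr_ge0 ?invr_ge0 ?ler0n //.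
have := qR_ge2 K; have -> : 2 / 3 * Y * q%:R = 2 / 3 * (Y * q%:R) by rewrite mulrA.
move=> h; have : Y * 2 <= Y * q%:R by rewrite ler_wpM2l.
by lra.
Qed.

Lemma alpha_entire : entire al.
Proof.
split=> [n|e e0]; first exact: alpha_tate.
have c0 := cbound_gt0; have c1 := cbound_ge1.
have H k : exists N, forall n, (N <= n)%N -> bnd (al n) (((2 / 3) ^+ k * cbound) ^+ (q ^ n)).
  elim: k => [|k [N HN]].
    exists 0%N => n _; rewrite expr0 mul1r; apply: bnd_le (@alpha_bnd n).
    by rewrite ler_weXn2l // leq_pred.
  have [|M HM] := @alpha_bnd_improve _ _ _ HN.
    by rewrite mulr_ge0 ?exprn_ge0 ?divr_ge0 ?ler0n // ltW.
  by exists M => n /HM; rewrite mulrA -exprS.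
have h0 : 0 <= 2 / 3 :> R by rewrite divr_ge0 ?ler0n.
have h1 : 2 / 3 < 1 :> R by lra.
have [k /(_ k (leqnn k)) Hk] := pow_lt_small h0 h1 (divr_gt0 e0 c0).
have [N HN] := H k; exists N => n Nn; apply: bnd_le (HN n Nn).
rewrite lerXn2r ?nnegrE ?mulr_ge0 ?exprn_ge0 ?(ltW c0) ?(ltW e0) //.
by rewrite -ler_pdivlMr // ltW.
Qed.

(* Coefficientwise form of [c theta - theta c = b exp_phi]. *)
Definition exp_primitive (b c : nat -> ts) := forall n,
  tconst (thetaD n) * c n = \sum_(k < n.+1) b k * tw k (al (n - k)%N).

(** F_eta inherits the decay of exp: its n-th coefficient involves only the alpha_(n-k) with k <
    d. *)
Lemma primitive_entire b c d : c 0%N = 0 -> (forall k, tate (b k)) ->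
  (forall k, (d <= k)%N -> b k = 0) -> exp_primitive b c -> entire c.
Proof.
move=> c00 tb bd bc; split=> [[|n]|e e0]; first by rewrite c00; apply: tate0.
  rewrite (thetaD_inv (ltn0Sn n) (bc n.+1)); apply: tateM; first exact: tate_const.
  by apply: tate_sum => k _; apply: tateM => //; apply/tate_twist/alpha_tate.
have [kb kb1 Hkb] : exists2 kb : R, 1 <= kb & forall k, bnd (b k) kb.
  have /choice[k Hk] k : exists rho : R, 1 <= rho /\ bnd (b k) rho.
    by have [rho] := tate_bnd (tb k); exists rho.
  have p0 : 0 <= \sum_(i < d) k i.
    by rewrite sumr_ge0 // => i _; rewrite (le_trans ler01) ?(proj1 (Hk i)).
  exists (1 + \sum_(i < d) k i); first by rewrite lerDl.
  move=> i; have [id|/bd->] := ltnP i d; last by apply: bnd0; rewrite addr_ge0.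
  apply: bnd_le (proj2 (Hk i)); rewrite (bigD1 (Ordinal id)) //= addrCA lerDl.
  by rewrite addr_ge0 ?ler01 ?sumr_ge0 // => j _; rewrite (le_trans ler01) ?(proj1 (Hk j)).
have e1 : 0 < e / 2 by rewrite divr_gt0.
have [N HN] := proj2 alpha_entire _ e1; have [N' HN'] := pow_absorb kb.
exists (N + d + N').+1 => n nn; have n0 : (0 < n)%N by move: nn; lia.
apply: bnd_le (_ : kb * (e / 2) ^+ (q ^ n) / q%:R ^+ (q ^ n) <= _) _.
  apply: le_trans (_ : _ <= kb * (e / 2) ^+ (q ^ n)) _.
    rewrite ler_pdivrMr ?exprn_gt0 ?qR_gt0 // ler_peMr //.
      by rewrite mulr_ge0 ?exprn_ge0 ?(ltW e1) // (le_trans ler01).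
    by rewrite exprn_ege1 // ltW // qR_gt1.
  apply: le_trans (_ : _ <= (4 / 3) ^+ (q ^ n) * (e / 2) ^+ (q ^ n)) _.
    by rewrite ler_wpM2r ?exprn_ge0 ?(ltW e1) // HN' //; move: nn; lia.
  rewrite -exprMn lerXn2r ?nnegrE ?mulr_ge0 ?divr_ge0 ?invr_ge0 ?ler0n ?(ltW e0) //; lra.
apply: (thetaD_bnd n0 (bc n)); apply: bnd_sum => [|[k kn] _ /=].
  by rewrite mulr_ge0 ?exprn_ge0 ?(ltW e1) // (le_trans ler01).
have [kd|/bd->] := ltnP k d; last first.
  by rewrite mul0r; apply: bnd0; rewrite mulr_ge0 ?exprn_ge0 ?(ltW e1) // (le_trans ler01).
have -> : (e / 2) ^+ (q ^ n) = ((e / 2) ^+ (q ^ (n - k))) ^+ (q ^ k).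
  by rewrite -exprM -expnD subnK // -ltnS.
apply: bndM => //; apply: bnd_twist.
by apply: HN; move: nn kd; lia.
Qed.

Definition Exp f := tev al f.

Definition pev d b f : ts := \sum_(k < d) b k * tw k f.

(** One functional equation for both series: exp, with b the non-constant part of phi_theta, and
    F_eta, with b = eta_theta. *)
Lemma tev_theta b c d f : (forall k, tate (b k)) -> (forall k, (d <= k)%N -> b k = 0) ->
  exp_primitive b c -> entire c -> tate f ->
  tev c (thc * f) = thc * tev c f + pev d b (Exp f).
Proof.
move=> tb bd bc ec tf; apply: tev_eq.
have tfn n : tate (tw n f) by apply: tate_twist.
have ha : usums (fun n => thc * (c n * tw n f)) (thc * tev c f).
  apply: usums_mulr (tevP ec tf); first exact: tate_const.
  by move=> n; apply: entire_term_tate.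
(* The composite with exp is grouped by the power tau^k: the k-th group is the exponential series
   twisted k times and delayed by k places. *)
have hb : usums (fun n => \sum_(k < d)
    (if (k <= n)%N then b k * tw k (al (n - k)%N * tw (n - k) f) else 0)) (pev d b (Exp f)).
  apply: usums_sum => k.
  apply: (@usums_delay _ _ k (fun n => b k * tw k (al n * tw n f))).
  have te n : tate (al n * tw n f) by apply: entire_term_tate => //; apply: alpha_entire.
  apply: usums_mulr => [//|n|]; first exact/tate_twist.
  by apply: usums_twist => //; apply: tevP => //; apply: alpha_entire.
apply: eq_usums (usumsD ha hb) => n i.
rewrite -[LHS]/((thc * (c n * tw n f) + \sum_(k < d)
    (if (k <= n)%N then b k * tw k (al (n - k)%N * tw (n - k) f) else 0)) i).
congr ((_ : ts) i).
have -> : \sum_(k < d) (if (k <= n)%N then b k * tw k (al (n - k)%N * tw (n - k) f) else 0) =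
    \sum_(k < n.+1) b k * tw k (al (n - k)%N) * tw n f.
  pose G k := if (k <= n)%N then b k * tw k (al (n - k)%N * tw (n - k) f) else 0.
  transitivity (\sum_(0 <= k < maxn d n.+1) G k).
    rewrite -(big_mkord xpredT G) (big_cat_nat (n := d) (p := maxn d n.+1)) ?leq_maxl //=.
    rewrite [X in _ = _ + X]big_nat_cond [X in _ = _ + X]big1 ?addr0 //.
    by move=> k /andP[/andP[dk _] _]; rewrite /G bd // mul0r; case: ifP.
  rewrite (big_cat_nat (n := n.+1)) ?leq_maxr //= [X in _ + X]big_nat_cond [X in _ + X]big1 ?addr0.
    rewrite big_mkord; apply: eq_bigr => -[k kn] _; rewrite /G /= -ltnS kn.
    rewrite rmorphM /= twist_comp; have -> : (k : int) + (n - k)%N = n by rewrite -PoszD subnKC.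
    exact: mulrA.
  by move=> k /andP[/andP[nk _] _]; rewrite /G leqNgt nk.
rewrite -mulr_suml -bc rmorphM /= twist_const /thetaD.
rewrite tconstD; set t := tconst (frobz _ _ _) : ts.
have -> : (tconst (- th) : ts) = - thc.
  by apply/eqP; rewrite -addr_eq0 -tconstD addNr tconst0.
by ring.
Qed.

Lemma Exp_tate f : tate f -> tate (Exp f).
Proof. by move=> tf; apply: tev_tate => //; apply: alpha_entire. Qed.

Lemma expRE f g : tate f -> expR F th ab r A f g <-> g = Exp f.
Proof.
move=> tf; have h := tevP alpha_entire tf; split=> [e|->]; last exact: h.
by apply: usums_unique e h.
Qed.

Lemma phi_thetaE f : @phi_theta F C th s r A f = thc * f + pev r.+1 phib f.
Proof.
rewrite /phi_theta -[LHS]/(thc * f + (fun m => \sum_(1 <= i < r.+1) tmul (A i) (tw i f) m)).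
congr (_ + _); apply: funext => m; rewrite /pev tcoef_sum -(big_mkord xpredT (fun i => (phib i * tw i f) m)).
rewrite [RHS]big_ltn // {1}/phib /= mul0r tcoef0 add0r; apply: eq_big_nat => i /andP[i0].
by rewrite ltnS => ir; rewrite /phib i0 ir.
Qed.

Lemma phib_large k : (r.+1 <= k)%N -> phib k = 0.
Proof. by move=> h; rewrite /phib [(k <= r)%N]leqNgt h andbF. Qed.

Lemma Exp_theta f : tate f -> Exp (thc * f) = @phi_theta F C th s r A (Exp f).
Proof.
move=> tf; rewrite phi_thetaE; apply: tev_theta => //.
- exact: tate_phib.
- exact: phib_large.
- exact: alphaE.
exact: alpha_entire.
Qed.

Lemma ExpD f g : tate f -> tate g -> Exp (f + g) = Exp f + Exp g.
Proof. by apply: tevD; apply: alpha_entire. Qed.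

Lemma ExpB f g : tate f -> tate g -> Exp (f - g) = Exp f - Exp g.
Proof. by apply: additiveB; apply: ExpD. Qed.

Lemma Exp0 : Exp 0 = 0.
Proof. exact: additive0 ExpD. Qed.

(** The term of index n >= 1 is at most (cbound rho)^(q^n - 1) rho, hence at most cbound rho^2. *)
Lemma Exp_near f rho : tate f -> 0 <= rho -> bnd f rho -> cbound * rho <= 1 ->
  bnd (Exp f - f) (cbound * rho ^+ 2).
Proof.
move=> tf r0 fr cr; have c0 := cbound_gt0; have := tevP alpha_entire tf.
move/usums_shift => /=.
have -> : (fun i => tev al f i - (al 0 * tw 0 f) i) = Exp f - f.
  by apply: funext => i; rewrite alpha0 mul1r.
move/usums_bnd; apply; first by rewrite mulr_ge0 ?exprn_ge0 // ltW.
move=> n; have := bndM (@alpha_bnd n.+1) (@bnd_twist _ _ n.+1 _ _ fr).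
apply: bnd_le; have q0 := qn_gt0 K n.+1; have q2 : (2 <= q ^ n.+1)%N.
  by rewrite (leq_trans (q_gt1 K)) // -{1}(expn1 q) leq_exp2l ?q_gt1.
rewrite -{2}(prednK q0) exprSr mulrA -exprMn [rho ^+ 2]exprSr expr1 mulrA ler_wpM2r //.
rewrite -[leRHS]expr1 ler_wiXn2l ?mulr_ge0 ?(ltW c0) //; lia.
Qed.

Lemma Exp_small f rho : tate f -> 0 <= rho -> bnd f rho -> cbound * rho <= 1 -> bnd (Exp f) rho.
Proof.
move=> tf r0 fr cr; rewrite -[Exp f](subrK f); apply: bndD => //.
by apply: bnd_le (Exp_near tf r0 fr cr); rewrite expr2 mulrA ler_piMl.
Qed.

Lemma Exp_inj_small f rho : tate f -> bnd f rho -> cbound * rho < 1 -> Exp f = 0 -> f = 0.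
Proof.
move=> tf fr cr ef; apply/eqP/negPn/negP => f0.
have [m0 [h1 h2]] := tate_max tf f0; have p0 : 0 < ab (f m0) by rewrite lt0r h1 ab_ge0.
have c1 : cbound * ab (f m0) < 1 by apply: le_lt_trans cr; rewrite ler_pM2l ?cbound_gt0.
have := Exp_near tf (ltW p0) h2 (ltW c1) m0.
rewrite ef tcoefB tcoef0 sub0r abN expr2 mulrA -[leLHS]mul1r ler_pM2r //.
by rewrite leNgt c1.
Qed.

Lemma Exp_cont e : 0 < e -> exists2 d, 0 < d & forall f, tate f -> bnd f d -> bnd (Exp f) e.
Proof.
move=> e0; have c0 := cbound_gt0.
exists (Num.min e cbound^-1); first by rewrite lt_min e0 invr_gt0.
move=> f tf fd; have m0 := ab_bnd0 (mon0 s) fd.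
have h : bnd (Exp f) (Num.min e cbound^-1).
  apply: Exp_small => //; rewrite mulrC -ler_pdivlMr // mul1r.
  by rewrite ge_min lexx orbT.
by apply: bnd_le h; rewrite ge_min lexx.
Qed.

(** Successive correction: the errors h_(n+1) = h_n - exp(h_n) shrink by the factor cbound rho, and
    exp of the n-th partial sum of the h_k is g - h_n. *)
Lemma Exp_surj_small g rho : tate g -> 0 <= rho -> bnd g rho -> cbound * rho < 1 ->
  exists f, [/\ tate f, bnd f rho & Exp f = g].
Proof.
move=> tg r0 gr cr; have c0 := cbound_gt0.
pose h n := iter n (fun x : ts => x - Exp x) g.
have th' n : tate (h n) by elim: n => //= n IH; apply: tateB => //; apply: Exp_tate.
have cr0 : 0 <= cbound * rho by rewrite mulr_ge0 // ltW.
have hb n : bnd (h n) (rho * (cbound * rho) ^+ n).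
  elim: n => [|n IH]; first by rewrite expr0 mulr1.
  set rn := _ * _ in IH; have rn0 : 0 <= rn by rewrite mulr_ge0 ?exprn_ge0.
  have rnr : rn <= rho by rewrite ler_piMr // exprn_ile1 // ltW.
  rewrite /= -opprB; apply: bndN.
  have := Exp_near (th' n) rn0 IH (le_trans (ler_wpM2l (ltW c0) rnr) (ltW cr)).
  apply: bnd_le; have -> : rho * (cbound * rho) ^+ n.+1 = rn * (cbound * rho) by rewrite exprSr mulrA.
  by rewrite expr2 mulrCA ler_wpM2l // ler_wpM2l // ltW.
have [f Hf] : exists f : ts, usums h f.
  (* The divisor is rho + 1 because rho may be 0. *)
  apply: usums_ex => e e0; have e1 : 0 < e / (rho + 1) by rewrite divr_gt0 // ltr_wpDl.
  have [N HN] := pow_lt_small cr0 cr e1; exists N => n Nn i.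
  apply: le_lt_trans (hb n i) _; apply: le_lt_trans (_ : _ <= (rho + 1) * (cbound * rho) ^+ n) _.
    by rewrite ler_wpM2r ?exprn_ge0 // lerDl ler01.
  by rewrite mulrC -ltr_pdivlMr ?HN // ltr_wpDl.
have tf := usums_tate Hf th'.
exists f; split=> //.
  apply: (usums_bnd r0 Hf) => n; apply: bnd_le (hb n).
  by rewrite ler_piMr // exprn_ile1 // ltW.
have h1 : usums (fun n => Exp (h n)) (Exp f) by apply: usums_map ExpD Exp_cont _ _ th' Hf.
apply: usums_unique h1 _ => e e0.
have e1 : 0 < e / (rho + 1) by rewrite divr_gt0 // ltr_wpDl.
have [N HN] := pow_lt_small cr0 cr e1; exists N => n Nn i.
have -> : \sum_(k < n) Exp (h k) i - g i = - h n i.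
  elim: n {Nn} => [|n IH]; first by rewrite big_ord0 sub0r.
  by rewrite big_ord_recr /= addrAC IH tcoefB opprB addrC.
rewrite abN; apply: le_lt_trans (hb n i) _.
apply: le_lt_trans (_ : _ <= (rho + 1) * (cbound * rho) ^+ n) _.
  by rewrite ler_wpM2r ?exprn_ge0 // lerDl ler01.
by rewrite mulrC -ltr_pdivlMr ?HN // ltr_wpDl.
Qed.

End Exponential.

(** * Evaluation at z = theta and the ring F_q[t, z] *)

Section Evaluation.
Variables (K : cinf) (s : nat).
Local Notation F := (cF K).
Local Notation C := (cC K).
Local Notation R := (cR K).
Local Notation io := (@cio K).
Local Notation th := (@cth K).
Local Notation ab := (@cab K).
Local Notation q := (Defs.q (cF K)).
Local Notation ts := (@tser (cC K) s).
Local Notation zs := (@zser (cC K) s).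
Local Notation S := (nser K s).
Local Notation tate := (@Defs.tate C R ab s).
Local Notation tw n := (@twist F C s (Posz n)).
Implicit Types (a b : zs) (f g : ts).

Definition thp n : ts := tconst (th ^+ n).
(** Replacing z by theta z carries radius q to radius 1: T_s{z/theta} becomes a condition [znull],
    and evaluation at z = theta becomes summation of coefficients. *)
Definition zscale a : zs := fun n => thp n * (a n : ts).

Lemma thpD m n : thp (m + n) = thp m * thp n.
Proof. by rewrite /thp exprD tconstM. Qed.
Lemma thp0 : thp 0 = 1. Proof. by rewrite /thp expr0. Qed.
Lemma thp_bnd n : bnd (thp n) (q%:R ^+ n).
Proof. by rewrite -(ab_th K) -abX; apply: bnd_const. Qed.
Lemma tate_thp n : tate (thp n). Proof. exact: tate_const. Qed.

Lemma zscaleD a b : zscale (a + b) = zscale a + zscale b.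
Proof. by apply: funext => n; rewrite /zscale !zcoefD mulrDr. Qed.
Lemma zscaleN a : zscale (- a) = - zscale a.
Proof. by apply: funext => n; rewrite /zscale zcoefN mulrN. Qed.
Lemma zscaleM a b : zscale (a * b) = zscale a * zscale b.
Proof.
apply: funext => n; rewrite /zscale !zcoefM mulr_sumr; apply: eq_bigr => -[k kn] _ /=.
by rewrite mulrACA -thpD subnKC.
Qed.
Lemma zscale_const f : zscale (zconst f) = zconst f.
Proof. by apply: funext => -[|n]; rewrite /zscale /zconst /= ?thp0 ?mul1r ?mulr0. Qed.

Lemma zTateE a : zTate F ab a <-> znull (zscale a).
Proof.
have ab_sc n m : ab (zscale a n m) = q%:R ^+ n * ab (a n m).
  by rewrite /zscale tcoef_constM abM abX ab_th.
rewrite znullP; split=> -[ta ua]; split.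
- by move=> n; apply: tateM => //; apply: tate_const.
- by move=> e /ua[N HN]; exists N => n Nn m; rewrite ab_sc HN.
- move=> n; have -> : a n = tconst (th ^+ n)^-1 * zscale a n.
    rewrite /zscale mulrA -tconstM mulVf ?mul1r //.
    by rewrite -ab_eq0 abX ab_th expf_neq0 // gt_eqF // qR_gt0.
  by apply: tateM => //; apply: tate_const.
by move=> e /ua[N HN]; exists N => n Nn m; rewrite -ab_sc HN.
Qed.

Definition zev a : ts :=
  if pselect (exists g : ts, usums (fun n => zscale a n : ts) g) is left h then sval (cid h) else 0.

Lemma zev_eq a g : usums (fun n => zscale a n : ts) g -> zev a = g.
Proof.
move=> h; rewrite /zev; case: pselect => [h'|[]]; last by exists g.
by case: (cid h') => g' /= hg'; apply: usums_unique hg' h.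
Qed.

Lemma zevP a : znull (zscale a) -> usums (fun n => zscale a n : ts) (zev a).
Proof.
move=> na; suff [g hg] : exists g : ts, usums (fun n => zscale a n : ts) g by rewrite (zev_eq hg).
by apply: usums_ex; have [_] := (znullP _).1 na.
Qed.

Lemma zev_tate a : znull (zscale a) -> tate (zev a).
Proof. by move=> na; apply: usums_tate (zevP na) _ => n; apply: znull_tate. Qed.

Lemma zevD a b : znull (zscale a) -> znull (zscale b) -> zev (a + b) = zev a + zev b.
Proof.
by move=> na nb; apply: zev_eq; rewrite zscaleD; apply: usumsD (zevP na) (zevP nb).
Qed.

Lemma zevN a : znull (zscale a) -> zev (- a) = - zev a.
Proof. by move=> na; apply: zev_eq; rewrite zscaleN; apply: usumsN (zevP na). Qed.

Lemma zev_finite a D : (forall n, (D <= n)%N -> a n = 0 :> ts) ->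
  zev a = \sum_(n < D) thp n * (a n : ts).
Proof.
move=> H; apply: zev_eq.
have := @usums_finite K (mon s) (fun n => zscale a n) D; rewrite psumE; apply.
by move=> n /H e i; rewrite /zscale e mulr0.
Qed.

Lemma zev_const f : zev (zconst f) = f.
Proof.
by rewrite (@zev_finite _ 1) => [|[]//]; rewrite big_ord_recl big_ord0 addr0 thp0 mul1r.
Qed.

Lemma zev0 : zev 0 = 0.
Proof.
by apply: zev_eq => e e0; exists 0%N => n _ m; rewrite big1 ?subrr ?ab0 // => k _; rewrite /zscale mulr0.
Qed.

Lemma zevM a b : znull (zscale a) -> znull (zscale b) -> zev (a * b) = zev a * zev b.
Proof.
move=> na nb; have ta n := znull_tate n na; have tb n := znull_tate n nb.
have nab : znull (zscale (a * b)) by rewrite zscaleM; apply: znullM.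
have [rb rb1 Hb] := znull_zbnd nb; have rb0 := lt_le_trans ltr01 rb1.
have ub : usums (fun n => zscale a n * zev b) (zev a * zev b).
  rewrite mulrC; under eq_fun do rewrite mulrC.
  by apply: usums_mulr (zevP na) => //; apply: zev_tate.
apply: uconv_unique ub => e e0; have e2 : 0 < e / 2 / rb by rewrite !divr_gt0.
have [N HN] := proj2 ((znullP _).1 na) _ e2; exists N => n Nn m.
(* D k is the k-th coefficient of a times the series b, shifted to start in degree k. The first n of
   them sum to a partial sum of a(theta) times b(theta), and the part of a b they miss only uses
   coefficients of a of index at least n. *)
pose D k j : ts := if (k <= j)%N then zscale a k * zscale b (j - k)%N else 0.
have hD : usums (fun j => \sum_(k < n) D k j) (\sum_(k < n) zscale a k * zev b).
  apply: usums_sum => k.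
  apply: (@usums_delay _ _ k (fun j => zscale a k * zscale b j)).
  by apply: usums_mulr (zevP nb).
have e3 : 0 <= e / 2 by rewrite divr_ge0 // ltW.
have H := usums_bnd e3 (usumsD hD (usumsN (zevP nab))).
have -> : \sum_(k < n) (zscale a k * zev b) m - zev (a * b) m =
    (\sum_(k < n) zscale a k * zev b) m - zev (a * b) m by rewrite tcoef_sum.
apply: le_lt_trans (H _ m) _; last by rewrite ltr_pdivrMr // ltr_pMr // ltr1n.
move=> j i; rewrite -[X in ab X]/((\sum_(k < n) D k j - zscale (a * b) j) i).
rewrite zscaleM zcoefM -(big_mkord xpredT (fun k => D k j)).
have -> : \sum_(k < j.+1) (zscale a k : ts) * zscale b (j - k)%N = \sum_(0 <= k < maxn n j.+1) D k j.
  rewrite [RHS](big_cat_nat (n := j.+1)) ?leq_maxr //= [X in _ = _ + X]big_nat_cond [X in _ = _ + X]big1 ?addr0.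
    by rewrite big_mkord; apply: eq_bigr => -[k kj] _; rewrite /D /= -ltnS kj.
  by move=> k /andP[/andP[jk _] _]; rewrite /D leqNgt jk.
rewrite [X in _ - X](big_cat_nat (n := n)) ?leq_maxl //= opprD addrA subrr sub0r.
apply: bndN; rewrite big_nat_cond; apply: bnd_sum => [|k /andP[/andP[nk _] _]].
  exact: e3.
rewrite /D; case: ifP => _; last exact: bnd0.
have -> : e / 2 = e / 2 / rb * rb by rewrite divfK // gt_eqF.
by apply: bndM => // m'; apply/ltW/HN/(leq_trans Nn).
Qed.

Lemma zev_sum (I : Type) (r : seq I) (u : I -> zs) : (forall i, znull (zscale (u i))) ->
  zev (\sum_(i <- r) u i) = \sum_(i <- r) zev (u i).
Proof.
move=> H; elim: r => [|i r IH]; first by rewrite !big_nil zev0.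
rewrite !big_cons zevD ?IH //; elim: r {IH} => [|j r IH].
  rewrite big_nil; have -> : zscale 0 = 0 by apply: funext => n; rewrite /zscale mulr0.
  by rewrite -(nval0 K s); apply: nvalP.
by rewrite big_cons zscaleD; apply: znullD.
Qed.

Definition zvar : zs := fun n => if n == 1%N then (1 : ts) else 0.

Lemma zvarM a n : (zvar * a : zs) n = if n is n'.+1 then a n' else 0 :> ts.
Proof.
rewrite zcoefM; case: n => [|n]; first by rewrite big_ord_recl big_ord0 addr0 mul0r.
rewrite big_ord_recl /= mul0r add0r big_ord_recl /= mul1r subSS subn0.
by rewrite big1 ?addr0 // => i _; rewrite mul0r.
Qed.

Lemma zvar_null : znull zvar.
Proof.
apply/znullP; split=> [n|e e0].
  by rewrite /zvar; case: ifP => _; [apply: tate1 | apply: tate0].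
by exists 2%N => -[|[|n]] // _ m; rewrite /zvar /= ab0.
Qed.

(* F_q[t, z] is the ring of fixed points of tau on C<t, z>. *)
Definition fixedS (v : S) := stwist 1 v = v.

Lemma fixedS_coef v n : fixedS v -> twist F 1 (nval v n : ts) = nval v n.
Proof. by move=> fv; rewrite -{2}fv nval_twist. Qed.

Lemma twist_fixed f n : twist F 1 f = f -> tw n f = f.
Proof. by move=> h; elim: n => [//|n IH]; rewrite -addn1 PoszD -twist_comp h IH. Qed.

Lemma twist1_coef f m : twist F 1 f = f -> exists c, f m = io c.
Proof. by move/(congr1 (fun g : ts => g m)) => h; apply: frob_fixed; apply: h. Qed.

(** Frobenius-fixed coefficients lie in F_q and have absolute value 0 or 1, so tending to zero means
    finite support. *)
Lemma inFtP f : inFt io f <-> tate f /\ twist F 1 f = f.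
Proof.
split=> [[Fc [N HN]]|[tf ff]].
  split; first by move=> e e0; exists N => m /HN ->; rewrite ab0.
  by apply: funext => m; rewrite /twist /=; have [c ->] := Fc m; rewrite frob_io.
split=> [m|]; first exact: twist1_coef.
have [N HN] := tf _ ltr01; exists N => m /HN; have [c ->] := twist1_coef m ff.
by have [->|/ab_io->] := eqVneq c 0; rewrite ?rmorph0 ?ltxx.
Qed.

Lemma fixedS_finite v : fixedS v -> exists D, forall n m, (D <= n + mdeg m)%N -> nval v n m = 0.
Proof.
move=> fv; have [D HD] := nvalP v ltr01; exists D => n m /HD.
have [c ->] := twist1_coef m (fixedS_coef n fv).
by have [->|/ab_io->] := eqVneq c 0; rewrite ?rmorph0 ?ltxx.
Qed.

Lemma fixedS_trunc v : fixedS v -> exists D, forall n, (D <= n)%N -> nval v n = 0 :> ts.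
Proof.
move=> /fixedS_finite[D HD]; exists D => n Dn; apply: funext => m.
by rewrite HD // (leq_trans Dn) ?leq_addr.
Qed.

Lemma zev_inAt v : fixedS v -> inAt io th (zev (nval v)).
Proof.
move=> fv; have [D HD] := fixedS_finite fv; have [D' HD'] := fixedS_trunc fv.
rewrite (zev_finite HD'); split=> [m|].
  have /choice[c Hc] n := twist1_coef m (fixedS_coef n fv).
  exists (\sum_(n < D') c n *: 'X^n); rewrite rmorph_sum horner_sum tcoef_sum.
  apply: eq_bigr => n _; rewrite tcoef_constM Hc /= map_polyZ map_polyXn !hornerE.
  by rewrite mulrC.
exists D => m Dm; rewrite tcoef_sum big1 // => n _.
by rewrite tcoef_constM HD ?mulr0 // (leq_trans Dm) ?leq_addl.
Qed.

(** Together with [zev_inAt] and [zev_fixed_inj], evaluation at theta identifies F_q[t, z] with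
    A[t]; this is how lattice scalars become tau-fixed elements of S. *)
Lemma inAt_zev f : inAt io th f -> exists2 v, fixedS v & f = zev (nval v).
Proof.
move=> [/choice[p Hp] [N HN]].
(* The chosen polynomials are reset to 0 in the degrees where f vanishes, so that only finitely many
   remain. *)
pose p' m := if (N <= mdeg m)%N then 0 else p m.
have Hp' m : f m = (map_poly io (p' m)).[th].
  by rewrite /p'; case: leqP => [/HN->|_]; rewrite ?rmorph0 ?horner0 ?Hp.
pose D := (\sum_(m <- mons s N) size (p m))%N.
have pD m : (size (p' m) <= D)%N.
  rewrite /p'; case: (leqP N (mdeg m)) => [_|h]; first by rewrite size_poly0.
  by rewrite /D (big_rem m) ?mem_mons //= leq_addr.
pose a : zs := fun n m => io (p' m)`_n.
have na : znull a.
  move=> e e0; exists (N + D)%N => n m h; rewrite /a; have [Nm|mN] := leqP N (mdeg m).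
    by rewrite /p' Nm coef0 rmorph0 ab0.
  rewrite nth_default ?rmorph0 ?ab0 // (leq_trans (pD m)) //; move: h mN; lia.
exists (toS a).
  apply: nval_inj; rewrite nval_twist toSK //; apply: funext => n; apply: funext => m.
  exact: frob_io.
rewrite toSK // (@zev_finite _ D); last first.
  by move=> n Dn; apply: funext => m; rewrite /a nth_default ?rmorph0 // (leq_trans (pD m)).
apply: funext => m; rewrite tcoef_sum Hp' (@horner_coef_wide _ D) ?size_map_poly //.
by apply: eq_bigr => n _; rewrite tcoef_constM coef_map mulrC.
Qed.

Lemma zev_fixed_inj v : fixedS v -> zev (nval v) = 0 -> v = 0.
Proof.
move=> fv; have [D HD] := fixedS_trunc fv; rewrite (zev_finite HD) => e.
apply: nval_inj; rewrite nval0; apply: funext => n; apply: funext => m.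
have [Dn|nD] := leqP D n; first by rewrite HD.
have /choice[c Hc] k := twist1_coef m (fixedS_coef k fv).
have p0 : \poly_(k < D) c k = 0.
  apply: (@theta_transcendental K); move/(congr1 (fun g : ts => g m)): e; rewrite tcoef_sum tcoef0 => e.
  rewrite -[RHS]e.
  rewrite (@horner_coef_wide _ D) ?size_map_poly ?size_poly //.
  by apply: eq_bigr => k _; rewrite tcoef_constM coef_map coef_poly ltn_ord mulrC Hc.
have c0 : c n = 0 by move/(congr1 (fun p : {poly F} => p`_n)): p0; rewrite coef_poly nD coef0.
by rewrite Hc c0 rmorph0.
Qed.

End Evaluation.

(** * Generating series and the Moore matrix *)

Section GeneratingSeries.
Variables (K : cinf) (s r : nat).
Local Notation F := (cF K).
Local Notation C := (cC K).
Local Notation R := (cR K).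
Local Notation th := (@cth K).
Local Notation ab := (@cab K).
Local Notation q := (Defs.q (cF K)).
Local Notation ts := (@tser (cC K) s).
Local Notation zs := (@zser (cC K) s).
Local Notation S := (nser K s).
Local Notation tate := (@Defs.tate C R ab s).
Variable A : nat -> ts.
Hypothesis tateA : forall i, (1 <= i <= r)%N -> tate (A i).
Local Notation phi := (@phi_theta F C th s r A).
Local Notation Exp := (@Exp K s r A).
Local Notation thp := (@thp K s).
Local Notation phib := (@phib K s r A).
Local Notation Lam := (Lambda F th ab r A).
Local Notation cbound := (@cbound K s r A tateA).
Implicit Types (a b : zs) (f g x y : ts).

Definition thn n : ts := tconst (th^-1 ^+ n).

Lemma th_neq0 : th != 0.
Proof. by rewrite -ab_eq0 ab_th gt_eqF // qR_gt0. Qed.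

Lemma thnD m n : thn (m + n) = thn m * thn n.
Proof. by rewrite /thn exprD tconstM. Qed.
Lemma thn0 : thn 0 = 1. Proof. by rewrite /thn expr0. Qed.
Lemma thpnK n : thp n * thn n = 1.
Proof. by rewrite -tconstM -exprMn mulfV ?th_neq0 // expr1n. Qed.
Lemma thn_thp m n : thn (m + n) * thp n = thn m.
Proof. by rewrite thnD -mulrA [thn n * _]mulrC thpnK mulr1. Qed.
Lemma tate_thn n : tate (thn n). Proof. exact: tate_const. Qed.
Lemma thn_bnd n : bnd (thn n) (q%:R^-1 ^+ n).
Proof. by rewrite -(ab_th K) -abV -abX; apply: bnd_const. Qed.

Lemma phiE f : phi f = thp 1 * f + pev r.+1 phib f.
Proof. by rewrite phi_thetaE. Qed.

Lemma pevD d (c : nat -> ts) f g : pev d c (f + g) = pev d c f + pev d c g.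
Proof. by rewrite /pev -big_split; apply: eq_bigr => k _; rewrite rmorphD mulrDr. Qed.

Lemma phiD f g : phi (f + g) = phi f + phi g.
Proof. by rewrite !phiE mulrDr pevD addrACA. Qed.

Lemma phi0 : phi 0 = 0.
Proof. by apply: (addrI (phi 0)); rewrite -phiD !addr0. Qed.

Lemma Lam_iff f : Lam f <-> tate f /\ Exp f = 0.
Proof.
split=> -[tf h]; split=> //; first exact: (esym ((expRE tateA _ tf).1 h)).
exact: ((expRE tateA _ tf).2 (esym h)).
Qed.

Lemma Exp_thp1 x : tate x -> Exp (thp 1 * x) = phi (Exp x).
Proof. by move=> tx; rewrite -Exp_theta. Qed.

Lemma Exp_thp n x : Lam x -> Exp (thp n * x) = 0.
Proof.
move=> /Lam_iff[tx ex]; elim: n => [|n IH]; first by rewrite thp0 mul1r.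
by rewrite -add1n thpD -mulrA Exp_thp1 ?IH ?phi0 //; apply: tateM => //; apply: tate_thp.
Qed.

(** The Anderson generating function of x. *)
Definition gen x : zs := fun n => Exp (thn n.+1 * x).
Definition gsys a g := phi (a 0%N) = g /\ forall n, phi (a n.+1) = a n.

Lemma gen_phi x : tate x -> gsys (gen x) (Exp x).
Proof.
move=> tx; have h n : phi (Exp (thn n.+1 * x)) = Exp (thn n * x).
  rewrite -Exp_thp1 ?mulrA; last by apply: tateM => //; apply: tate_thn.
  by rewrite [thp 1 * _]mulrC -addn1 thn_thp.
by split=> [|n]; rewrite h // thn0 mul1r.
Qed.

Lemma thn_small x e : tate x -> 0 < e -> exists N, forall n, (N <= n)%N -> bnd (thn n * x) e.
Proof.
move=> tx e0; have [rho r1 xr] := tate_bnd tx; have r0 := lt_le_trans ltr01 r1.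
have i0 : 0 <= (q%:R^-1 : R) by rewrite invr_ge0 ler0n.
have i1 : (q%:R^-1 : R) < 1 by rewrite invf_lt1 ?qR_gt1 ?qR_gt0.
have [N HN] := pow_lt_small i0 i1 (divr_gt0 e0 r0); exists N => n Nn.
apply: bnd_le (bndM (thn_bnd n) xr); rewrite -ler_pdivlMr //; exact/ltW/HN.
Qed.

Lemma gen_null x : tate x -> znull (gen x).
Proof.
move=> tx; have tn n : tate (thn n * x) by apply: tateM => //; apply: tate_thn.
apply/znullP; split=> [n|e e0]; first exact: Exp_tate.
have e2 : 0 < e / 2 by rewrite divr_gt0.
have [d d0 Hd] := Exp_cont tateA e2; have [N HN] := thn_small tx d0.
exists N => n Nn m; apply: le_lt_trans (Hd _ (tn _) (HN _ (leqW Nn)) m) _.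
by rewrite ltr_pdivrMr // ltr_pMr // ltr1n.
Qed.

Lemma genD x y : tate x -> tate y -> gen (x + y) = gen x + gen y.
Proof.
move=> tx ty; apply: funext => n; rewrite /gen mulrDr zcoefD ExpD //;
  by apply: tateM => //; apply: tate_thn.
Qed.

Lemma gen0 : gen 0 = 0.
Proof. by apply: funext => n; rewrite /gen mulr0 Exp0. Qed.

(** Far out, the coefficients are values of exp in the ball where it is injective. *)
Lemma gen_inj0 x : tate x -> gen x = 0 -> x = 0.
Proof.
move=> tx gx; have c0 := cbound_gt0 tateA.
have e0 : 0 < cbound^-1 / 2 by rewrite divr_gt0 // invr_gt0.
have [N HN] := thn_small tx e0.
have tn : tate (thn N.+1 * x) by apply: tateM => //; apply: tate_thn.
have : thn N.+1 * x = 0.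
  apply: (Exp_inj_small (tateA := tateA) tn (HN _ (leqnSn N))).
    by rewrite mulrA mulfV ?gt_eqF // mul1r invf_lt1 ?ltr1n.
  exact: (congr1 (fun a : zs => a N : ts) gx).
by move/(congr1 (fun y => thp N.+1 * y)); rewrite mulrA thpnK mul1r mulr0.
Qed.

(* The coefficients of a null solution of phi_theta a = z a + g are eventually small, where exp has an inverse. *)
Lemma gsys_log a g : znull a -> gsys a g -> exists x, [/\ tate x, Exp x = g & a = gen x].
Proof.
move=> na [a0 aS]; have c0 := cbound_gt0 tateA; have q0 := qR_gt0 K.
have /znullP[ta ua] := na.
(* Small enough that theta times an element of size e still lies where exp is injective; this makes
   the logarithms of consecutive coefficients compatible. *)
pose e : R := cbound^-1 / q%:R / 2.
have e0 : 0 < e by rewrite !divr_gt0 // invr_gt0.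
have ce : cbound * (q%:R * e) < 1.
  have -> : cbound * (q%:R * e) = 2^-1 by rewrite /e; field; rewrite !gt_eqF.
  by rewrite invf_lt1 ?ltr1n.
have eqe : e <= q%:R * e by rewrite ler_peMl ?(ltW e0) // ltW // qR_gt1.
have ce' : cbound * e < 1 by apply: le_lt_trans ce; rewrite ler_pM2l.
have [N HN] := ua _ e0.
have /choice[l Hl] n : exists l : ts, (N <= n)%N -> [/\ tate l, bnd l e & Exp l = a n].
  have [Nn|nN] := leqP N n; last by exists 0.
  have [|l Hl] := Exp_surj_small (ta n) (ltW e0) _ ce'; last by exists l.
  by move=> m; apply/ltW/HN.
have lS n : (N <= n)%N -> l n = thp 1 * l n.+1.
  move=> Nn; have [t1 b1 e1] := Hl n Nn; have [t2 b2 e2] := Hl n.+1 (leqW Nn).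
  have t3 : tate (thp 1 * l n.+1) by apply: tateM => //; apply: tate_thp.
  apply/eqP; rewrite -subr_eq0; apply/eqP.
  apply: (@Exp_inj_small _ _ _ _ tateA _ (q%:R * e)); rewrite ?ExpB //.
  - exact: tateB.
  - apply: bndB; first exact: bnd_le b1.
    by have := bndM (@thp_bnd K s 1) b2; rewrite expr1.
  by rewrite e1 Exp_thp1 // e2 aS subrr.
(* From l_n = theta l_(n+1) for n >= N follows l_n = x / theta^(n+1) with this x. *)
pose x := thp N.+1 * l N.
have lN k : l (N + k)%N = thn (N + k).+1 * x.
  elim: k => [|k IH].
    by rewrite addn0 /x mulrA [thn _ * _]mulrC thpnK mul1r.
  have := lS (N + k)%N (leq_addr _ _); rewrite IH => e1.
  by rewrite addnS -[LHS]mul1r -(thpnK 1) [thp 1 * _]mulrC -mulrA -e1 mulrA -thnD.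
have tx : tate x by apply: tateM; [exact: tate_thp | case: (Hl N (leqnn N))].
have [g0 gS] := gen_phi tx.
(* Only large n are covered so far; a_n = phi_theta(a_(n+1)), valid for both series, carries the
   equality down to n = 0. *)
have an k n : (N <= n + k)%N -> a n = gen x n.
  elim: k n => [|k IH] n h.
    have [_ _ <-] : [/\ tate (l n), bnd (l n) e & Exp (l n) = a n] by apply: Hl; rewrite -(addn0 n).
    by rewrite addn0 in h; rewrite -(subnKC h) lN.
  by rewrite -aS -gS IH // addSnnS.
exists x; split=> //; last by apply: funext => n; apply: (an N); rewrite leq_addl.
by rewrite -g0 -a0 (an N) ?leq_addl.
Qed.

(** Coefficients in F_q[t] pass through exp, and multiplying x by theta shifts the generating
    series. The shift loses nothing because exp vanishes on the lattice, so A[t] acts on periods as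
    F_q[t, z] acts on series. *)
Lemma gen_fixed v x : fixedS v -> Lam x ->
  [/\ Lam (zev (nval v) * x) & gen (zev (nval v) * x) = nval v * gen x].
Proof.
move=> fv Lx; have [tx ex] := (Lam_iff x).1 Lx.
have [D HD] := fixedS_trunc fv; have zt : tate (zev (nval v)).
  by rewrite (zev_finite HD); apply: tate_sum => k _; apply: tateM; [exact: tate_thp | exact: znull_tate (nvalP v)].
have tv k : tate (nval v k : ts) := znull_tate k (nvalP v).
have key n : Exp (thn n * (zev (nval v) * x)) =
    \sum_(k < D) (nval v k : ts) * Exp (thn n * thp k * x).
  rewrite (zev_finite HD) mulr_suml mulr_sumr (additive_sum (ExpD tateA)); last first.
    move=> k _; apply: tateM; first exact: tate_thn.
    by apply: tateM => //; apply: tateM => //; apply: tate_thp.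
  apply: eq_bigr => k _; rewrite -(tevZ (alpha_entire tateA)) //; first by congr Exp; ring.
    by apply: tateM => //; apply: tateM; [exact: tate_thn | exact: tate_thp].
  by move=> j; apply: twist_fixed; apply: fixedS_coef.
split.
  apply/Lam_iff; split; first exact: tateM.
  have := key 0%N; rewrite thn0 mul1r => ->; rewrite big1 // => k _.
  by rewrite mul1r Exp_thp // mulr0.
apply: funext => n; rewrite zcoefM /gen key.
pose G k : ts := (nval v k : ts) * Exp (thn n.+1 * thp k * x).
(* For k > n the argument of exp is theta^(k-n-1) x, again a period. *)
have Gbig k : (n < k)%N -> G k = 0.
  move=> nk; rewrite /G -(subnKC nk) thpD mulrA [thn _ * _]mulrC thpnK mul1r.
  by rewrite Exp_thp // mulr0.
transitivity (\sum_(0 <= k < maxn D n.+1) G k).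
  rewrite -(big_mkord xpredT G) [RHS](big_cat_nat (n := D)) ?leq_maxl //=.
  rewrite [X in _ = _ + X]big_nat_cond [X in _ = _ + X]big1 ?addr0 //.
  by move=> k /andP[/andP[Dk _] _]; rewrite /G HD // mul0r.
rewrite (big_cat_nat (n := n.+1)) ?leq_maxr //= [X in _ + X]big_nat_cond [X in _ + X]big1 ?addr0.
  rewrite big_mkord; apply: eq_bigr => -[k kn] _; rewrite /G /=; congr (_ * Exp (_ * _)).
  by rewrite -{1}(subnK (_ : k <= n)%N) // -addSn thn_thp.
by move=> k /andP[/andP[nk _] _]; apply: Gbig.
Qed.

Lemma Lam0 : Lam 0.
Proof. by apply/Lam_iff; split; [exact: tate0 | exact: Exp0]. Qed.
Lemma LamD x y : Lam x -> Lam y -> Lam (x + y).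
Proof.
move=> /Lam_iff[tx ex] /Lam_iff[ty ey]; apply/Lam_iff; split; first exact: tateD.
by rewrite ExpD // ex ey addr0.
Qed.

Lemma gen_sum n (v : 'I_n -> S) (l : 'I_n -> ts) :
  (forall i, fixedS (v i)) -> (forall i, Lam (l i)) ->
  Lam (\sum_i zev (nval (v i)) * l i) /\
  gen (\sum_i zev (nval (v i)) * l i) = \sum_i nval (v i) * gen (l i).
Proof.
move=> fv Ll; elim: (index_enum _) => [|i e [IH1 IH2]].
  by rewrite !big_nil; split; [exact: Lam0 | exact: gen0].
have [h1 h2] := gen_fixed (fv i) (Ll i).
rewrite !big_cons; split; first exact: LamD.
by rewrite genD ?h2 ?IH2 //; [case/Lam_iff: h1 | case/Lam_iff: IH1].
Qed.

End GeneratingSeries.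

(** * The operator phi_theta - z and its Moore matrix *)

Section Operator.
Variables (K : cinf) (s r : nat).
Local Notation F := (cF K).
Local Notation C := (cC K).
Local Notation R := (cR K).
Local Notation io := (@cio K).
Local Notation th := (@cth K).
Local Notation ab := (@cab K).
Local Notation ts := (@tser (cC K) s).
Local Notation zs := (@zser (cC K) s).
Local Notation S := (nser K s).
Local Notation tate := (@Defs.tate C R ab s).
Local Notation tau n := (@stwist K s (Posz n)).
Variables (A : nat -> ts) (B : ts).
Hypothesis tateA : forall i, (1 <= i <= r)%N -> tate (A i).
Hypothesis r_gt0 : (0 < r)%N.
Hypothesis tateB' : tate B.
Hypothesis AB : A r * B = 1.
Local Notation phi := (@phi_theta F C th s r A).
Local Notation Exp := (@Exp K s r A).
Local Notation thp := (@thp K s).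
Local Notation phib := (@phib K s r A).
Local Notation Lam := (Lambda F th ab r A).
Local Notation gen := (@gen K s r A).
Local Notation gsys := (@gsys K s r A).
Local Notation scst := (@scst K s).
Local Notation thn := (@thn K s).
Implicit Types (f g x y : ts).

Definition svar : S := toS (@zvar K s).
Definition opc k : S := if k == 0%N then scst (thp 1) - svar else scst (phib k).
(* The operator [phi_theta - z]. *)
Definition opP (x : S) : S := \sum_(k < r.+1) opc k * tau k x.

Lemma nval_svar : nval svar = @zvar K s.
Proof. by rewrite toSK //; apply: zvar_null. Qed.

Lemma opP_coef (x : S) n :
  nval (opP x) n = phi (nval x n) - (if n is n'.+1 then nval x n' else 0) :> ts.
Proof.
rewrite /opP big_ord_recl.
rewrite nvalD zcoefD stwist0 /opc /= mulrBl nvalB zcoefB !nvalM nval_svar.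
rewrite (nval_cst (@tate_thp K s 1)) zcoef_constM zvarM phiE addrAC; congr (_ + _ - _).
rewrite /pev big_ord_recl /= {1}/phib /= mul0r add0r nval_sum zcoef_sum.
apply: eq_bigr => k _; rewrite nvalM (nval_cst (tate_phib tateA _)) zcoef_constM nval_twist.
by [].
Qed.

Lemma opP_gsys (x : S) g : tate g -> opP x = scst g <-> gsys (nval x) g.
Proof.
move=> tg; split=> [e|[h0 hS]].
  have h n := opP_coef x n; rewrite e nval_cst // in h; split=> [|n].
    by have := h 0%N; rewrite subr0 => <-.
  by have := h n.+1; rewrite /zconst /= => /esym/eqP; rewrite subr_eq0 => /eqP.
apply: nval_inj; apply: funext => n; rewrite opP_coef nval_cst //.
by case: n => [|n]; rewrite ?h0 ?hS ?subr0 ?subrr.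
Qed.

Lemma scst0 : scst (0 : ts) = 0.
Proof.
by apply: nval_inj; rewrite nval_cst ?nval0 //; [apply: funext => -[|n] | exact: tate0].
Qed.
Lemma scstM f g : tate f -> tate g -> scst (f * g) = scst f * scst g.
Proof. by move=> tf tg; apply: nval_inj; rewrite nvalM !nval_cst ?zconstM //; apply: tateM. Qed.
Lemma scst1 : scst (1 : ts) = 1.
Proof. by apply: nval_inj; rewrite nval_cst ?nval1 //; apply: tate1. Qed.

Lemma opP_gsys0 (x : S) : opP x = 0 <-> gsys (nval x) 0.
Proof. by rewrite -scst0; apply: opP_gsys; apply: tate0. Qed.

Lemma opc_r : opc r * scst B = 1.
Proof.
rewrite /opc gtn_eqF // /phib r_gt0 leqnn /= -scstM ?AB ?scst1 //.
by apply: tateA; rewrite r_gt0 leqnn.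
Qed.

(** The inverse of theta - z is a geometric series, which lies in S because |theta| > 1. It allows P
    f = 0 to be solved for f itself. *)
Lemma opc0_inv : exists u, opc 0 * u = 1.
Proof.
pose g : zs := fun n => thn n.+1.
have ng : znull g.
  apply/znullP; split=> [n|e e0]; first exact: tate_thn.
  have [N HN] := thn_small (@tate1 K s) (divr_gt0 e0 (ltr0n _ 2)).
  exists N => n Nn m; have := HN n.+1 (leqW Nn) m; rewrite mulr1 => h.
  by apply: le_lt_trans h _; rewrite ltr_pdivrMr // ltr_pMr // ltr1n.
exists (toS g); apply: nval_inj; rewrite nvalM nval1 toSK // /opc /= nvalB nval_svar.
rewrite (nval_cst (@tate_thp K s 1)) mulrBl; apply: funext => n.
rewrite zcoefB zcoef_constM zvarM /g; case: n => [|n]; first by rewrite thpnK subr0.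
by rewrite -[n.+2]addn1 thnD mulrCA thpnK mulr1 subrr.
Qed.

Lemma tau_comp m n (x : S) : tau m (tau n x) = tau (m + n) x.
Proof. by rewrite stwist_comp. Qed.

Lemma tau_fixed (c : S) n : fixedS c -> tau n c = c.
Proof. by move=> h; elim: n => [|n IH]; rewrite ?stwist0 // -add1n -tau_comp IH. Qed.

Lemma opPZ (c x : S) : fixedS c -> opP (c * x) = c * opP x.
Proof.
move=> fc; rewrite /opP mulr_sumr; apply: eq_bigr => k _.
by rewrite rmorphM /= tau_fixed // mulrCA.
Qed.

Lemma opP_sum n (u : 'I_n -> S) : opP (\sum_i u i) = \sum_i opP (u i).
Proof.
rewrite /opP exchange_big; apply: eq_bigr => k _.
by rewrite rmorph_sum mulr_sumr.
Qed.

(** The twists run downwards, so that f itself is the last column and, after one further tau, column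
    j carries tau^(r-j). *)
Definition moore n (f : 'I_n -> S) : 'M[S]_(n, r) := \matrix_(j, i) tau (r - i.+1) (f j).

Definition compan : 'M[S]_r := \matrix_(i', i)
  if i == 0%N :> nat then - scst B * opc (r - i'.+1)%N else (i'.+1 == i :> nat)%:R.

Lemma moore_tau n (f : 'I_n -> S) : (forall j, opP (f j) = 0) ->
  map_mx (tau 1) (moore f) = moore f *m compan.
Proof.
move=> Pf; apply/matrixP => j i; rewrite !mxE tau_comp.
have [i0|i0] := eqVneq (i : nat) 0%N.
  have -> : (1 + (r - i.+1) = r)%N by rewrite i0; move: r_gt0; lia.
  transitivity (- scst B * \sum_(k < r) opc k * tau k (f j)).
    have := Pf j; rewrite /opP big_ord_recr /= => /eqP; rewrite addr_eq0 => /eqP ->.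
    by rewrite mulrNN mulrA [scst B * _]mulrC opc_r mul1r.
  rewrite (reindex_inj rev_ord_inj) /= mulr_sumr; apply: eq_bigr => k _.
  by rewrite !mxE i0 eqxx mulrA mulrC.
have lt1 : (i.-1 < r)%N by rewrite (leq_ltn_trans (leq_pred _)).
rewrite (bigD1 (Ordinal lt1)) //= !mxE (negbTE i0) /= prednK ?lt0n // eqxx mulr1.
rewrite big1 ?addr0 => [|k kn]; last first.
  rewrite !mxE (negbTE i0); case: eqP => [ki|]; last by rewrite mulr0.
  by move/eqP: kn; case; apply: val_inj; rewrite /= -ki.
by congr (tau _ _); have := ltn_ord i; move: i0; lia.
Qed.

(** The backward recursion: P f = 0 solved for f instead of tau^r f, with u the inverse of theta -
    z. *)
Definition compan' (u : S) : 'M[S]_r := \matrix_(i', i)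
  if i.+1 == r then - u * opc (r - i')%N else (i' == i.+1 :> nat)%:R.

Lemma moore_tau' n (f : 'I_n -> S) u : opc 0 * u = 1 -> (forall j, opP (f j) = 0) ->
  moore f = map_mx (tau 1) (moore f) *m compan' u.
Proof.
move=> u1 Pf; apply/matrixP => j i; rewrite !mxE.
have [ir|ir] := eqVneq i.+1 r.
  rewrite ir subnn stwist0.
  transitivity (- u * \sum_(k < r) opc k.+1 * tau k.+1 (f j)).
    have := Pf j; rewrite /opP big_ord_recl /= stwist0 => /eqP; rewrite addrC addr_eq0 => /eqP ->.
    by rewrite mulrNN mulrA [u * _]mulrC u1 mul1r.
  rewrite (reindex_inj rev_ord_inj) /= mulr_sumr; apply: eq_bigr => k _.
  have e : ((r - k.+1).+1 = r - k)%N by have := ltn_ord k; lia.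
  have e2 : (1 + (r - k.+1) = r - k)%N by rewrite add1n.
  by rewrite !mxE ir eqxx tau_comp e2 e mulrA mulrC.
have lt1 : (i.+1 < r)%N by rewrite ltn_neqAle ir ltn_ord.
rewrite (bigD1 (Ordinal lt1)) //= !mxE (negbTE ir) /= eqxx mulr1 tau_comp.
rewrite big1 ?addr0 => [|k kn]; last first.
  rewrite !mxE (negbTE ir); case: eqP => [ki|]; last by rewrite mulr0.
  by move/eqP: kn; case; apply: val_inj.
by congr (tau _ _); lia.
Qed.

Definition moore_basis (f : 'I_r -> S) := (forall i, opP (f i) = 0) /\ moore f \in unitmx.

Lemma map_tau_unit n (M : 'M[S]_n) : M \in unitmx -> map_mx (tau 1) M \in unitmx.
Proof. by rewrite !unitmxE det_map_mx; apply: rmorph_unit. Qed.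

(** Solved coefficient by coefficient; small coefficients receive small roots, so the solution is
    again null. *)
Lemma artin_schreier_S (h : S) : exists y : S, tau 1 y - y = h.
Proof.
have [y Hy] := choice (fun p : nat * mon s => artin_schreier (nval h p.1 p.2)).
pose a : zs := fun n m => y (n, m).
have na : znull a.
  move=> e e0; have m0 : 0 < Num.min e 1 by rewrite lt_min e0 ltr01.
  have [N HN] := nvalP h m0; exists N => n m /HN; rewrite lt_min => /andP[h1 h2].
  by have [_ /(_ h2) h3] := Hy (n, m); apply: le_lt_trans h3 h1.
exists (toS a); apply: nval_inj; rewrite nvalB nval_twist toSK //.
apply: funext => n; apply: funext => m; rewrite zcoefB tcoefB.
by have [e _] := Hy (n, m); rewrite -[RHS]e.
Qed.

Section Basis.
Variable f : 'I_r -> S.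
Hypothesis Uf : moore_basis f.

(** The rows of twists of x and of the f_j satisfy the same difference system, so the coordinates of
    x in the Moore matrix are fixed by tau. *)
Lemma moore_basis_span (x : S) : opP x = 0 ->
  exists c : 'I_r -> S, (forall j, fixedS (c j)) /\ x = \sum_j c j * f j.
Proof.
case: Uf => Pf uM Px; pose X := moore (fun _ : 'I_1 => x).
pose c := X *m invmx (moore f).
have Xc : X = c *m moore f by rewrite mulmxKV.
have tM := map_tau_unit uM.
have tc : map_mx (tau 1) c = c.
  apply: (can_inj (mulmxK tM)); rewrite -map_mxM -Xc !moore_tau //.
  by rewrite mulmxA -Xc.
have lt1 : (r.-1 < r)%N by rewrite prednK.
exists (fun j => c ord0 j); split=> [j|].
  by have /matrixP/(_ ord0 j) := tc; rewrite [LHS]mxE.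
move/matrixP: Xc => /(_ ord0 (Ordinal lt1)); rewrite !mxE /= prednK // subnn stwist0 => ->.
by apply: eq_bigr => j _; rewrite !mxE /= prednK // subnn stwist0.
Qed.

Lemma moore_basis_surj (g : S) : exists x : S, opP x = g.
Proof.
case: Uf => Pf uM.
have tM := map_tau_unit uM.
(* h is chosen so that the sums of h_j tau^k f_j vanish for 0 < k < r and equal B g for k = r. With
   tau y_j - y_j = h_j, the first r - 1 twists of x = sum y_j f_j then act on the f_j alone, and the
   last one produces A_r B g = g. *)
pose rhs : 'rV[S]_r := \row_i (if i == 0%N :> nat then scst B * g else 0).
have [h hM] : exists h : 'rV[S]_r, h *m map_mx (tau 1) (moore f) = rhs.
  by exists (rhs *m invmx (map_mx (tau 1) (moore f))); rewrite mulmxKV.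
have hE (i : 'I_r) : \sum_j h ord0 j * tau (r - i) (f j) = rhs ord0 i.
  rewrite -hM mxE; apply: eq_bigr => j _; rewrite !mxE tau_comp; congr (_ * tau _ _).
  by have := ltn_ord i; lia.
have hk k : (0 < k < r)%N -> \sum_j h ord0 j * tau k (f j) = 0.
  move=> /andP[k0 kr]; have lt1 : (r - k < r)%N by move: k0 kr; lia.
  have := hE (Ordinal lt1); rewrite /= subKn ?(ltnW kr) // => ->.
  by rewrite mxE /= gtn_eqF // subn_gt0.
have hr : \sum_j h ord0 j * tau r (f j) = scst B * g.
  by have := hE (Ordinal r_gt0); rewrite /= subn0 => ->; rewrite mxE.
have [y Hy] := choice (fun j => artin_schreier_S (h ord0 j)).
pose x := \sum_j y j * f j.
have ystep k : tau 1 (\sum_j y j * tau k (f j)) =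
    \sum_j y j * tau k.+1 (f j) + \sum_j h ord0 j * tau k.+1 (f j).
  rewrite rmorph_sum -big_split /=; apply: eq_bigr => j _.
  by rewrite rmorphM /= tau_comp -mulrDl -Hy addrC subrK.
have xk k : (k < r)%N -> tau k x = \sum_j y j * tau k (f j).
  elim: k => [|k IH] kr; first by rewrite stwist0; apply: eq_bigr => j _; rewrite stwist0.
  by rewrite -add1n -tau_comp IH ?(ltnW kr) // ystep hk ?addr0.
exists x; rewrite /opP big_ord_recr /=.
have -> : tau r x = \sum_j y j * tau r (f j) + scst B * g.
  have e : r = (1 + r.-1)%N by rewrite add1n prednK.
  rewrite {1}e -tau_comp xk ?prednK // ystep prednK // hr //.
rewrite mulrDr mulrA opc_r mul1r addrA.
have -> : \sum_(k < r) opc k * tau k x = \sum_(k < r) opc k * \sum_j y j * tau k (f j).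
  by apply: eq_bigr => k _; rewrite xk.
have -> : \sum_(k < r) opc k * (\sum_j y j * tau k (f j)) + opc r * (\sum_j y j * tau r (f j)) =
    \sum_j y j * opP (f j).
  transitivity (\sum_(k < r.+1) opc k * (\sum_j y j * tau k (f j))); first by rewrite big_ord_recr.
  under eq_bigr => k _ do rewrite mulr_sumr.
  rewrite exchange_big; apply: eq_bigr => j _; rewrite /opP mulr_sumr.
  by apply: eq_bigr => k _; rewrite mulrCA.
by rewrite big1 ?add0r // => j _; rewrite Pf mulr0.
Qed.

Lemma moore_basis_uniformizable g : tate g -> exists x, tate x /\ Exp x = g.
Proof.
move=> tg; have [x Px] := moore_basis_surj (scst g).
have [y [ty ey _]] := gsys_log tateA (nvalP x) ((opP_gsys x tg).1 Px).
by exists y.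
Qed.

Lemma moore_basis_log : exists l : 'I_r -> ts, (forall i, Lam (l i)) /\
  forall i, nval (f i) = gen (l i).
Proof.
have /choice[l Hl] i : exists l, Lam l /\ nval (f i) = gen l.
  have [x [tx ex xf]] := gsys_log tateA (nvalP (f i)) ((opP_gsys0 (f i)).1 (proj1 Uf i)).
  by exists x; split=> //; apply/(Lam_iff tateA).
by exists l; split=> i; case: (Hl i).
Qed.

Lemma moore_basis_gen (l : 'I_r -> ts) x : (forall i, Lam (l i)) ->
  (forall i, nval (f i) = gen (l i)) -> Lam x ->
  exists c : 'I_r -> S, (forall i, fixedS (c i)) /\ x = \sum_i zev (nval (c i)) * l i.
Proof.
move=> Ll fl Lx; have [tx ex] := (Lam_iff tateA x).1 Lx.
have ng := gen_null tateA tx.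
have [|c [fc ec]] := @moore_basis_span (toS (gen x)).
  by apply/opP_gsys0; rewrite toSK // -ex; apply: gen_phi.
exists c; split=> //; apply/eqP; rewrite -subr_eq0; apply/eqP.
have [h1 h2] := gen_sum tateA fc Ll; have [t1 e1] := (Lam_iff tateA _).1 h1.
apply: (gen_inj0 tateA); first exact: tateB.
have := genD tateA (tateB tx t1) t1; rewrite subrK h2 => e2.
apply: (addIr (\sum_i nval (c i) * gen (l i))); rewrite -e2 add0r.
rewrite -(toSK ng) ec nval_sum; apply: eq_bigr => j _.
by rewrite nvalM fl.
Qed.

End Basis.

(** Freeness over A[t] supplies the saturation required by [moore_unit]: independence settles c = 0,
    and for c <> 0 the spanning property expresses the quotient by c, again a solution of P, through
    the f_j with fixed coefficients. *)
Lemma lattice_moore_basis (l : 'I_r -> ts) : (forall i, Lam (l i)) ->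
  (forall x, Lam x -> exists c : 'I_r -> ts, (forall i, inAt io th (c i)) /\ x = \sum_i c i * l i) ->
  (forall c : 'I_r -> ts, (forall i, inAt io th (c i)) -> \sum_i c i * l i = 0 -> forall i, c i = 0) ->
  moore_basis (fun i => toS (gen (l i))).
Proof.
move=> Ll span indep; set f := fun i => _.
have tl i : tate (l i) by case/(Lam_iff tateA): (Ll i).
have fE i : nval (f i) = gen (l i) by rewrite toSK //; apply: gen_null.
have Pf i : opP (f i) = 0.
  apply/opP_gsys0; rewrite fE; case/(Lam_iff tateA): (Ll i) => _ <-.
  exact: gen_phi.
have ind (v : 'I_r -> S) : (forall j, fixedS (v j)) -> \sum_j v j * f j = 0 -> forall j, v j = 0.
  move=> fv e j; have [h1 h2] := gen_sum tateA fv Ll.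
  apply: zev_fixed_inj => //; apply: (indep (fun j => zev (nval (v j)))) => [i|].
    exact: zev_inAt.
  apply: (gen_inj0 tateA); first by case/(Lam_iff tateA): h1.
  rewrite h2; transitivity (nval (\sum_j v j * f j)); last by rewrite e nval0.
  rewrite nval_sum; apply: eq_bigr => i _.
  by rewrite nvalM fE.
split=> //; have [u u1] := opc0_inv.
apply: (moore_unit (moore_tau Pf) (moore_tau' u1 Pf)) => c v fc fv [y vy].
have {}fv j : fixedS (v ord0 j) by rewrite /fixedS -{2}fv mxE.
have lt1 : (r.-1 < r)%N by rewrite prednK.
(* Only the last column of v M = c y matters, where the Moore matrix has the untwisted f_j. *)
pose y0 := y ord0 (Ordinal lt1).
have e0 : \sum_j v ord0 j * f j = c * y0.
  move/rowP: vy => /(_ (Ordinal lt1)); rewrite !mxE => <-.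
  by apply: eq_bigr => j _; rewrite mxE /= prednK // subnn stwist0.
have [c0|cn0] := eqVneq c 0.
  exists 0; apply/rowP => j; rewrite c0 scale0r mxE; apply: (ind (fun j => v ord0 j)) => //.
  by rewrite e0 c0 mul0r.
have Py : opP y0 = 0.
  apply: (mulfI cn0); rewrite mulr0 -opPZ // -e0 opP_sum big1 // => j _.
  by rewrite opPZ // Pf mulr0.
have [x [tx ex yx]] := gsys_log tateA (nvalP y0) ((opP_gsys0 y0).1 Py).
have [a [Aa xa]] := span x ((Lam_iff tateA x).2 (conj tx ex)).
have /choice[w Hw] j : exists w, fixedS w /\ a j = zev (nval w).
  by have [w] := inAt_zev (Aa j); exists w.
have yw : y0 = \sum_j w j * f j.
  apply: nval_inj; rewrite yx xa; have [_] := gen_sum tateA (fun j => proj1 (Hw j)) Ll.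
  under eq_bigr => j _ do rewrite -(proj2 (Hw j)).
  by move=> ->; rewrite nval_sum; apply: eq_bigr => j _; rewrite nvalM fE.
exists (\row_j w j); apply/rowP => j; rewrite !mxE; apply/eqP; rewrite -subr_eq0; apply/eqP.
apply: (ind (fun j => v ord0 j - c * w j)) => [i|].
  by rewrite /fixedS rmorphB rmorphM /= fv fc (proj1 (Hw i)).
under eq_bigr => i _ do rewrite mulrBl.
rewrite sumrB e0 yw mulr_sumr; apply/eqP; rewrite subr_eq0; apply/eqP.
by apply: eq_bigr => i _; rewrite mulrA.
Qed.

End Operator.

(** * Rigid analytic trivializations *)

Section Decay.
Variables (K : cinf) (s : nat).
Local Notation F := (cF K).
Local Notation C := (cC K).
Local Notation R := (cR K).
Local Notation ab := (@cab K).
Local Notation q := (Defs.q (cF K)).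
Local Notation ts := (@tser (cC K) s).
Local Notation zs := (@zser (cC K) s).
Local Notation tate := (@Defs.tate C R ab s).
Local Notation tw n := (@twist F C s (Posz n)).
Implicit Types (f : ts) (kap rho : R).

Lemma tate_norm f : tate f -> exists mu : R, [/\ 0 <= mu, bnd f mu & forall rho, bnd f rho -> mu <= rho].
Proof.
move=> tf; have [->|f0] := eqVneq f 0.
  by exists 0; split=> // [|rho /(ab_bnd0 (mon0 s))//]; apply: bnd0.
by have [m0 [_ h]] := tate_max tf f0; exists (ab (f m0)); split=> //; apply: ab_ge0.
Qed.

Lemma family_bnd d (c : nat -> ts) : (forall k, tate (c k)) ->
  exists2 rho : R, 1 <= rho & forall k, (k < d)%N -> bnd (c k) rho.
Proof.
move=> tc; elim: d => [|d [rho r1 H]]; first by exists 1.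
have [sg s1 Hd] := tate_bnd (tc d); exists (Num.max rho sg); first by rewrite le_max r1.
move=> k; rewrite ltnS leq_eqVlt => /orP[/eqP ->|/H h].
  by apply: bnd_le Hd; rewrite le_max lexx orbT.
by apply: bnd_le h; rewrite le_max lexx.
Qed.

(** Once the coefficients are small, the twisted terms are of order at least two and are dominated,
    so the linear term u x_n alone determines the geometric rate. *)
Lemma decay_rec (x : zs) d (u : ts) (c b : nat -> ts) kap : 0 < kap -> kap < 1 ->
  znull x -> bnd u kap -> (forall k, tate (c k)) -> (forall k, tate (b k)) ->
  (forall n, x n.+1 = u * (x n : ts) + \sum_(k < d) c k * tw k.+1 (x n.+1) +
     \sum_(k < d) b k * tw k.+1 (x n)) ->
  exists c0 : R, exists N, forall n, (N <= n)%N -> bnd (x n) (c0 * kap ^+ n).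
Proof.
move=> k0 k1 /znullP[tx ux] uk tc tb xS.
have [ka ka1 Hka] := family_bnd d tc; have [kb kb1 Hkb] := family_bnd d tb.
pose kk := Num.max ka kb.
have kk1 : 1 <= kk by rewrite le_max ka1.
have kk0 : 0 < kk := lt_le_trans ltr01 kk1.
have /choice[mu Hmu] n : exists mu : R, [/\ 0 <= mu, bnd (x n) mu & forall rho, bnd (x n) rho -> mu <= rho].
  exact: tate_norm.
(* Below the threshold kap / kk a twisted term with coefficient of size at most kk contributes at
   most kap times the norm. *)
have e0 : 0 < kap / kk by rewrite divr_gt0.
have ek : kap / kk <= kap by rewrite ler_pdivrMr // ler_peMr // ltW.
have [N HN] := ux _ e0.
have mu_small n : (N <= n)%N -> mu n <= kap / kk.
  by move=> Nn; have [_ _] := Hmu n; apply => m; apply/ltW/HN.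
have pow_small m j : 0 <= m -> m <= kap / kk -> kk * m ^+ (q ^ j.+1) <= kap * m.
  move=> m0 mk; have m1 : m <= 1 by rewrite (le_trans mk) // (le_trans ek) // ltW.
  apply: le_trans (_ : _ <= kk * m ^+ 2) _.
    rewrite ler_pM2l // ler_wiXn2l //.
    by rewrite (leq_trans (q_gt1 K)) // -{1}(expn1 q) leq_exp2l ?q_gt1.
  by rewrite expr2 mulrA ler_wpM2r // mulrC -ler_pdivlMr.
have step n : (N <= n)%N -> mu n.+1 <= kap * mu n.
  move=> Nn; have [m0 mb mmin] := Hmu n; have [m0' mb' mmin'] := Hmu n.+1.
  have hb : bnd (x n.+1) (Num.max (kap * mu n) (kap * mu n.+1)).
    have p0 : 0 <= Num.max (kap * mu n) (kap * mu n.+1) by rewrite le_max mulr_ge0 // ltW.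
    rewrite xS; apply: bndD; first apply: bndD.
    - by apply: bnd_le (bndM uk mb); rewrite le_max lexx.
    - apply: bnd_sum => // k _; apply: bnd_le (bndM (Hka k (ltn_ord k)) (@bnd_twist _ _ k.+1 _ _ mb')).
      rewrite le_max; apply/orP; right.
      apply: le_trans (pow_small _ k m0' (mu_small _ (leqW Nn))).
      by rewrite ler_wpM2r ?exprn_ge0 // le_max lexx.
    apply: bnd_sum => // k _; apply: bnd_le (bndM (Hkb k (ltn_ord k)) (@bnd_twist _ _ k.+1 _ _ mb)).
    rewrite le_max; apply/orP; left.
    apply: le_trans (pow_small _ k m0 (mu_small _ Nn)).
    by rewrite ler_wpM2r ?exprn_ge0 // le_max lexx orbT.
  (* The twisted terms in x_(n+1) itself leave the alternative mu_(n+1) <= kap mu_(n+1), which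
     forces mu_(n+1) = 0. *)
  have := mmin' _ hb; rewrite le_max => /orP[//|h].
  have -> : mu n.+1 = 0; last by rewrite mulr_ge0 // ltW.
  apply/eqP; rewrite eq_le m0' andbT leNgt; apply/negP => mp.
  by move: h; rewrite -{1}(mul1r (mu n.+1)) ler_pM2r // leNgt k1.
have kn n : 0 < kap ^+ n by rewrite exprn_gt0.
exists (mu N / kap ^+ N), N => n Nn.
have [_ hb _] := Hmu n; apply: bnd_le hb; rewrite -(subnKC Nn); move: (n - N)%N => j.
elim: j => [|j IH]; first by rewrite addn0 divfK // gt_eqF.
rewrite addnS exprS mulrCA; apply: le_trans (step _ (leq_addr _ _)) _.
by rewrite ler_pM2l.
Qed.

(** l twists turn the ratio kap into kap^(q^l). *)
Lemma geometric_zTate (x : zs) c0 kap N l : znull x -> 0 < kap -> q%:R * kap ^+ (q ^ l) < 1 ->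
  (forall n, (N <= n)%N -> bnd (x n) (c0 * kap ^+ n)) -> znull (zscale (ztwist (Posz l) x)).
Proof.
move=> nx k0 k1 Hb; apply/znullP; split=> [n|e e0].
  by apply: tateM; [exact: tate_thp | apply/tate_twist/znull_tate].
have c00 : 0 <= c0.
  have := ab_bnd0 (mon0 s) (Hb N (leqnn N)); rewrite pmulr_lge0 // exprn_gt0 //.
set t := q%:R * kap ^+ (q ^ l) in k1.
have t0 : 0 <= t by rewrite mulr_ge0 ?ler0n ?exprn_ge0 // ltW.
have c1 : 0 < c0 ^+ (q ^ l) + 1 by rewrite ltr_wpDl // exprn_ge0.
have [M HM] := pow_lt_small t0 k1 (divr_gt0 e0 c1).
exists (maxn N M) => n; rewrite geq_max => /andP[Nn Mn] m.
have h := bndM (@thp_bnd K s n) (@bnd_twist _ _ l _ _ (Hb n Nn)) m.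
apply: le_lt_trans h _.
have -> : q%:R ^+ n * (c0 * kap ^+ n) ^+ (q ^ l) = c0 ^+ (q ^ l) * t ^+ n.
  by rewrite !exprMn mulrCA -!exprM [(n * _)%N]mulnC.
apply: le_lt_trans (_ : _ <= (c0 ^+ (q ^ l) + 1) * t ^+ n) _.
  by rewrite ler_wpM2r ?exprn_ge0 // lerDl ler01.
by rewrite mulrC -ltr_pdivlMr // HM.
Qed.

End Decay.

(** * From a trivialization to a Moore basis *)

Section Trivialization.
Variables (K : cinf) (s r : nat).
Local Notation F := (cF K).
Local Notation C := (cC K).
Local Notation R := (cR K).
Local Notation th := (@cth K).
Local Notation ab := (@cab K).
Local Notation ts := (@tser (cC K) s).
Local Notation zs := (@zser (cC K) s).
Local Notation S := (nser K s).
Local Notation tate := (@Defs.tate C R ab s).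
Local Notation tau n := (@stwist K s (Posz n)).
Local Notation sg n := (@stwist K s (- Posz n)).
Variables (A : nat -> ts) (B : ts).
Hypothesis tateA : forall i, (1 <= i <= r)%N -> tate (A i).
Hypothesis r_gt0 : (0 < r)%N.
Hypothesis tate_B : tate B.
Hypothesis AB : A r * B = 1.
Local Notation thp := (@thp K s).
Local Notation phib := (@phib K s r A).
Local Notation scst := (@scst K s).
Local Notation svar := (@svar K s).
Local Notation opc := (@opc K s r A).
Local Notation opP := (@opP K s r A).
Local Notation moore := (@moore K s r).
Local Notation moore_basis := (@moore_basis K s r A).
Implicit Types (f : S).

Lemma tausg n f : tau n (sg n f) = f.
Proof. by rewrite stwist_comp addrN stwist0. Qed.
Lemma sgtau n f : sg n (tau n f) = f.
Proof. by rewrite stwist_comp addNr stwist0. Qed.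

Lemma stwist_cst n (g : ts) : tate g -> stwist n (scst g) = scst (twist F n g).
Proof.
move=> tg; apply: nval_inj; rewrite nval_twist !nval_cst ?ztwist_const //.
exact: tate_twist.
Qed.

Lemma svar_fixed : fixedS svar.
Proof.
apply: nval_inj; rewrite nval_twist nval_svar; apply: funext => n; rewrite /ztwist /zvar.
by case: eqP => _; rewrite ?rmorph1 ?rmorph0.
Qed.

Definition cA k : S := scst (phib k).

Lemma opc_cA k : (0 < k)%N -> opc k = cA k.
Proof. by rewrite /opc; case: k. Qed.

Lemma opP_split f : opP f = (scst (thp 1) - svar) * f + \sum_(1 <= k < r.+1) cA k * tau k f.
Proof.
rewrite /opP big_ord_recl stwist0; congr (_ + _).
rewrite big_add1 /= big_mkord; apply: eq_bigr => k _.
by rewrite opc_cA.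
Qed.

(* [map_mx tau (moore f) *m trivW] is the inverse of a trivialization when [f] is a Moore basis. *)
Definition trivW : 'M[S]_r := \matrix_(l, j) if (j <= l)%N then sg j (cA (r - l + j)) else 0.

Lemma trivW_unit : trivW \in unitmx.
Proof.
rewrite unitmxE det_trig; last by apply/is_trig_mxP => i j ij; rewrite mxE leqNgt ij.
apply: rpred_prod => i _; rewrite mxE leqnn subnK; last exact: ltnW (ltn_ord i).
by apply: rmorph_unit; rewrite -opc_cA //; apply: unitS (opc_r tateA r_gt0 tate_B AB).
Qed.

Definition trivrow (f : S) (j : nat) : S :=
  \sum_(l < r) tau (r - l) f * (if (j <= l)%N then sg j (cA (r - l + j)) else 0).

Lemma moore_trivW n (f : 'I_n -> S) i j :
  (map_mx (tau 1) (moore f) *m trivW) i j = trivrow (f i) j.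
Proof.
rewrite mxE; apply: eq_bigr => l _; rewrite !mxE tau_comp; congr (tau _ _ * _).
by have := ltn_ord l; lia.
Qed.

Lemma tau_trivrow f j : (j < r)%N -> tau j (trivrow f j) = \sum_(j.+1 <= k < r.+1) cA k * tau k f.
Proof.
move=> jr; rewrite rmorph_sum /=.
transitivity (\sum_(0 <= l < r | (j <= l)%N) cA (r - l + j) * tau (r - l + j) f).
  rewrite big_mkord [RHS]big_mkcond /=; apply: eq_bigr => l _.
  rewrite rmorphM /= tau_comp; case: ifP => _; last by rewrite rmorph0 mulr0.
  by rewrite tausg mulrC addnC.
rewrite -(big_nat_widenl j 0 r xpredT) // (big_addn 0 r j) (big_addn 0 r.+1 j.+1) subSS !big_mkord.
rewrite (reindex_inj rev_ord_inj) /=; apply: eq_bigr => k _.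
by have -> : (r - (r - j - k.+1 + j) + j = k + j.+1)%N by have := ltn_ord k; lia.
Qed.

(** P f = 0 exchanges the tail of the operator, in tau^k with k > j, for its head. In this form
    consecutive columns differ by one term, as the last row of Phi prescribes. *)
Lemma tau_trivrow_opP f j : opP f = 0 -> (j < r)%N ->
  tau j (trivrow f j) = (svar - scst (thp 1)) * f - \sum_(1 <= k < j.+1) cA k * tau k f.
Proof.
move=> Pf jr; rewrite tau_trivrow //; apply/eqP; rewrite eq_sym subr_eq [X in _ == X]addrC.
rewrite -(big_cat_nat (n := j.+1)) //=; last by rewrite ltnS ltnW.
by have := Pf; rewrite opP_split => /eqP; rewrite addrC addr_eq0 -mulNr opprB => /eqP ->.
Qed.

Definition phiS (i j : 'I_r) : S :=
  if (i < r.-1)%N then (j == i.+1 :> nat)%:R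
  else if j == 0%N :> nat then (svar - scst (thp 1)) * sg r (scst B)
  else - sg j (cA j) * sg r (scst B).

Lemma nval_phiS i j : nval (phiS i j) = Phi F th A B i j.
Proof.
have tB : tate (twist F (- Posz r) B) by apply: tate_twist.
rewrite /phiS /Phi; case: ifP => _; first by case: ifP => _; rewrite ?nval1 // nval0; apply: funext => -[].
rewrite (stwist_cst _ tate_B); case: eqP => j0.
  rewrite mulrBl nvalB !nvalM nval_svar (nval_cst (@tate_thp K s 1)) (nval_cst tB).
  apply: funext => n; rewrite zcoefB zvarM zcoef_constM.
  case: n => [|[|n]]; rewrite /zconst /= ?mulr0 ?subr0 // sub0r -mulNr.
  congr (_ * _); apply/esym/eqP; rewrite -addr_eq0 /thp expr1 -tconstD addNr tconst0 //.
have jr : (0 < j <= r)%N by rewrite lt0n; move/eqP: j0 => ->; rewrite ltnW.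
rewrite stwist_cst; last exact: tate_phib.
rewrite /phib jr nvalM nvalN !nval_cst //; last by apply: tate_twist; apply: tateA.
rewrite (_ : tmul _ _ = (0 - (twist F (- Posz j) (A j) : ts)) * twist F (- Posz r) B) //.
rewrite zconstM zconstB; have -> : zconst (0 : ts) = 0 :> zs by apply: funext => -[].
by rewrite sub0r.
Qed.

Lemma nval_mx (P Q : 'M[S]_r) (P' Q' : @mxz C s r) :
  (forall i j, nval (P i j) = P' i j) -> (forall i j, nval (Q i j) = Q' i j) ->
  forall i j, nval ((P *m Q) i j) = mxmul P' Q' i j.
Proof.
move=> hP hQ i j; rewrite mxE nval_sum; apply: funext => n; apply: funext => m.
rewrite zcoef_sum tcoef_sum /mxmul; apply: eq_bigr => l _.
by rewrite nvalM hP hQ.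
Qed.

Lemma zTate_znull (a : zs) : zTate F ab a -> znull a.
Proof.
move=> [ta ua]; apply/znullP; split=> // e /ua[N HN]; exists N => n Nn m.
apply: le_lt_trans (HN n Nn m); rewrite ler_peMl ?ab_ge0 //.
by rewrite exprn_ege1 // ltW // qR_gt1.
Qed.

(* The last column of the inverse of a rigid analytic trivialization determines the others. *)
Lemma RAT_moore_basis (Psi Psi' : @mxz C s r) :
  (forall i j, zTate F ab (Psi i j) /\ zTate F ab (Psi' i j)) ->
  mxmul Psi Psi' = @mxone C s r -> mxmul Psi' Psi = @mxone C s r ->
  (fun i j n => twist F (-1) (Psi i j n)) = mxmul (Phi F th A B) Psi ->
  exists2 f, moore_basis f & forall i (j : 'I_r), nval (trivrow (f i) j) = Psi' i j.
Proof.
move=> zt e1 e2 e3.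
have [P hP] : exists P : 'M[S]_r, forall i j, nval (P i j) = Psi i j.
  exists (\matrix_(i, j) toS (Psi i j)) => i j; rewrite mxE toSK //.
  by apply: zTate_znull; case: (zt i j).
have [P' hP'] : exists P' : 'M[S]_r, forall i j, nval (P' i j) = Psi' i j.
  exists (\matrix_(i, j) toS (Psi' i j)) => i j; rewrite mxE toSK //.
  by apply: zTate_znull; case: (zt i j).
have one i j : nval ((1%:M : 'M[S]_r) i j) = @mxone C s r i j.
  rewrite mxE /mxone; case: eqP => _; first exact: nval1.
  by rewrite nval0; apply: funext => -[].
have PP' : P *m P' = 1%:M.
  by apply/matrixP => i j; apply: nval_inj; rewrite (nval_mx hP hP') e1 one.
have P'P : P' *m P = 1%:M by apply: mulmx1C.
have sP : map_mx (sg 1) P = (\matrix_(i, j) phiS i j) *m P.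
  apply/matrixP => i j; apply: nval_inj; rewrite (nval_mx (P' := Phi F th A B) _ hP).
    by rewrite -e3 mxE nval_twist hP.
  by move=> i' j'; rewrite mxE nval_phiS.
have sP' : P' = map_mx (sg 1) P' *m (\matrix_(i, j) phiS i j).
  rewrite -[RHS]mulmx1 -PP' mulmxA -(mulmxA _ (\matrix_(i, j) phiS i j)) -sP.
  by rewrite -map_mxM P'P map_mx1 mul1mx.
have lt1 : (r.-1 < r)%N by rewrite prednK.
(* Forced by the last column, which has to be tau f times the (r-1)-fold inverse twist of A_r. *)
pose f i := sg 1 (P' i (Ordinal lt1)) * sg r (scst B).
have recur i (j : 'I_r) : tau j (P' i j) = (svar - scst (thp 1)) * f i - \sum_(1 <= k < j.+1) cA k * tau k (f i).
  case: j => j; elim: j => [|j IH] jr.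
    rewrite /= stwist0 big_geq // subr0 [in LHS]sP' mxE (bigD1 (Ordinal lt1)) //= !mxE /phiS /= ltnn ?eqxx /=.
    rewrite big1 ?addr0; first by rewrite /f mulrCA.
    move=> k kn; rewrite !mxE /phiS; case: ifP => [_|]; first by rewrite mulr0.
    move=> /negbT; rewrite -leqNgt => h; case/eqP: kn; apply: val_inj => /=.
    by apply/eqP; rewrite eqn_leq h andbT -ltnS prednK // ltn_ord.
  have jr' : (j < r)%N := ltnW jr.
  have -> : P' i (Ordinal jr) = sg 1 (P' i (Ordinal jr')) - f i * sg j.+1 (cA j.+1).
    rewrite [in LHS]sP' mxE (bigD1 (Ordinal lt1)) //= (bigD1 (Ordinal jr')) /=; last first.
      by rewrite -val_eqE /=; move: jr; lia.
    rewrite !mxE /phiS /= ltnn ?eqxx /=.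
    have -> : (j < r.-1)%N by move: jr; lia.
    rewrite ?eqxx mulr1 big1 ?addr0.
      by rewrite addrC /f -mulrN mulrA mulrAC; congr (_ + _); rewrite mulrN mulNr -mulrA.
    move=> k /andP[k1 k2]; rewrite !mxE /phiS; case: ifP => [_|].
      case: eqP => [ek|_]; last by rewrite mulr0.
      by case/eqP: k2; apply: val_inj; case: ek.
    move=> /negbT; rewrite -leqNgt => h; case/eqP: k1; apply: val_inj => /=.
    by apply/eqP; rewrite eqn_leq h andbT -ltnS prednK // ltn_ord.
  rewrite rmorphB rmorphM /= tausg stwist_comp.
  have -> : (j.+1 : int) + - (1%N : int) = j by rewrite -addn1 PoszD addrK.
  rewrite (IH jr') [in RHS]big_nat_recr //= opprD addrA; congr (_ - _).
  by rewrite mulrC.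
(* The definition of f gives tau^(r-1) of the last column as A_r tau^r f, the recursion gives it as
   the negative of the lower terms of P f; their equality is P f = 0. *)
have Pf i : opP (f i) = 0.
  rewrite opP_split big_nat_recr //=.
  have := recur i (Ordinal lt1); rewrite /= prednK // => e.
  have -> : cA r * tau r (f i) = tau r.-1 (P' i (Ordinal lt1)).
    rewrite /f rmorphM /= tausg stwist_comp.
    have -> : (r : int) + - (1%N : int) = r.-1 by rewrite -{1}(prednK r_gt0) -addn1 PoszD addrK.
    by rewrite mulrCA -opc_cA // (opc_r tateA r_gt0 tate_B AB) mulr1.
  by rewrite e; move: (\sum_(_ <= k < _) _) => t; ring.
have rows i (j : 'I_r) : trivrow (f i) j = P' i j.
  by apply: (can_inj (sgtau j)); rewrite recur tau_trivrow_opP.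
exists f; last by move=> i j; rewrite rows hP'.
split=> //; have : map_mx (tau 1) (moore f) *m trivW \in unitmx.
  have -> : map_mx (tau 1) (moore f) *m trivW = P'.
    by apply/matrixP => i j; rewrite moore_trivW rows.
  by case: (mulmx1_unit P'P).
rewrite unitmx_mul => /andP[]; rewrite !unitmxE det_map_mx => h _.
by rewrite -[\det _](sgtau 1); apply: rmorph_unit.
Qed.

End Trivialization.

(** * From a Moore basis to a trivialization *)

Section TrivializationFromBasis.
Variables (K : cinf) (s r : nat).
Local Notation F := (cF K).
Local Notation C := (cC K).
Local Notation R := (cR K).
Local Notation th := (@cth K).
Local Notation ab := (@cab K).
Local Notation q := (Defs.q (cF K)).
Local Notation ts := (@tser (cC K) s).
Local Notation zs := (@zser (cC K) s).
Local Notation S := (nser K s).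
Local Notation tate := (@Defs.tate C R ab s).
Local Notation tau n := (@stwist K s (Posz n)).
Local Notation sg n := (@stwist K s (- Posz n)).
Variables (A : nat -> ts) (B : ts).
Hypothesis tateA : forall i, (1 <= i <= r)%N -> tate (A i).
Hypothesis r_gt0 : (0 < r)%N.
Hypothesis tate_B : tate B.
Hypothesis AB : A r * B = 1.
Local Notation thp := (@thp K s).
Local Notation thn := (@thn K s).
Local Notation phib := (@phib K s r A).
Local Notation scst := (@scst K s).
Local Notation svar := (@svar K s).
Local Notation opP := (@opP K s r A).
Local Notation moore := (@moore K s r).
Local Notation moore_basis := (@moore_basis K s r A).
Implicit Types (f : S).

Local Notation cA := (@cA K s r A).
Local Notation trivrow := (@trivrow K s r A).
Local Notation trivW := (@trivW K s r A).
Local Notation phiS := (@phiS K s r A B).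

Definition zTs (a : S) := znull (zscale (nval a)).

Lemma zTsD (a b : S) : zTs a -> zTs b -> zTs (a + b).
Proof. by rewrite /zTs nvalD zscaleD; apply: znullD. Qed.
Lemma zTsM (a b : S) : zTs a -> zTs b -> zTs (a * b).
Proof. by rewrite /zTs nvalM zscaleM; apply: znullM. Qed.
Lemma zTs_cst (g : ts) : tate g -> zTs (scst g).
Proof. by move=> tg; rewrite /zTs nval_cst // zscale_const znull_const. Qed.
Lemma zTs0 : zTs 0.
Proof. by rewrite -(@scst0 K s); apply: zTs_cst; apply: tate0. Qed.
Lemma zTs_sum I (t : seq I) (P : pred I) (u : I -> S) : (forall i, P i -> zTs (u i)) ->
  zTs (\sum_(i <- t | P i) u i).
Proof. by move=> H; elim/big_ind: _ => //; [exact: zTs0 | exact: zTsD]. Qed.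

(** Dividing the recursion by theta gives decay of order q^(-n), not enough for |z| = q. One twist
    improves the ratio to q^(-q), and q q^(-q) < 1. *)
Lemma decay_kernel f l : opP f = 0 -> (0 < l)%N -> zTs (tau l f).
Proof.
move=> Pf l0; have q0 := qR_gt0 K; have q2 := qR_ge2 K.
have [_ xS] := (opP_gsys0 tateA f).1 Pf.
have k0 : 0 < (q%:R^-1 : cR K) by rewrite invr_gt0.
have k1 : (q%:R^-1 : cR K) < 1 by rewrite invf_lt1 ?qR_gt1.
have uk : bnd (thn 1) (q%:R^-1 : cR K) by have := @thn_bnd K s 1; rewrite expr1.
have [||n|c0 [N HN]] := decay_rec (x := nval f) (d := r) (c := fun k => - (thn 1 * phib k.+1))
    (b := fun=> 0) k0 k1 (nvalP f) uk.
- by move=> k; apply/tateN/tateM; [exact: tate_thn | exact: tate_phib].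
- by move=> k; apply: tate0.
- rewrite [X in _ = _ + X]big1 ?addr0 => [|k _]; last exact: mul0r.
  rewrite -(xS n) phiE /pev big_ord_recl /= {1}/phib /= mul0r add0r.
  rewrite mulrDr mulrA [thn 1 * thp _]mulrC thpnK mul1r mulr_sumr -addrA -big_split /=.
  by rewrite big1 ?addr0 // => k _; rewrite mulNr mulrA addrN.
rewrite /zTs nval_twist; apply: (geometric_zTate (kap := q%:R^-1) (nvalP f) k0 _ HN).
apply: le_lt_trans (_ : _ <= q%:R * q%:R^-1 ^+ 2) _.
  rewrite ler_pM2l // ler_wiXn2l ?(ltW k0) ?(ltW k1) //.
  by rewrite (leq_trans (q_gt1 K)) // -{1}(expn1 q) leq_exp2l ?q_gt1.
by rewrite expr2 mulrA divff ?gt_eqF // mul1r.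
Qed.

Lemma zTs_trivrow f j : opP f = 0 -> zTs (trivrow f j).
Proof.
move=> Pf; apply: zTs_sum => l _; apply: zTsM.
  by apply: decay_kernel => //; rewrite subn_gt0.
case: ifP => _; last exact: zTs0.
by rewrite stwist_cst; [apply/zTs_cst/tate_twist/tate_phib | exact: tate_phib].
Qed.

Lemma trivrow_last f : sg 1 (trivrow f r.-1) * sg r (scst B) = f.
Proof.
have lt1 : (r.-1 < r)%N by rewrite prednK.
have := tau_trivrow A r_gt0 f lt1; rewrite prednK // big_nat1 => e.
have -> : sg 1 (trivrow f r.-1) = sg r (cA r * tau r f).
  rewrite -e !stwist_comp; congr (stwist _ _).
  by have := r_gt0; lia.
rewrite -rmorphM /= mulrAC -opc_cA // (opc_r tateA r_gt0 tate_B AB) mul1r.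
exact: sgtau.
Qed.

Lemma trivrow_phi f (j : 'I_r) : opP f = 0 ->
  \sum_(l < r) sg 1 (trivrow f l) * phiS l j = trivrow f j.
Proof.
move=> Pf; have lt1 : (r.-1 < r)%N by rewrite prednK.
have off (k l : 'I_r) : k != Ordinal lt1 -> l != k.+1 :> nat -> phiS k l = 0.
  rewrite /phiS => kn lk; have -> : (k < r.-1)%N.
    by rewrite ltn_neqAle -ltnS prednK // ltn_ord andbT; apply: contraNneq kn => e; apply/eqP/val_inj.
  by rewrite (negbTE lk).
rewrite (bigD1 (Ordinal lt1)) //=; case: j => [[|j] jr].
  rewrite big1 ?addr0 => [|k kn]; last by rewrite off ?mulr0.
  rewrite /phiS /= ltnn mulrCA trivrow_last.
  by have := tau_trivrow_opP r_gt0 Pf jr; rewrite stwist0 big_geq // subr0.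
have jr' : (j < r)%N := ltnW jr.
rewrite (bigD1 (Ordinal jr')) /=; last by rewrite -val_eqE /=; move: jr; lia.
rewrite big1 ?addr0 => [|k /andP[k1 k2]]; last first.
  by rewrite off ?mulr0 //=; apply: contraNneq k2 => -[e]; apply/eqP/val_inj.
have jp : (j < r.-1)%N by move: jr; lia.
rewrite /phiS /= ltnn jp eqxx mulr1.
rewrite mulrCA trivrow_last; apply: (can_inj (sgtau j.+1)).
rewrite rmorphD rmorphM rmorphN /= tausg stwist_comp.
have -> : (j.+1 : int) + - (1%N : int) = j by rewrite -addn1 PoszD addrK.
rewrite !tau_trivrow_opP // [in RHS]big_nat_recr //=; ring.
Qed.

(** Convergence at |z| = q must be shown for a matrix and for its inverse. The inverse of Psi
    contains only proper twists of the f_i, so [decay_kernel] applies; for Psi a separate recursion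
    is extracted from the difference equation. *)
Lemma basis_RAT (f : 'I_r -> S) : moore_basis f -> has_RAT F th ab r A B.
Proof.
move=> [Pf uM].
have [P' P'E] : exists P' : 'M[S]_r, forall i j, P' i j = trivrow (f i) j.
  by exists (\matrix_(i, j) trivrow (f i) j) => i j; rewrite mxE.
have uP' : P' \in unitmx.
  have -> : P' = map_mx (tau 1) (moore f) *m trivW.
    by apply/matrixP => i j; rewrite moore_trivW.
  rewrite unitmx_mul (trivW_unit tateA r_gt0 tate_B AB) andbT; exact: map_tau_unit.
have [P [P'P PP']] : exists P, P' *m P = 1%:M /\ P *m P' = 1%:M.
  by exists (invmx P'); rewrite mulmxV // mulVmx.
have sP' : map_mx (sg 1) P' *m (\matrix_(i, j) phiS i j) = P'.
  apply/matrixP => i j; rewrite mxE P'E -(trivrow_phi j (Pf i)).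
  by apply: eq_bigr => l _; rewrite !mxE P'E.
have sP : map_mx (sg 1) P = (\matrix_(i, j) phiS i j) *m P.
  rewrite -[RHS]mul1mx -(map_mx1 (sg 1)) -PP' map_mxM -mulmxA [map_mx _ P' *m _]mulmxA sP'.
  by rewrite P'P mulmx1.
have lt1 : (r.-1 < r)%N by rewrite prednK.
(* The shift rows of Phi make every row of P a twist of the last one, so only the last row needs an
   estimate. *)
have shift i (ir : (i.+1 < r)%N) c : P (Ordinal (ltnW ir)) c = tau 1 (P (Ordinal ir) c).
  have ir' : (i < r.-1)%N by move: ir; lia.
  have /matrixP/(_ (Ordinal (ltnW ir)) c) := sP.
  rewrite !mxE (bigD1 (Ordinal ir)) //= mxE /phiS /= ir' eqxx mul1r big1 ?addr0 => [<-|k kn].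
    by rewrite tausg.
  rewrite mxE /= ir'; case: eqP => [e|_]; last exact: mul0r.
  by case/eqP: kn; apply: val_inj.
have Prow c k (kr : (r - k.+1 < r)%N) : (k < r)%N -> P (Ordinal kr) c = tau k (P (Ordinal lt1) c).
  elim: k kr => [|k IH] kr kr'.
    by rewrite stwist0; congr (P _ c); apply: val_inj; rewrite /= subn1.
  have h1 : ((r - k.+2).+1 < r)%N by move: kr'; lia.
  have -> : Ordinal kr = Ordinal (ltnW h1) by apply: val_inj.
  have h2 : (r - k.+1 < r)%N by move: kr'; lia.
  have e : Ordinal h1 = Ordinal h2 by apply: val_inj => /=; move: kr'; lia.
  by rewrite shift e IH ?tau_comp // ltnW.
have q0 := qR_gt0 K; have q1 := qR_gt1 K.
(* The recursion for the last row has no untwisted term, so any ratio below 1 is attainable; q^(-2)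
   already suffices at |z| = q without a twist. *)
pose kap : cR K := q%:R^-1 / q%:R.
have k0 : 0 < kap by rewrite divr_gt0 // invr_gt0.
have kq : q%:R * kap = q%:R^-1 by rewrite /kap mulrA divff ?gt_eqF // mul1r.
have i1 : (q%:R^-1 : cR K) < 1 by rewrite invf_lt1.
have k1 : kap < 1 by rewrite /kap ltr_pdivrMr // mul1r (lt_trans i1).
pose b1 : ts := twist F 1 (twist F (- Posz r) B).
have tb1 : tate b1 by do 2! apply: tate_twist.
pose g (l : nat) : ts := - (if l == 0%N then twist F 1 (thp 1) * b1 else twist F 1 (twist F (- Posz l) (phib l)) * b1).
have tg l : tate (g l).
  apply: tateN; case: ifP => _; apply: tateM => //; apply: tate_twist; first exact: tate_thp.
  by apply: tate_twist; apply: tate_phib.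
have phig (l : 'I_r) : tau 1 (phiS (Ordinal lt1) l) = (if l == 0%N :> nat then svar * scst b1 else 0) + scst (g l).
  have tphi := @tate_phib K s r A tateA l.
  rewrite /phiS /= ltnn /g; case: eqP => l0.
    rewrite rmorphM rmorphB /= (svar_fixed K s) !stwist_cst //; try exact: tate_thp; try exact: tate_twist.
    rewrite -/b1 -mulNr scstM //; last by apply/tateN/tate_twist/tate_thp.
    rewrite -mulrDl; congr (_ * _); congr (_ + _).
    by rewrite -[in RHS]sub0r; apply: nval_inj; rewrite nvalN !nval_cst ?sub0r;
       [rewrite -[in RHS]sub0r zconstB; have -> : zconst (0 : ts) = 0 :> zs by [apply: funext => -[]]; rewrite sub0r
       |apply/tateN/tate_twist/tate_thp|apply/tate_twist/tate_thp].
  rewrite add0r rmorphM rmorphN /= !stwist_cst //; try (by do ?apply: tate_twist).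
  rewrite -/b1 mulNr -scstM //; last by do 2! apply: tate_twist.
  apply: nval_inj; rewrite nvalN !nval_cst; try (by do ?apply: tateN; apply: tateM => //; do 2! apply: tate_twist).
  rewrite -[in RHS]sub0r zconstB; have -> : zconst (0 : ts) = 0 :> zs by apply: funext => -[].
  by rewrite sub0r.
have zP c l : zTs (tau l (P (Ordinal lt1) c)).
  set h := P (Ordinal lt1) c.
  (* The last row of the difference equation after one twist. Only the entry of Phi in column 0
     involves z, whence the single term with [svar]. *)
  have hrec : h = svar * scst b1 * tau r h + \sum_(k < r) scst (g (r - k.+1)%N) * tau k.+1 h.
    have /matrixP/(_ (Ordinal lt1) c) := sP; rewrite !mxE => /(congr1 (tau 1)); rewrite tausg -/h => hE.
    rewrite [LHS]hE {hE} rmorph_sum /= (reindex_inj rev_ord_inj) /=.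
    have E (k : 'I_r) : tau 1 ((\matrix_(i, j) phiS i j) (Ordinal lt1) (rev_ord k) * P (rev_ord k) c) =
        (if (r - k.+1 == 0)%N then svar * scst b1 * tau r h else 0) + scst (g (r - k.+1)%N) * tau k.+1 h.
      rewrite rmorphM /= mxE phig /=.
      have kr : (r - k.+1 < r)%N by have := ltn_ord k; lia.
      have -> : P (rev_ord k) c = tau k h by rewrite -(Prow c k kr) //; congr (P _ c); apply: val_inj.
      rewrite tau_comp add1n mulrDl; congr (_ + _); case: eqP => e; last by rewrite mul0r.
      by congr (_ * tau _ _); have := ltn_ord k; move: e; lia.
    rewrite (eq_bigr _ (fun k _ => E k)) big_split /=; congr (_ + _).
    rewrite (bigD1 (Ordinal lt1)) //= prednK // subnn eqxx big1 ?addr0 // => k kn.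
    case: eqP => // e; case/eqP: kn; apply: val_inj => /=; have := ltn_ord k; move: e; lia.
  have [||n|c0 [N HN]] := decay_rec (x := nval h) (d := r) (u := 0) (c := fun k => g (r - k.+1)%N)
      (b := fun k => if k.+1 == r then b1 else 0) k0 k1 (nvalP h) (bnd0 (ltW k0)).
  - by move=> k; apply: tg.
  - by move=> k; case: ifP => _; [exact: tb1 | exact: tate0].
  - rewrite mul0r add0r {1}hrec nvalD zcoefD addrC -mulrA nvalM nval_svar zvarM nvalM (nval_cst tb1) zcoef_constM.
    congr (_ + _).
      rewrite nval_sum zcoef_sum; apply: eq_bigr => k _.
      by rewrite nvalM (nval_cst (tg _)) zcoef_constM nval_twist.
    rewrite (bigD1 (Ordinal lt1)) //= prednK // eqxx big1 ?addr0; first by rewrite nval_twist.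
    move=> k kn; case: eqP => [e|_]; last exact: mul0r.
    by case/eqP: kn; apply: val_inj => /=; move: e; lia.
  rewrite /zTs nval_twist; apply: (geometric_zTate (nvalP h) k0 _ HN).
  apply: le_lt_trans i1; rewrite -kq ler_pM2l // -[leRHS]expr1.
  by rewrite ler_wiXn2l ?(ltW k0) ?(ltW k1) // qn_gt0.
exists (fun i j => nval (P i j)), (fun i j => nval (P' i j)); split.
- move=> i j; rewrite !zTateE; split; last by rewrite P'E; apply: zTs_trivrow.
  have ir : (r - (r - i.+1).+1 < r)%N by have := ltn_ord i; lia.
  have -> : i = Ordinal ir by apply: val_inj => /=; have := ltn_ord i; lia.
  by rewrite Prow; [exact: zP | have := ltn_ord i; lia].
- apply: funext => i; apply: funext => j; rewrite -(nval_mx (P := P) (Q := P')) // PP' mxE /mxone.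
  by case: eqP => _; [exact: nval1 | rewrite nval0; apply: funext => -[]].
- apply: funext => i; apply: funext => j; rewrite -(nval_mx (P := P') (Q := P)) // P'P mxE /mxone.
  by case: eqP => _; [exact: nval1 | rewrite nval0; apply: funext => -[]].
apply: funext => i; apply: funext => j.
rewrite -(nval_mx (P := \matrix_(i, j) phiS i j) (Q := P)) //; last first.
  by move=> i' j'; rewrite mxE nval_phiS.
by rewrite -sP mxE nval_twist.
Qed.

End TrivializationFromBasis.

(** * The de Rham map *)

Section DeRham.
Variables (K : cinf) (s r : nat).
Local Notation F := (cF K).
Local Notation C := (cC K).
Local Notation R := (cR K).
Local Notation th := (@cth K).
Local Notation ab := (@cab K).
Local Notation q := (Defs.q (cF K)).
Local Notation ts := (@tser (cC K) s).
Local Notation zs := (@zser (cC K) s).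
Local Notation S := (nser K s).
Local Notation tate := (@Defs.tate C R ab s).
Local Notation tw n := (@twist F C s (Posz n)).
Variables (A : nat -> ts) (B : ts).
Hypothesis tateA : forall i, (1 <= i <= r)%N -> tate (A i).
Hypothesis r_gt0 : (0 < r)%N.
Hypothesis tate_B : tate B.
Hypothesis AB : A r * B = 1.
Local Notation phi := (@phi_theta F C th s r A).
Local Notation thp := (@thp K s).
Local Notation thn := (@thn K s).
Local Notation phib := (@phib K s r A).
Local Notation scst := (@scst K s).
Local Notation svar := (@svar K s).
Local Notation opP := (@opP K s r A).
Implicit Types (f : S).

Local Notation zTs := (@zTs K s).
Local Notation Lam := (Lambda F th ab r A).
Local Notation gen := (@gen K s r A).
Local Notation Fco := (@Fco F C th s r A).
Local Notation tpoly := (@taupoly C R ab s).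

Lemma FcoE e : e 0%N = 0 -> exp_primitive r A e (Fco e).
Proof.
move=> e0 [|n].
  by rewrite /thetaD /= subrr tconst0 mul0r big_ord_recl big_ord0 e0 mul0r addr0.
apply: funext => m; rewrite tcoef_constM /Fco /= mulrC divfK ?(@thetaB_neq0 K n.+1) // tcoef_sum.
by [].
Qed.

Lemma Fco_entire e : tpoly e -> entire (Fco e).
Proof.
move=> [e0 te [d ed]]; apply: (primitive_entire tateA (b := e) (d := d)) => //.
exact: FcoE.
Qed.

Lemma FevE e l g : tpoly e -> tate l -> Fev F th ab r A e l g <-> g = tev (Fco e) l.
Proof.
move=> pe tl; have h := tevP (Fco_entire pe) tl; split=> [e'|->]; last exact: h.
by apply: usums_unique e' h.
Qed.

Lemma Lam_kernel l : Lam l -> nval (toS (gen l)) = gen l /\ opP (toS (gen l)) = 0.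
Proof.
move=> /(Lam_iff tateA)[tl el]; have h : nval (toS (gen l)) = gen l by rewrite toSK //; apply: gen_null.
by split=> //; apply/opP_gsys0 => //; rewrite h -el; apply: gen_phi.
Qed.

(** Quasi-periods as special values of twisted Anderson generating functions; convergence at theta
    is guaranteed for 0 < k and l a period. *)
Definition qperiod k l : ts := zev (ztwist (Posz k) (gen l)).

Lemma zTs_twist_gen k l : Lam l -> (0 < k)%N -> znull (zscale (ztwist (Posz k) (gen l))).
Proof.
move=> Ll k0; have [h1 h2] := Lam_kernel Ll.
by have := decay_kernel tateA h2 k0; rewrite /zTs nval_twist h1.
Qed.

(** Without a term in tau^0 the series is at least quadratic near 0, so theta^n F_eta(l / theta^n)
    tends to 0. *)
Lemma tev_no_linear_small (c : nat -> ts) : entire c -> c 0%N = 0 -> exists2 M : R, 0 <= M &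
  forall x rho, tate x -> bnd x rho -> rho <= 1 -> bnd (tev c x) (M * rho ^+ 2).
Proof.
move=> ec c0; have [N HN] := proj2 ec _ ltr01.
have [M M1 HM] := family_bnd N (proj1 ec).
exists M; first exact: le_trans ler01 M1.
move=> x rho tx xr r1; have r0 := ab_bnd0 (mon0 s) xr.
have M0 := le_trans ler01 M1.
apply: (usums_bnd _ (tevP ec tx)) => [|n]; first by rewrite mulr_ge0 ?exprn_ge0.
have cM : bnd (c n) M.
  have [Nn|/HM//] := leqP N n; apply: bnd_le (HN n Nn); by rewrite expr1n.
case: n cM => [|n] cM; first by rewrite c0 mul0r; apply: bnd0; rewrite mulr_ge0 ?exprn_ge0.
apply: bnd_le (bndM cM (@bnd_twist _ _ n.+1 _ _ xr)).
rewrite ler_wpM2l // ler_wiXn2l //.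
by rewrite (leq_trans (q_gt1 K)) // -{1}(expn1 q) leq_exp2l ?q_gt1.
Qed.

(** Telescoping: F_eta(l / theta^n) = theta F_eta(l / theta^(n+1)) + eta_theta(exp(l /
    theta^(n+1))). The partial sums of the series at z = theta are F_eta(l) - theta^n F_eta(l /
    theta^n). *)
Lemma deRham_zev e d l : tpoly e -> (forall k, (d <= k)%N -> e k = 0) -> tate l ->
  tev (Fco e) l = zev (fun n => pev d e (gen l n)).
Proof.
move=> pe ed tl; have ec := Fco_entire pe; have [e0 te _] := pe.
have tn n : tate (thn n * l) by apply: tateM => //; apply: tate_thn.
have rec n : tev (Fco e) (thn n * l) = thp 1 * tev (Fco e) (thn n.+1 * l) + pev d e (gen l n).
  rewrite -(tev_theta tateA te ed (FcoE e0) ec (tn _)); congr tev.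
  by rewrite mulrA [_ * thn _]mulrC -addn1 thn_thp.
pose X : zs := fun n => pev d e (gen l n).
have psum n : \sum_(k < n) zscale X k = tev (Fco e) l - thp n * tev (Fco e) (thn n * l).
  elim: n => [|n IH]; first by rewrite big_ord0 thp0 thn0 !mul1r subrr.
  have -> : thp n.+1 = thp n * thp 1 by rewrite -addn1 thpD.
  rewrite big_ord_recr /= IH /zscale /X rec; ring.
apply/esym/zev_eq => eps eps0.
have [M M0 HM] := tev_no_linear_small ec (erefl : Fco e 0 = 0).
have [rho r1 lr] := tate_bnd tl; have r0 : 0 < rho := lt_le_trans ltr01 r1.
have q0 := qR_gt0 K.
have i0 : 0 <= (q%:R^-1 : R) by rewrite invr_ge0 ler0n.
have i1 : (q%:R^-1 : R) < 1 by rewrite invf_lt1 ?qR_gt1.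
have c1 : 0 < M * rho ^+ 2 + 1 by rewrite ltr_wpDl // mulr_ge0 ?exprn_ge0 // ltW.
have [N1 HN1] := thn_small tl ltr01.
have [N2 HN2] := pow_lt_small i0 i1 (divr_gt0 eps0 c1).
have [N3 HN3] := pow_lt_small i0 i1 (divr_gt0 ltr01 r0).
exists (maxn N2 N3) => n; rewrite geq_max => /andP[n2 n3] m.
have -> : \sum_(k < n) zscale X k m = (\sum_(k < n) zscale X k) m by rewrite tcoef_sum.
rewrite psum tcoefB addrAC subrr sub0r abN.
have b1 := bndM (@thn_bnd K s n) lr.
have b2 : q%:R^-1 ^+ n * rho <= 1 by rewrite -ler_pdivlMr // ltW // HN3.
have h := bndM (@thp_bnd K s n) (HM _ _ (tn n) b1 b2) m; apply: le_lt_trans h _.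
have -> : q%:R ^+ n * (M * (q%:R^-1 ^+ n * rho) ^+ 2) = M * rho ^+ 2 * q%:R^-1 ^+ n.
  rewrite exprMn [(q%:R^-1 ^+ n) ^+ 2]expr2.
  have : q%:R ^+ n * q%:R^-1 ^+ n = 1 :> R by rewrite -exprMn mulfV ?expr1n // gt_eqF.
  move: (q%:R ^+ n) (q%:R^-1 ^+ n) => x y xy.
  by transitivity (M * rho ^+ 2 * y * (x * y)); [ring | rewrite xy mulr1].
apply: le_lt_trans (_ : _ <= (M * rho ^+ 2 + 1) * q%:R^-1 ^+ n) _.
  by rewrite ler_wpM2r ?exprn_ge0 // lerDl ler01.
by rewrite mulrC -ltr_pdivlMr // HN2.
Qed.

Lemma pev_gen d e l : (fun n => pev d e (gen l n)) =
  \sum_(k < d) (zconst (e k) * ztwist (Posz k) (gen l) : zs).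
Proof.
apply: funext => n; rewrite zcoef_sum; apply: eq_bigr => k _.
by rewrite zcoef_constM.
Qed.

Lemma pev_term_null e l k : e 0%N = 0 -> (forall k, tate (e k)) -> Lam l ->
  znull (zscale (zconst (e k) * ztwist (Posz k) (gen l))).
Proof.
move=> e0 te Ll; case: k => [|k].
  have -> : zconst (e 0%N) = 0 :> zs by rewrite e0; apply: funext => -[].
  by rewrite mul0r; have := @zTs0 K s; rewrite /zTs nval0.
rewrite zscaleM; apply: znullM; last exact: zTs_twist_gen.
by rewrite zscale_const znull_const.
Qed.

Lemma deRham_period e d l : tpoly e -> (forall k, (d <= k)%N -> e k = 0) -> Lam l ->
  tev (Fco e) l = \sum_(k < d) e k * qperiod k l.
Proof.
move=> pe ed Ll; have [tl _] := (Lam_iff tateA l).1 Ll; have [e0 te _] := pe.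
rewrite (deRham_zev pe ed tl) pev_gen zev_sum => [|k]; last exact: pev_term_null.
apply: eq_bigr => -[[|k] kd] _ /=; last first.
  rewrite zevM ?zev_const //; last exact: zTs_twist_gen.
  by rewrite zscale_const znull_const.
have -> : zconst (e 0%N) = 0 :> zs by rewrite e0; apply: funext => -[].
by rewrite e0 !mul0r zev0.
Qed.

Lemma zTs_finite v D : (forall n, (D <= n)%N -> nval v n = 0 :> ts) -> zTs v.
Proof.
move=> HD; apply/znullP; split=> [n|eps eps0].
  by apply: tateM; [exact: tate_thp | apply/znull_tate/nvalP].
by exists D => n Dn m; rewrite /zscale HD // mulr0 ab0.
Qed.

Lemma zTs_fixed v : fixedS v -> zTs v.
Proof. by move=> /fixedS_trunc[D HD]; apply: zTs_finite HD. Qed.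

Lemma qperiod_sum k n (v : 'I_n -> S) (l : 'I_n -> ts) : (0 < k)%N ->
  (forall i, fixedS (v i)) -> (forall i, Lam (l i)) ->
  qperiod k (\sum_i zev (nval (v i)) * l i) = \sum_i zev (nval (v i)) * qperiod k (l i).
Proof.
move=> k0 fv Ll; rewrite /qperiod (gen_sum tateA fv Ll).2 rmorph_sum /=.
have E i : ztwist (Posz k) (nval (v i) * gen (l i)) = nval (v i) * ztwist (Posz k) (gen (l i)).
  by rewrite rmorphM /= -nval_twist (tau_fixed _ (fv i)).
under eq_bigr => i _ do rewrite E.
have nz i : znull (zscale (nval (v i))) := zTs_fixed (fv i).
rewrite zev_sum => [|i]; last by rewrite zscaleM; apply: znullM => //; apply: zTs_twist_gen.
by apply: eq_bigr => i _; rewrite zevM //; apply: zTs_twist_gen.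
Qed.

Lemma deRham_sum e n (v : 'I_n -> S) (l : 'I_n -> ts) : tpoly e ->
  (forall i, fixedS (v i)) -> (forall i, Lam (l i)) ->
  tev (Fco e) (\sum_i zev (nval (v i)) * l i) = \sum_i zev (nval (v i)) * tev (Fco e) (l i).
Proof.
move=> pe fv Ll; have [e0 te [d ed]] := pe; have [Ls _] := gen_sum tateA fv Ll.
rewrite (deRham_period pe ed Ls); under [RHS]eq_bigr => i _ do rewrite (deRham_period pe ed (Ll i)) mulr_sumr.
rewrite exchange_big; apply: eq_bigr => -[[|k] kd] _ /=.
  by rewrite e0 mul0r big1 // => i _; rewrite mul0r mulr0.
by rewrite qperiod_sum // mulr_sumr; apply: eq_bigr => i _; rewrite mulrCA.
Qed.

Definition inner (m : nat -> ts) : nat -> ts :=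
  fun n => tw_mul F m (phiw th r A) n - (tw_mul F (@thetaw C th s) m n : ts).

Lemma innerE m n : inner m n =
  \sum_(k < n.+1) m k * tw k (phiw th r A (n - k)%N) - thp 1 * m n.
Proof.
congr (_ - _); first by apply: funext => i; rewrite tcoef_sum.
apply: funext => i; rewrite /tw_mul big_ord_recl /= big1 ?addr0 ?subn0 /thetaw //=.
by move=> k _; rewrite -[tmul _ _]/((0 : ts) * _) mul0r.
Qed.

Lemma phiw_large n : (r < n)%N -> phiw th r A n = 0.
Proof.
move=> rn; rewrite /phiw; have -> : (n == 0%N) = false by apply/negbTE; move: rn; lia.
by have -> : (n <= r)%N = false by apply/negbTE; rewrite -ltnNge.
Qed.

Lemma phiw_tate n : tate (phiw th r A n).
Proof.
rewrite /phiw; case: eqP => n0; first exact: tate_const.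
case: ifP => nr; last exact: tate0.
by apply: tateA; rewrite nr lt0n; move/eqP: n0 => ->.
Qed.

Lemma phiw_phi (f : ts) : phi f = \sum_(k < r.+1) phiw th r A k * tw k f.
Proof.
rewrite phiE /pev !big_ord_recl /= {1}/phib /= mul0r add0r.
rewrite /thp expr1; congr (_ + _).
Qed.

Lemma inner_large m d n : (forall k, (d <= k)%N -> m k = 0) -> (d + r <= n)%N -> inner m n = 0.
Proof.
move=> md dn; rewrite innerE md ?(leq_trans (leq_addr _ _) dn) // mulr0 subr0.
apply: big1 => k _; have [dk|kd] := leqP d k; first by rewrite md // mul0r.
by rewrite phiw_large ?rmorph0 ?mulr0 //; move: dn kd; lia.
Qed.

Lemma inner_tpoly m : tpoly m -> tpoly (inner m).
Proof.
move=> [m0 tm [d md]]; split.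
- by rewrite -[LHS]/(inner m 0) innerE big_ord_recl big_ord0 m0 mul0r mulr0 addr0 subrr.
- move=> n; rewrite innerE; apply: tateB; last by apply: tateM => //; apply: tate_thp.
  by apply: tate_sum => k _; apply: tateM => //; apply/tate_twist/phiw_tate.
by exists (d + r)%N => n dn; apply: inner_large dn.
Qed.

Lemma pev_widen d d' e (f : ts) : (d <= d')%N -> (forall k, (d <= k)%N -> e k = 0) -> pev d' e f = pev d e f.
Proof.
move=> dd ed; rewrite /pev -!(big_mkord xpredT (fun k => e k * tw k f)).
rewrite (big_cat_nat (n := d)) //= [X in _ + X]big_nat_cond [X in _ + X]big1 ?addr0 //.
by move=> k /andP[/andP[dk _] _]; rewrite ed // mul0r.
Qed.

Lemma pev_inner d m (f : ts) : (forall k, (d <= k)%N -> m k = 0) ->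
  pev (d + r) (inner m) f = pev d m (phi f) - thp 1 * pev d m f.
Proof.
move=> md; rewrite -[in X in _ - X](pev_widen f (leq_addr r d) md) /pev mulr_sumr -sumrN.
transitivity (\sum_(n < d + r) (\sum_(k < n.+1) m k * tw k (phiw th r A (n - k)%N)) * tw n f +
   \sum_(i < d + r) - (thp 1 * (m i * tw i f))).
  by rewrite -big_split; apply: eq_bigr => n _; rewrite innerE mulrBl mulrA.
congr (_ + _).
pose G k n : ts := if (k <= n)%N then m k * tw k (phiw th r A (n - k)%N) * tw n f else 0.
transitivity (\sum_(n < d + r) \sum_(k < d) G k n).
  apply: eq_bigr => n _; rewrite mulr_suml.
  transitivity (\sum_(0 <= k < maxn d n.+1) G k n).
    rewrite [RHS](big_cat_nat (n := n.+1)) ?leq_maxr //= [X in _ = _ + X]big_nat_cond [X in _ = _ + X]big1 ?addr0.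
      by rewrite big_mkord; apply: eq_bigr => -[k kn] _; rewrite /G /= -ltnS kn.
    by move=> k /andP[/andP[nk _] _]; rewrite /G leqNgt nk.
  rewrite (big_cat_nat (n := d)) ?leq_maxl //= [X in _ + X]big_nat_cond [X in _ + X]big1 ?addr0 ?big_mkord //.
  by move=> k /andP[/andP[dk _] _]; rewrite /G md // !mul0r; case: ifP.
rewrite exchange_big; apply: eq_bigr => k _.
rewrite phiw_phi rmorph_sum mulr_sumr /= -(big_mkord xpredT (G k)).
have kd : (k <= d + r)%N by rewrite (leq_trans (ltnW (ltn_ord k))) ?leq_addr.
rewrite (big_cat_nat (n := k)) //= [X in X + _]big_nat_cond [X in X + _]big1 ?add0r; last first.
  by move=> n /andP[/andP[_ nk] _]; rewrite /G leqNgt nk.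
rewrite -{1}(add0n (k : nat)) big_addn.
have rk : (r.+1 <= d + r - k)%N by have := ltn_ord k; lia.
rewrite (big_cat_nat (n := r.+1)) //= [X in _ + X]big_nat_cond [X in _ + X]big1 ?addr0 ?big_mkord.
  apply: eq_bigr => j _; rewrite /G leq_addl addnK rmorphM /= twist_comp -mulrA.
  by rewrite -PoszD addnC.
move=> n /andP[/andP[rn _] _]; rewrite /G leq_addl addnK phiw_large // rmorph0 mulr0 mul0r //.
Qed.

(** For a period, phi_theta acts on its generating series as z. Hence m phi_theta - theta m acts as
    (z - theta) m, and since m has no constant term m(gen l) converges at theta, so the product
    vanishes there. *)
Lemma deRham_inner m l : tpoly m -> Lam l -> tev (Fco (inner m)) l = 0.
Proof.
move=> pm Ll; have [m0 tm [d md]] := pm; have [tl el] := (Lam_iff tateA l).1 Ll.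
rewrite (deRham_zev (inner_tpoly pm) (d := d + r)) //; last by move=> k; apply: inner_large.
pose M : zs := fun n => pev d m (gen l n).
have nM : znull (zscale M).
  rewrite /M pev_gen; have := @zTs_sum K s _ (index_enum 'I_d) xpredT
    (fun k => toS (zconst (m k)) * toS (ztwist (Posz k) (gen l))).
  have E (k : 'I_d) : nval (toS (zconst (m k)) * toS (ztwist (Posz k) (gen l))) = zconst (m k) * ztwist (Posz k) (gen l).
    by rewrite nvalM !toSK ?znull_const //; apply: ztwist_null; apply: gen_null.
  rewrite /zTs nval_sum (eq_bigr _ (fun k _ => E k)); apply => k _.
  by rewrite E; apply: pev_term_null.
have -> : (fun n => pev (d + r) (inner m) (gen l n)) = (@zvar K s - zconst (thp 1)) * M :> zs.
  apply: funext => n; rewrite pev_inner // mulrBl zcoefB zvarM zcoef_constM; congr (_ - _).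
  have [h0 hS] := gen_phi tateA tl; case: n => [|n]; last by rewrite hS.
  by rewrite h0 el /pev big1 // => k _; rewrite rmorph0 mulr0.
have vE : @zvar K s - zconst (thp 1) = nval (svar - scst (thp 1)).
  by rewrite nvalB nval_svar (nval_cst (@tate_thp K s 1)).
have v0 n : (2 <= n)%N -> nval (svar - scst (thp 1)) n = 0 :> ts.
  by rewrite -vE; case: n => [|[|n]] // _; rewrite zcoefB /zconst /zvar /= subrr.
rewrite vE zevM //; last exact: (zTs_finite v0).
rewrite (zev_finite v0) -vE !big_ord_recl big_ord0 !zcoefB /zvar /zconst /=.
by rewrite thp0 mul1r sub0r subr0 mulr1 addr0 addNr mul0r.
Qed.

(* Subtracting an inner biderivation kills the leading coefficient because A_r is a unit. *)
Lemma deRham_reduce e : tpoly e -> exists m, [/\ tpoly m, tpoly (fun n => e n - inner m n) &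
  forall n, (r < n)%N -> e n - inner m n = 0].
Proof.
move=> pe; have [e0 te [N eN]] := pe.
elim: N e pe e0 te eN => [|N IH] e pe e0 te eN.
  exists (fun=> 0); have z n : inner (fun=> 0) n = 0.
    by rewrite innerE mulr0 subr0 big1 // => k _; rewrite mul0r.
  have pz : tpoly (fun=> 0) by split=> //; [move=> n; apply: tate0 | exists 0%N].
  split=> // [|n _]; last by rewrite z subr0 eN.
  by move: pz; congr tpoly; apply: funext => n; rewrite z subr0 eN.
have [Nr|rN] := leqP N r.
  exists (fun=> 0); have z n : inner (fun=> 0) n = 0.
    by rewrite innerE mulr0 subr0 big1 // => k _; rewrite mul0r.
  have pz : tpoly (fun=> 0) by split=> //; [move=> n; apply: tate0 | exists 0%N].
  split=> // [|n rn]; last by rewrite z subr0 eN // (leq_ltn_trans Nr).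
  by move: pe; congr tpoly; apply: funext => n; rewrite z subr0.
(* Then c tau^(N-r) times A_r tau^r is e_N tau^N; as N > r, the element c tau^(N-r) has no constant
   term and defines an inner biderivation. *)
pose c := e N * tw (N - r) B.
have tc : tate c by apply: tateM => //; apply: tate_twist.
pose m1 : nat -> ts := fun n => if n == (N - r)%N then c else 0.
have pm1 : tpoly m1.
  split; first by rewrite /m1 eq_sym subn_eq0 leqNgt rN.
    by move=> n; rewrite /m1; case: eqP => _ //; apply: tate0.
  by exists (N - r).+1 => n h; rewrite /m1 gtn_eqF.
have [i0 ti [d id]] := inner_tpoly pm1.
pose e1 : nat -> ts := fun n => e n - inner m1 n.
have e1N n : (N <= n)%N -> e1 n = 0.
  rewrite leq_eqVlt => /orP[/eqP <-|Nn]; last first.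
    rewrite /e1 eN // (@inner_large _ (N - r).+1) ?subrr //; last by rewrite addSn subnK // ltnW.
    by move=> k h; rewrite /m1 gtn_eqF.
  rewrite /e1 innerE; have lt1 : (N - r < N.+1)%N by rewrite ltnS leq_subr.
  rewrite (bigD1 (Ordinal lt1)) //= big1 ?addr0; last first.
    move=> k; rewrite -val_eqE /= => kn; rewrite /m1 (negbTE kn); exact: mul0r.
  have Nn : (N == N - r)%N = false by apply/negbTE; move: rN r_gt0; lia.
  rewrite /m1 eqxx Nn mulr0 subr0 subKn ?(ltnW rN) // /phiw gtn_eqF // leqnn /c.
  by rewrite -mulrA -rmorphM /= [B * _]mulrC AB rmorph1 mulr1 subrr.
have pe1 : tpoly e1.
  split; first by rewrite /e1 -[RHS](subrr (0 : ts)); congr (_ - _).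
    by move=> n; apply: tateB.
  by exists N.
have [e10 te1 _] := pe1.
have [m2 [pm2 p2 h2]] := IH e1 pe1 e10 te1 e1N.
have mD n : inner (fun n => m1 n + m2 n) n = inner m1 n + inner m2 n.
  rewrite !innerE mulrDr opprD addrACA -big_split /=; congr (_ + _).
  by apply: eq_bigr => k _; rewrite mulrDl.
exists (fun n => m1 n + m2 n); have E n : e n - inner (fun n => m1 n + m2 n) n = e1 n - inner m2 n.
  by rewrite mD opprD addrA.
split.
- have [a1 a2 [a3 a4]] := pm1; have [b1 b2 [b3 b4]] := pm2; split.
  + by rewrite -[RHS](addr0 (0 : ts)); congr (_ + _).
  + by move=> n; apply: tateD.
  by exists (maxn a3 b3) => n; rewrite geq_max => /andP[/a4 -> /b4 ->]; apply: (addr0 (0 : ts)).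
- by move: p2; congr tpoly; apply: funext => n; rewrite E.
by move=> n rn; rewrite E h2.
Qed.

(** A leading term m_N tau^N gives the leading term m_N tau^N(A_r) tau^(N+r), where A_r is a unit
    and N + r > r, so m = 0. Representatives of degree at most r are therefore unique. *)
Lemma inner_small_eq0 m : tpoly m -> (forall n, (r < n)%N -> inner m n = 0) -> forall n, inner m n = 0.
Proof.
move=> [m0 tm [N mN]] h; have {}mN : forall n, m n = 0.
  elim: N mN => [|N IH] mN; first by move=> n; apply: mN.
  apply: IH => n; rewrite leq_eqVlt => /orP[/eqP <-|/mN//].
  case: N mN => [//|N] mN.
  have := h (N.+1 + r)%N; rewrite addSn ltnS leq_addl => /(_ isT).
  rewrite -addSn innerE mN ?mulr0 ?subr0; last by rewrite -[X in (X <= _)%N]addn1 leq_add2l.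
  have lt1 : (N.+1 < (N.+1 + r).+1)%N by rewrite ltnS leq_addr.
  rewrite (bigD1 (Ordinal lt1)) //= big1 ?addr0 => [|k]; last first.
    rewrite -val_eqE /= neq_ltn => /orP[kN|Nk]; last by rewrite mN // mul0r.
    by rewrite phiw_large ?rmorph0 ?mulr0 //; move: kN; lia.
  rewrite addKn /phiw gtn_eqF // leqnn => /(congr1 (fun g : ts => g * tw N.+1 B)).
  by rewrite -mulrA -rmorphM /= AB rmorph1 mulr1 mul0r.
by move=> n; rewrite innerE mN mulr0 subr0 big1 // => k _; rewrite mN mul0r.
Qed.

End DeRham.

(** * The equivalences *)

Section Equivalences.
Variables (K : cinf) (s r : nat).
Local Notation F := (cF K).
Local Notation C := (cC K).
Local Notation R := (cR K).
Local Notation io := (@cio K).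
Local Notation th := (@cth K).
Local Notation ab := (@cab K).
Local Notation ts := (@tser (cC K) s).
Local Notation zs := (@zser (cC K) s).
Local Notation S := (nser K s).
Local Notation tate := (@Defs.tate C R ab s).
Local Notation tau n := (@stwist K s (Posz n)).
Variables (A : nat -> ts) (B : ts).
Hypothesis tateA : forall i, (1 <= i <= r)%N -> tate (A i).
Hypothesis r_gt0 : (0 < r)%N.
Hypothesis tate_B : tate B.
Hypothesis AB : A r * B = 1.
Local Notation thp := (@thp K s).
Local Notation thn := (@thn K s).
Local Notation scst := (@scst K s).
Local Notation svar := (@svar K s).
Local Notation moore := (@moore K s r).
Local Notation moore_basis := (@moore_basis K s r A).
Implicit Types (f : S).

Local Notation trivW := (@trivW K s r A).

Local Notation zTs := (@zTs K s).
Local Notation Exp := (@Exp K s r A).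
Local Notation Lam := (Lambda F th ab r A).
Local Notation gen := (@gen K s r A).
Local Notation Fco := (@Fco F C th s r A).
Local Notation tpoly := (@taupoly C R ab s).

Local Notation qperiod := (@qperiod K s r A).
Local Notation inner := (@inner K s r A).
Local Notation Ato := (@inAt F C io th s).
Local Notation Fto := (@inFt F C io s).
Local Notation tau_mx := (map_mx (tau 1)).

Lemma fixedS_sub (a b : S) : fixedS a -> fixedS b -> fixedS (a - b).
Proof. by rewrite /fixedS rmorphB /= => -> ->. Qed.
Lemma fixedS_mul (a b : S) : fixedS a -> fixedS b -> fixedS (a * b).
Proof. by rewrite /fixedS rmorphM /= => -> ->. Qed.
Lemma zev_sub (a b : S) : zTs a -> zTs b -> zev (nval (a - b)) = zev (nval a) - zev (nval b).
Proof.
move=> za zb; have zb' : zTs (- b) by rewrite /zTs nvalN zscaleN; apply: znullN.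
by rewrite nvalD zevD // nvalN zevN.
Qed.
Lemma zev_mul (a b : S) : zTs a -> zTs b -> zev (nval (a * b)) = zev (nval a) * zev (nval b).
Proof. by move=> za zb; rewrite nvalM zevM. Qed.

Lemma Ato_sub (x y : ts) : Ato x -> Ato y -> Ato (x - y).
Proof.
move=> /inAt_zev[v fv ->] /inAt_zev[w fw ->].
by rewrite -zev_sub; try exact: zTs_fixed; apply: zev_inAt; apply: fixedS_sub.
Qed.
Lemma Ato_mul (x y : ts) : Ato x -> Ato y -> Ato (x * y).
Proof.
move=> /inAt_zev[v fv ->] /inAt_zev[w fw ->].
by rewrite -zev_mul; try exact: zTs_fixed; apply: zev_inAt; apply: fixedS_mul.
Qed.
Lemma Ato0 : Ato 0.
Proof. by rewrite -(zev0 K s) -(@nval0 K s); apply: zev_inAt; rewrite /fixedS rmorph0. Qed.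
Lemma Ato1 : Ato 1.
Proof.
rewrite -[1](@zev_const K s) -[zconst 1]/(1 : zs) -(@nval1 K s).
by apply: zev_inAt; rewrite /fixedS rmorph1.
Qed.
Lemma Ato_add (x y : ts) : Ato x -> Ato y -> Ato (x + y).
Proof. by move=> hx hy; rewrite -[y]opprK -[- y]sub0r; apply: Ato_sub => //; apply: Ato_sub => //; exact: Ato0. Qed.
Lemma Ato_tate (x : ts) : Ato x -> tate x.
Proof. by move=> /inAt_zev[v fv ->]; apply: zev_tate; apply: zTs_fixed. Qed.

Lemma Lam_mul (a l : ts) : Ato a -> Lam l -> Lam (a * l).
Proof. by move=> /inAt_zev[v fv ->] Ll; case: (gen_fixed tateA fv Ll). Qed.

Definition lattice_basis n (l : 'I_n -> ts) := [/\ forall i, Lam (l i),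
  forall x, Lam x -> exists c : 'I_n -> ts, (forall i, Ato (c i)) /\ x = \sum_i c i * l i
  & forall c : 'I_n -> ts, (forall i, Ato (c i)) -> \sum_i c i * l i = 0 -> forall i, c i = 0].

Lemma free_rank_basis n : free_rank Ato Lam n <-> exists l : 'I_n -> ts, lattice_basis l.
Proof.
split=> -[l [h1 h2 h3]]; exists l; split=> //.
- by move=> x /h2[c [ac xc]]; exists c; rewrite xc tsumE.
- by move=> c ac e; apply: h3 => //; rewrite tsumE.
- by move=> x /h2[c [ac xc]]; exists c; rewrite xc tsumE.
by move=> c ac; rewrite tsumE => e; apply: h3.
Qed.

Lemma lattice_basis_unique n (l : 'I_n -> ts) (c d : 'I_n -> ts) : lattice_basis l ->
  (forall i, Ato (c i)) -> (forall i, Ato (d i)) ->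
  \sum_i c i * l i = \sum_i d i * l i -> forall i, c i = d i.
Proof.
move=> [_ _ indep] ac ad e i; apply/eqP; rewrite -subr_eq0; apply/eqP.
apply: (indep (fun i => c i - d i)) => [j|]; first exact: Ato_sub.
by under eq_bigr => j _ do rewrite mulrBl; rewrite sumrB e subrr.
Qed.

Lemma lattice_basis_zev n (l : 'I_n -> ts) x : lattice_basis l -> Lam x ->
  exists v : 'I_n -> S, (forall i, fixedS (v i)) /\ x = \sum_i zev (nval (v i)) * l i.
Proof.
move=> [_ span _] /span[c [ac ->]].
have /choice[v Hv] i : exists v : S, fixedS v /\ c i = zev (nval v).
  by have [v] := inAt_zev (ac i); exists v.
exists v; split=> [i|]; first by case: (Hv i).
by apply: eq_bigr => i _; rewrite (proj2 (Hv i)).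
Qed.

Lemma lattice_basis_moore (l : 'I_r -> ts) : lattice_basis l -> moore_basis (fun i => toS (gen (l i))).
Proof. by move=> [h1 h2 h3]; apply: (lattice_moore_basis tateA r_gt0 tate_B AB). Qed.

Lemma lattice_RAT : free_rank Ato Lam r -> has_RAT F th ab r A B.
Proof. by move=> /free_rank_basis[l /lattice_basis_moore]; apply: basis_RAT. Qed.

Lemma deRham_mx e l : tpoly e -> (forall k, (r < k)%N -> e k = 0) -> Lam l ->
  tev (Fco e) l = \sum_(j < r) qperiod (r - j) l * e (r - j)%N.
Proof.
move=> pe er Ll; have [e0 _ _] := pe.
rewrite (deRham_period tateA pe er Ll) big_ord_recl e0 mul0r add0r.
rewrite (reindex_inj rev_ord_inj) /=; apply: eq_bigr => j _.
have -> : bump 0 (r - j.+1) = (r - j)%N by rewrite /bump /=; have := ltn_ord j; lia.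
exact: mulrC.
Qed.

Lemma deRham_sub e1 e2 l : tpoly e1 -> tpoly e2 -> tpoly (fun n => e1 n - e2 n) -> Lam l ->
  tev (Fco (fun n => e1 n - e2 n)) l = tev (Fco e1) l - tev (Fco e2) l.
Proof.
move=> p1 p2 p12 Ll; have [_ _ [d1 h1]] := p1; have [_ _ [d2 h2]] := p2.
have h1' k : (maxn d1 d2 <= k)%N -> e1 k = 0 by rewrite geq_max => /andP[/h1].
have h2' k : (maxn d1 d2 <= k)%N -> e2 k = 0 by rewrite geq_max => /andP[_ /h2].
have h12 k : (maxn d1 d2 <= k)%N -> e1 k - e2 k = 0 by move=> h; rewrite h1' // h2' // subrr.
rewrite (deRham_period tateA p1 h1' Ll) (deRham_period tateA p2 h2' Ll).
rewrite (deRham_period tateA p12 h12 Ll) -sumrB.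
by apply: eq_bigr => k _; rewrite mulrBl.
Qed.

Lemma tpoly_sub e1 e2 : tpoly e1 -> tpoly e2 -> tpoly (fun n => e1 n - e2 n).
Proof.
move=> [a1 b1 [d1 h1]] [a2 b2 [d2 h2]]; split.
- by rewrite a1 a2; apply: (subrr (0 : ts)).
- by move=> n; apply: tateB.
by exists (maxn d1 d2) => n; rewrite geq_max => /andP[/h1 -> /h2 ->]; apply: (subrr (0 : ts)).
Qed.

Lemma deRham_normal e : tpoly e -> exists e', [/\ tpoly e', forall k, (r < k)%N -> e' k = 0,
  exists m, tpoly m /\ (forall n, e n = e' n + inner m n) &
  forall l, Lam l -> tev (Fco e') l = tev (Fco e) l].
Proof.
move=> pe; have [m [pm pe' he']] := deRham_reduce tateA r_gt0 tate_B AB pe.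
exists (fun n => e n - inner m n); split=> //.
  by exists m; split=> // n; rewrite subrK.
move=> l Ll; rewrite deRham_sub //; last exact: inner_tpoly.
by rewrite deRham_inner // subr0.
Qed.

(** In representatives of degree at most r, the de Rham map is the quasi-period matrix D, which is
    tau(moore f) at z = theta. Its inverse in S is trivW Psi, and convergence of Psi at |z| = q
    allows the identity to be evaluated at theta. *)
Lemma RAT_deRham : has_RAT F th ab r A B -> DR_iso io th ab r A.
Proof.
move=> [Psi [Psi' [zt e1 e2 e3]]].
have [f Uf fE] := RAT_moore_basis tateA r_gt0 tate_B AB zt e1 e2 e3.
have [l [Ll fl]] := moore_basis_log tateA Uf.
have span := moore_basis_gen tateA r_gt0 tate_B AB Uf Ll fl.
have [P hP] : exists P : 'M[S]_r, forall i j, nval (P i j) = Psi i j.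
  exists (\matrix_(i, j) toS (Psi i j)) => i j; rewrite mxE toSK //.
  by apply: zTate_znull; case: (zt i j).
pose N := tau_mx (moore f).
have NQ : N *m (trivW *m P) = 1%:M.
  rewrite mulmxA; apply/matrixP => i j; apply: nval_inj.
  rewrite (nval_mx (P' := Psi') _ hP); last first.
    by move=> i' j'; rewrite /N moore_trivW.
  by rewrite e2 mxE /mxone; case: eqP => _; rewrite ?nval1 // nval0; apply: funext => -[].
have NE i j : nval (N i j) = ztwist (Posz (r - j)) (gen (l i)).
  rewrite !mxE tau_comp nval_twist fl; congr (ztwist _ _).
  by have := ltn_ord j; lia.
have zN i j : zTs (N i j).
  by rewrite /zTs NE; apply: zTs_twist_gen => //; rewrite subn_gt0.
have zQ i j : zTs ((trivW *m P) i j).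
  rewrite mxE; apply: zTs_sum => k _; apply: zTsM; last first.
    by rewrite /zTs hP; apply/zTateE; case: (zt k j).
  rewrite mxE; case: ifP => _; last exact: zTs0.
  by rewrite stwist_cst; [apply/zTs_cst/tate_twist/tate_phib | exact: tate_phib].
pose D : 'M[ts]_r := \matrix_(i, j) qperiod (r - j) (l i).
pose E : 'M[ts]_r := \matrix_(i, j) zev (nval ((trivW *m P) i j)).
have DE : D *m E = 1%:M.
  apply/matrixP => i j; move/matrixP: NQ => /(_ i j); rewrite mxE => /(congr1 (fun x => zev (nval x))).
  have -> : zev (nval ((1%:M : 'M[S]_r) i j)) = (1%:M : 'M[ts]_r) i j.
    rewrite !mxE; case: eqP => _; last by rewrite nval0 zev0.
    by rewrite nval1 -[1]/(zconst (1 : ts)) zev_const.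
  move=> <-; rewrite mxE nval_sum zev_sum => [|k].
    by apply: eq_bigr => k _; rewrite zev_mul // [D _ _]mxE [E _ _]mxE /qperiod -NE.
  by have := zTsM (zN i k) (zQ k j).
have ED : E *m D = 1%:M by apply: mulmx1C.
split.
  move=> a1 a2 p1 p2 h; have p12 := tpoly_sub p1 p2.
  have [e' [pe' he' [m [pm em]] Fe']] := deRham_normal p12.
  exists m; split=> // n; rewrite tsubE em -[RHS]add0r; congr (_ + _).
  have z i : tev (Fco e') (l i) = 0.
    have [g [g1 g2]] := h (l i) (Ll i); have [tl _] := (Lam_iff tateA _).1 (Ll i).
    rewrite Fe' // deRham_sub // -((FevE tateA g p1 tl).1 g1) -((FevE tateA g p2 tl).1 g2) subrr //.
  have Dz : D *m (\col_j e' (r - j)%N) = 0.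
    apply/colP => i; transitivity (tev (Fco e') (l i)); last by rewrite z mxE.
    by rewrite deRham_mx // mxE; apply: eq_bigr => j _; rewrite !mxE.
  have e0 : \col_(j < r) e' (r - j)%N = 0 by rewrite -[LHS]mul1mx -ED -mulmxA Dz mulmx0.
  have [n0|n0] := eqVneq n 0%N; first by rewrite n0; case: pe'.
  have [nr|/he'//] := leqP n r; have lt1 : (r - n < r)%N by move: nr n0; lia.
  by move/colP: e0 => /(_ (Ordinal lt1)); rewrite !mxE /= subKn.
move=> h [th' Ah].
pose x : 'cV[ts]_r := E *m \col_i h (l i).
(* The coordinate j is the coefficient of tau^(r-j); the guard keeps the index given to [insub] in
   range. *)
pose e : nat -> ts := fun k => if (0 < k <= r)%N then
  (if insub (r - k)%N is Some j then x j ord0 else 0) else 0.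
have tx j : tate (x j ord0).
  rewrite mxE; apply: tate_sum => i _; apply: tateM; last by rewrite mxE; apply: th'.
  by rewrite [E _ _]mxE; apply: zev_tate; apply: zQ.
have pe : tpoly e.
  split=> // [k|].
    by rewrite /e; case: ifP => _; [case: insubP => [j _ _|_]; [exact: tx | exact: tate0] | exact: tate0].
  by exists r.+1 => k rk; rewrite /e [(k <= r)%N]leqNgt rk andbF.
have er k : (r < k)%N -> e k = 0 by move=> rk; rewrite /e [(k <= r)%N]leqNgt rk andbF.
have ex (j : 'I_r) : e (r - j)%N = x j ord0.
  rewrite /e subn_gt0 ltn_ord leq_subr /= subKn; last exact: ltnW.
  by rewrite insubT //= => jr; congr (x _ _); apply: val_inj.
have eh i : tev (Fco e) (l i) = h (l i).
  rewrite deRham_mx //; have : D *m x = \col_i h (l i) by rewrite mulmxA DE mul1mx.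
  move/colP => /(_ i); rewrite [RHS]mxE => <-; rewrite [RHS]mxE.
  by apply: eq_bigr => j _; rewrite ex [D _ _]mxE.
exists e; split=> // y Ly; have [ty _] := (Lam_iff tateA y).1 Ly.
apply/FevE => //; have [c [fc ->]] := span y Ly.
rewrite deRham_sum //; under [RHS]eq_bigr => i _ do rewrite eh.
have hA a b u v : Ato a -> Ato b -> Lam u -> Lam v -> h (a * u + b * v) = a * h u + b * h v.
  by move=> aa ab' Lu Lv; have := Ah a b u v aa ab' Lu Lv; rewrite !tmul_mulE.
have hD u v : Lam u -> Lam v -> h (u + v) = h u + h v.
  by move=> Lu Lv; have := hA 1 1 u v Ato1 Ato1 Lu Lv; rewrite !mul1r.
have h0 : h 0 = 0.
  have e0 := hD 0 0 (Lam0 tateA) (Lam0 tateA); have z00 : (0 : ts) + 0 = 0 := addr0 _.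
  by rewrite z00 in e0; apply: (addIr (h 0)); rewrite -[LHS]e0 add0r.
have hZ a u : Ato a -> Lam u -> h (a * u) = a * h u.
  by move=> aa Lu; have := hA a 0 u u aa Ato0 Lu Lu; rewrite !mul0r !addr0.
suff [-> _] : h (\sum_i zev (nval (c i)) * l i) = \sum_i zev (nval (c i)) * h (l i) /\
  Lam (\sum_i zev (nval (c i)) * l i) by [].
elim/big_rec2: _ => [|i u v _ [IH Lv]]; first by split; [exact: h0 | exact: Lam0].
have La := zev_inAt (fc i).
by split; [rewrite hD ?hZ ?IH //; apply: Lam_mul | apply: LamD => //; apply: Lam_mul].
Qed.

(** Surjectivity applied to the n coordinate functions gives a one-sided inverse E of the r by n
    quasi-period matrix D. Injectivity and uniqueness of representatives of degree at most r make it
    two-sided, so the sizes agree. *)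
Lemma deRham_rank n : free_rank Ato Lam n -> DR_iso io th ab r A -> n = r.
Proof.
move=> /free_rank_basis[l bl] [inj surj]; have [Ll span indep] := bl.
(* Homomorphisms are total functions on series, so coordinates are chosen everywhere, with arbitrary
   values off the lattice. *)
have /choice[co Hco] x : exists c : 'I_n -> ts, Lam x -> (forall i, Ato (c i)) /\ x = \sum_i c i * l i.
  by have [/span[c Hc]|nL] := pselect (Lam x); [exists c | exists (fun=> 0)].
have hom i : AHom io th ab r A (fun x => co x i).
  split=> [x Lx|a b x y aa ab' Lx Ly]; first by apply/Ato_tate; case: (Hco x Lx).
  have [ax ex] := Hco x Lx; have [ay ey] := Hco y Ly.
  have Lxy : Lam (a * x + b * y) by apply: LamD => //; apply: Lam_mul.
  have [axy exy] := Hco _ Lxy.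
  apply: (lattice_basis_unique (c := co (a * x + b * y)) (d := fun i => a * co x i + b * co y i) bl axy) => [j|].
    by apply: Ato_add; apply: Ato_mul.
  rewrite -exy {1}ex {1}ey !mulr_sumr -big_split; apply: eq_bigr => j _ /=.
  by rewrite mulrDl !mulrA.
have /choice[e He] i : exists e : nat -> ts, [/\ tpoly e, forall k, (r < k)%N -> e k = 0 &
    forall x, Lam x -> tev (Fco e) x = co x i].
  have [eta [peta Heta]] := surj _ (hom i); have [e' [pe' he' _ Fe']] := deRham_normal peta.
  exists e'; split=> // x Lx; rewrite Fe' //.
  have [tx _] := (Lam_iff tateA x).1 Lx.
  by apply/esym/(FevE tateA _ peta tx)/Heta.
pose E : 'M[ts]_(n, r) := \matrix_(i, j) e i (r - j)%N.
pose D : 'M[ts]_(r, n) := \matrix_(j, i) qperiod (r - j) (l i).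
have ED : E *m D = 1%:M.
  apply/matrixP => i j; have [pe he Fe] := He i.
  transitivity (co (l j) i).
    rewrite -Fe // deRham_mx // mxE; apply: eq_bigr => k _; rewrite !mxE; exact: mulrC.
  have [aj ej] := Hco _ (Ll j); rewrite mxE.
  apply: (lattice_basis_unique (d := fun k => (k == j)%:R) bl aj) => [k|].
    by case: eqP => _; [exact: Ato1 | exact: Ato0].
  rewrite -ej (bigD1 j) //= eqxx mul1r big1 ?addr0 // => k /negbTE ->.
  by rewrite mul0r.
have DE : D *m E = 1%:M.
  apply/matrixP => j j'.
  (* tau^(r-j) minus the combination of the e_i with the same values on the basis: it vanishes on
     all periods, hence is inner, and its degree is at most r, hence it is zero. *)
  pose ep : nat -> ts := fun k => (k == (r - j)%N)%:R - \sum_i D j i * e i k.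
  have tD i : tate (D j i).
    by rewrite mxE; apply: zev_tate; apply: zTs_twist_gen => //; rewrite subn_gt0.
  have pep : tpoly ep.
    split.
    - rewrite /ep big1 => [|i _]; last by have [[-> _ _] _ _] := He i; apply: mulr0.
      by rewrite subr0 eq_sym gtn_eqF ?subn_gt0.
    - move=> k; apply: tateB; first by case: eqP => _; [exact: tate1 | exact: tate0].
      by apply: tate_sum => i _; apply: tateM => //; have [[_ te _] _ _] := He i.
    exists r.+1 => k rk; rewrite /ep big1 => [|i _]; last by have [_ -> // _] := He i; apply: mulr0.
    by rewrite subr0 gtn_eqF // (leq_ltn_trans (leq_subr _ _)).
  have epr k : (r < k)%N -> ep k = 0.
    move=> rk; rewrite /ep big1 => [|i _]; last by have [_ -> // _] := He i; apply: mulr0.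
    by rewrite subr0 gtn_eqF // (leq_ltn_trans (leq_subr _ _)).
  have epl i : tev (Fco ep) (l i) = 0.
    rewrite deRham_mx // /ep.
    under eq_bigr => k _ do rewrite mulrBr.
    rewrite sumrB (bigD1 j) //= eqxx mulr1 big1 ?addr0; last first.
      move=> k kj; have -> : ((r - k == r - j)%N) = false; last exact: mulr0.
      by apply/negbTE; move: kj; rewrite -val_eqE /=; have := ltn_ord k; have := ltn_ord j; lia.
    have -> : \sum_(k < r) qperiod (r - k) (l i) * (\sum_i0 D j i0 * e i0 (r - k)%N) = (D *m (E *m D)) j i.
      under eq_bigr => k _ do rewrite mulr_sumr.
      rewrite exchange_big [RHS]mxE; apply: eq_bigr => i0 _; rewrite [(E *m D) _ _]mxE mulr_sumr.
      by apply: eq_bigr => k _; rewrite [E _ _]mxE [D k i]mxE; ring.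
    by rewrite ED mulmx1 mxE subrr.
  have ep0 x : Lam x -> tev (Fco ep) x = 0.
    move=> /(lattice_basis_zev bl)[v [fv ->]]; rewrite deRham_sum // big1 // => i _.
    by rewrite epl mulr0.
  have pz : tpoly (fun=> 0) by split=> //; [move=> k; exact: tate0 | exists 0%N].
  have [|m [pm em]] := inj ep (fun=> 0) pep pz.
    move=> x Lx; have [tx _] := (Lam_iff tateA x).1 Lx; exists 0; split; apply/FevE => //.
      by rewrite ep0.
    by rewrite (deRham_period tateA (d := 0) pz) // big_ord0.
  have em' k : inner m k = ep k.
    by have := em k; rewrite tsubE subr0.
  have z := inner_small_eq0 r_gt0 AB pm (fun k rk => etrans (em' k) (epr k rk)).
  have := em' (r - j')%N; rewrite z /ep => /esym/eqP; rewrite subr_eq0 => /eqP e0.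
  rewrite !mxE; under eq_bigr => i _ do rewrite [E _ _]mxE.
  rewrite -e0; congr (_%:R); congr nat_of_bool.
  rewrite -val_eqE /=; apply/eqP/eqP; have := ltn_ord j; have := ltn_ord j'; lia.
by apply/eqP; rewrite eqn_leq (mulmx1_min ED) (mulmx1_min DE).
Qed.

Lemma lattice_uniformizable : free_rank Ato Lam r -> uniformizable F th ab r A.
Proof.
move=> /free_rank_basis[l /lattice_basis_moore Ul] g tg.
have [x [tx ex]] := moore_basis_uniformizable tateA r_gt0 tate_B AB Ul tg.
by exists x; split=> //; apply/expRE.
Qed.

(** The torsion is the quotient of the lattice by theta, through l |-> exp(l / theta). If x =
    exp(y), then theta y is a period, and the constant terms in z of its coordinates are the
    coordinates of x. The rank n is not assumed to be r, which is what the return from (d) to (a)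
    requires. *)
Lemma torsion_basis n : free_rank Ato Lam n -> uniformizable F th ab r A ->
  free_rank Fto (phi_torsion F th ab r A) n.
Proof.
move=> /free_rank_basis[l bl] unif; have [Ll span indep] := bl.
have tl i : tate (l i) by case/(Lam_iff tateA): (Ll i).
have tnl i : tate (thn 1 * l i) by apply: tateM => //; apply: tate_thn.
have ExpZ (c x : ts) : Fto c -> tate x -> Exp (c * x) = c * Exp x.
  move=> /inFtP[tc fc] tx; apply: tevZ => //; first exact: alpha_entire.
  by move=> k; apply: twist_fixed.
have Expsum (c : 'I_n -> ts) : (forall i, Fto (c i)) ->
    Exp (\sum_i c i * (thn 1 * l i)) = \sum_i c i * Exp (thn 1 * l i).
  move=> Fc; rewrite (additive_sum (ExpD tateA)) => [|i _].
    by apply: eq_bigr => i _; apply: ExpZ.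
  by apply: tateM => //; case/inFtP: (Fc i).
exists (fun i => Exp (thn 1 * l i)); split.
- move=> i; split; first exact: Exp_tate.
  rewrite -[LHS](Exp_thp1 tateA (tnl i)) mulrA thpnK mul1r.
  by case/(Lam_iff tateA): (Ll i).
- move=> x [tx px]; have [y [ty /(expRE tateA _ ty) xy]] := unif x tx.
  have Ly : Lam (thp 1 * y).
    apply/(Lam_iff tateA); split; first by apply: tateM => //; apply: tate_thp.
    by rewrite (Exp_thp1 tateA ty) -xy.
  have [v [fv ev]] := lattice_basis_zev bl Ly.
  have tv i : tate (nval (v i) 0%N) := znull_tate 0 (nvalP (v i)).
  have ns i : znull (fun n => nval (v i) n.+1).
    by move=> e e0; have [N HN] := nvalP (v i) e0; exists N => k m h; apply: HN; rewrite leqW.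
  pose v' i : S := toS (fun n => nval (v i) n.+1).
  have fv' i : fixedS (v' i).
    apply: nval_inj; rewrite nval_twist toSK //; apply: funext => k.
    exact: (@fixedS_coef K s (v i) k.+1 (fv i)).
  have vE i : zev (nval (v i)) = nval (v i) 0%N + thp 1 * zev (nval (v' i)).
    have [d Hd] := fixedS_trunc (fv i).
    rewrite (@zev_finite K s (nval (v i)) d.+1) => [|k dk]; last by rewrite Hd // ltnW.
    rewrite big_ord_recl thp0 mul1r; congr (_ + _).
    rewrite toSK // (@zev_finite K s _ d) => [|k dk]; last by rewrite Hd // leqW.
    by rewrite mulr_sumr; apply: eq_bigr => k _; rewrite /= /bump /= add1n -add1n thpD mulrA.
  have Fv i : Fto (nval (v i) 0%N) by apply/inFtP; split=> //; apply: fixedS_coef.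
  exists (fun i => nval (v i) 0%N); split=> //; rewrite tsumE.
  have Ls : Lam (\sum_i zev (nval (v' i)) * l i) := (gen_sum tateA fv' Ll).1.
  have [ts0 es0] := (Lam_iff tateA _).1 Ls.
  have -> : x = Exp (\sum_i nval (v i) 0%N * (thn 1 * l i) + \sum_i zev (nval (v' i)) * l i).
    rewrite xy; congr Exp; rewrite -big_split /=.
    have -> : y = thn 1 * (thp 1 * y) by rewrite mulrA [thn 1 * _]mulrC thpnK mul1r.
    rewrite ev mulr_sumr; apply: eq_bigr => i _.
    by rewrite vE mulrDl mulrDr mulrCA; congr (_ + _); rewrite !mulrA [thn 1 * _]mulrC thpnK mul1r.
  rewrite ExpD // ?es0 ?addr0 ?Expsum //.
  by apply: tate_sum => i _; apply: tateM.
move=> c Fc; rewrite tsumE => e0 i.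
have tc j : tate (c j) by case/inFtP: (Fc j).
have Ls : Lam (\sum_j c j * (thn 1 * l j)).
  apply/(Lam_iff tateA); split; first by apply: tate_sum => j _; apply: tateM.
  by rewrite Expsum.
have [w [fw ew]] := lattice_basis_zev bl Ls.
have nc j : nval (scst (c j)) = zconst (c j) := nval_cst (tc j).
(* The relation gives c_j - theta w_j(theta) = 0. Its lift c_j - z w_j vanishes by injectivity of
   evaluation on F_q[t, z], and its constant coefficient in z is c_j. *)
pose v j : S := scst (c j) - svar * w j.
have fv j : fixedS (v j).
  apply: fixedS_sub; last by apply: fixedS_mul => //; apply: svar_fixed.
  by rewrite /fixedS stwist_cst //; case/inFtP: (Fc j) => _ ->.
have zv j : zev (nval (v j)) = c j - thp 1 * zev (nval (w j)).
  rewrite zev_sub; [|exact: zTs_cst|apply: zTs_fixed; apply: fixedS_mul => //; apply: svar_fixed].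
  rewrite nc zev_const zev_mul; [|apply: zTs_fixed; apply: svar_fixed|exact: zTs_fixed].
  rewrite nval_svar; have -> : zev (@zvar K s) = thp 1; last by [].
  by rewrite (@zev_finite K s _ 2) => [|[|[|k]]//]; rewrite !big_ord_recl big_ord0 /zvar /= mulr0 add0r mulr1 addr0.
have : zev (nval (v i)) = 0.
  apply: (indep (fun j => zev (nval (v j)))) => [j|]; first exact: zev_inAt.
  under eq_bigr => j _ do rewrite zv mulrBl -mulrA.
  rewrite sumrB -mulr_sumr -ew mulr_sumr -sumrB big1 // => j _.
  have -> : thp 1 * (c j * (thn 1 * l j)) = (thp 1 * thn 1) * (c j * l j) by ring.
  by rewrite thpnK mul1r subrr.
move=> /(zev_fixed_inj (fv i)) /(congr1 (fun a : S => nval a 0%N)).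
rewrite /v nvalB nval0 nc nvalM nval_svar zcoefB zvarM subr0.
by [].
Qed.

(** Transition matrices between two bases are mutually inverse by independence; their sizes are
    compared over the commutative ring of all power series in t. *)
Lemma Fto_rank_unique M n p : free_rank Fto M n -> free_rank Fto M p -> n = p.
Proof.
have Fsum I (t : seq I) (u : I -> ts) : (forall i, Fto (u i)) -> Fto (\sum_(i <- t) u i).
  move=> Fu; apply/inFtP; split; first by apply: tate_sum => i _; case/inFtP: (Fu i).
  by rewrite rmorph_sum; apply: eq_bigr => i _; case/inFtP: (Fu i).
have FM x y : Fto x -> Fto y -> Fto (x * y).
  move=> /inFtP[tx fx] /inFtP[ty fy]; apply/inFtP; split; first exact: tateM.
  by rewrite rmorphM /= fx fy.
have FB x y : Fto x -> Fto y -> Fto (x - y).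
  move=> /inFtP[tx fx] /inFtP[ty fy]; apply/inFtP; split; first exact: tateB.
  by rewrite rmorphB /= fx fy.
have F01 (t : bool) : Fto t%:R.
  apply/inFtP; split; first by case: t; [exact: tate1 | exact: tate0].
  by rewrite rmorph_nat.
have main n' p' : free_rank Fto M n' -> free_rank Fto M p' -> (n' <= p')%N.
  move=> [b [Mb sb ib]] [d [Md sd id]].
  have /choice[c Hc] i := sb _ (Md i); have /choice[e He] i := sd _ (Mb i).
  pose X : 'M[ts]_(n', p') := \matrix_(i, j) e i j.
  pose Y : 'M[ts]_(p', n') := \matrix_(i, j) c i j.
  apply: (@mulmx1_min _ _ _ X Y); apply/matrixP => i j.
  apply/eqP; rewrite -subr_eq0; apply/eqP.
  apply: (ib (fun j => (X *m Y) i j - (1%:M : 'M[ts]_n') i j)) => [k|].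
    apply: FB; last by rewrite mxE; apply: F01.
    by rewrite mxE; apply: Fsum => m; apply: FM; rewrite mxE; [case: (He i) | case: (Hc m)].
  rewrite tsumE; under eq_bigr => k _ do rewrite tmul_mulE mulrBl.
  rewrite sumrB; apply/eqP; rewrite subr_eq0; apply/eqP.
  transitivity (b i).
    have [_ ->] := He i; rewrite tsumE.
    under [RHS]eq_bigr => m _ do rewrite (proj2 (Hc m)) tsumE tmul_mulE mulr_sumr.
    rewrite exchange_big; apply: eq_bigr => k _; rewrite mxE mulr_suml.
    by apply: eq_bigr => m _; rewrite !mxE tmul_mulE mulrA.
  rewrite (bigD1 i) //= mxE eqxx mul1r big1 ?addr0 // => k ki.
  by rewrite mxE eq_sym (negbTE ki) mul0r.
by move=> h1 h2; apply/eqP; rewrite eqn_leq !main.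
Qed.

End Equivalences.

Theorem theorem7p1 (F : finFieldType) (C : closedFieldType) (R : realType)
    (iota : {rmorphism F -> C}) (theta : C) (abs : C -> R)
    (s r : nat) (A : nat -> @tser C s) (B : @tser C s) :
  is_Cinf iota theta abs ->
  (0 < r)%N ->
  (forall i, (1 <= i <= r)%N -> tate abs (A i)) ->
  tate abs B -> tmul (A r) B = @tone C s ->
  (exists n, free_rank (@inAt F C iota theta s) (@Lambda F C R theta abs s r A) n) ->
  [<-> free_rank (@inAt F C iota theta s) (@Lambda F C R theta abs s r A) r;
       @has_RAT F C R theta abs s r A B;
       @DR_iso F C R iota theta abs s r A;
       @uniformizable F C R theta abs s r A /\
         free_rank (@inFt F C iota s) (@phi_torsion F C R theta abs s r A) r].
Proof.
move=> HC r_gt0 tateA tate_B AB [n free_n]; pose K := Cinf HC.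
have rank := @deRham_rank K s r A B tateA r_gt0 tate_B AB n free_n.
tfae.
- exact: (@lattice_RAT K s r A B tateA r_gt0 tate_B AB).
- exact: (@RAT_deRham K s r A B tateA r_gt0 tate_B AB).
(* The passage from (c) to (d) goes through (a): the ranks are compared first. *)
- move=> /rank e; rewrite e in free_n.
  have unif := @lattice_uniformizable K s r A B tateA r_gt0 tate_B AB free_n.
  by split=> //; apply: (@torsion_basis K s r A tateA r).
move=> [unif tors].
(* Uniformizability alone makes the torsion free of the rank n of the lattice. *)
have e := @Fto_rank_unique K s _ n r (@torsion_basis K s r A tateA n free_n unif) tors.
by rewrite e in free_n.
Qed.
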